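(* Suppose $h_i:=-\sum_{g\in\Gamma_i}\mu_i(g)\log\mu_i(g)<\infty$ for all $i\in\mathcal I$ (with $0\log 0:=0$). Then the asymptotic entropy $h=\lim_{n\to\infty}\frac1n\mathbb{E}[-\log\pi_n(X_n)]$ of the random walk $(X_n)_{n\ge0}$ on the free product of groups $\Gamma=\Gamma_1\ast\dots\ast\Gamma_r$ is given by $$h=-\sum_{i\in\mathcal I}\sum_{g\in\Gamma_i}\alpha_i\mu_i(g)\Bigl[\bigl(1-\varrho(i)\bigr)\log F_i(o_i,g|\xi_i)+(1-\xi_i)\,G_i(o_i,o_i|\xi_i)\,\mathcal F(g)\Bigr],$$ where $\varrho(i)=1-(1-\xi_i)G_i(o_i,o_i|\xi_i)$ and, for $g\in\Gamma_i$, $$\mathcal F(g)=\sum_{g'\in\Gamma_i^\times}F_i(o_i,g'|\xi_i)\log\frac{F_i(o_i,gg'|\xi_i)}{F_i(o_i,g'|\xi_i)}.$$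
   Context: Let $r\ge2$, $\mathcal I=\{1,\dots,r\}$. For each $i\in\mathcal I$, $\Gamma_i$ is a finitely generated group with identity $e_i=o_i$ (the $\Gamma_i$ taken pairwise disjoint), $\Gamma_i^\times=\Gamma_i\setminus\{e_i\}$, and $\mu_i$ is a probability measure on $\Gamma_i^\times$ (extended by $\mu_i(e_i)=0$) whose support generates $\Gamma_i$ as a semigroup. The case $r=2=|\Gamma_1|=|\Gamma_2|$ is excluded. The random walk on $\Gamma_i$ governed by $\mu_i$ has transition probabilities $p_i(x,y)=\mu_i(x^{-1}y)$ and $n$-step probabilities $p_i^{(n)}(x,y)$. Let $\alpha_1,\dots,\alpha_r>0$ with $\sum_i\alpha_i=1$. $\Gamma=\Gamma_1\ast\dots\ast\Gamma_r$ is the free product of groups with identity $e$, and $\mu$ is the probability measure on $\Gamma$ with $\mu(w)=\alpha_i\mu_i(w)$ if $w\in\Gamma_i^\times$, $\mu(w)=0$ otherwise. $(X_n)_{n\ge0}$ is the random walk on $\Gamma$ with $X_0=e$ and transition probabilities $p(x,y)=\mu(x^{-1}y)$; $\pi_n$ is the distribution of $X_n$. Generating functions: $G_i(x,y|z)=\sum_{n\ge0}p_i^{(n)}(x,y)z^n$; $F_i(x,y|z)=\sum_{n\ge0}\mathbb P[Y^{(i)}_n=y,\ Y^{(i)}_m\ne y\ \forall m\le n-1\mid Y^{(i)}_0=x]z^n$, where $Y^{(i)}$ is the random walk on $\Gamma_i$ governed by $\mu_i$ (so $F_i(x,x|z)=1$). With $T_e=\inf\{m\ge1:X_m=e\}$,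 $\overline H_i(z)=\sum_{n\ge1}\mathbb P[T_e=n,\ X_1\notin\Gamma_i^\times]z^n$ and $\xi_i=\xi_i(1)$, where $\xi_i(z)=\alpha_iz/(1-\overline H_i(z))$; it is known that $0<\xi_i<1$. *)

(* Defs.v *)
From HB Require Import structures.
From mathcomp Require Import all_boot all_order all_algebra.
From mathcomp Require Import all_classical all_reals all_analysis.

Set Implicit Arguments.
Unset Strict Implicit.
Unset Printing Implicit Defensive.
Import Order.TTheory GRing.Theory Num.Theory.
Import numFieldNormedType.Exports.

Local Open Scope classical_set_scope.
Local Open Scope ring_scope.

Section FreeProductWords.
Context {I : choiceType} (G : I -> groupType).
Local Open Scope group_scope.

Local Notation letter := {i : I & G i}.
Local Notation word := (seq letter).
Local Notation Tg := (Tagged G).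
Implicit Types (a b : letter) (s t u : word).

Definition reduced s : bool :=
  all (fun a => tagged a != 1) s && sorted (fun a b => tag a != tag b) s.

Definition cons_letter (i : I) (x : G i) s : word :=
  if x == 1 then s else Tg x :: s.

(* Reduced form of the concatenation of one letter (possibly trivial) with a
   reduced word. *)
Definition lact a s : word :=
  if s is b :: s' then
    if tag b == tag a then cons_letter (tagged a * tagged_as a b) s'
    else cons_letter (tagged a) s
  else cons_letter (tagged a) s.

Definition wmul s t : word := foldr lact t s.

Definition winv s : word := rev [seq Tg (tagged a)^-1 | a <- s].

Lemma reduced_cons a s : reduced (a :: s) =
  [&& tagged a != 1, (if s is b :: _ then tag a != tag b else true)
    & reduced s].
Proof.
rewrite /reduced /=; case: s => [|b s] /=; first by rewrite !andbT.
by rewrite -!andbA; do !bool_congr.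
Qed.

Lemma reduced_behead a s : reduced (a :: s) -> reduced s.
Proof. by rewrite reduced_cons => /and3P[]. Qed.

Lemma lact_eq i (x y : G i) s :
  lact (Tg x) (Tg y :: s) = cons_letter (x * y) s.
Proof. by rewrite /lact /= eqxx (@tagged_asE I (fun i => G i) (Tg x) y). Qed.

Lemma lact_neq a b s : tag b != tag a ->
  lact a (b :: s) = cons_letter (tagged a) (b :: s).
Proof. by move=> /negbTE ab; rewrite /lact ab. Qed.

Lemma lact_far i (x : G i) s :
  (if s is b :: _ then i != tag b else true) ->
  lact (Tg x) s = cons_letter x s.
Proof. by case: s => //= b s; rewrite eq_sym => /negbTE ->. Qed.

Lemma reduced_cons_letter i (x : G i) s :
  (if s is b :: _ then i != tag b else true) ->
  reduced s -> reduced (cons_letter x s).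
Proof.
rewrite /cons_letter => far rs; case: eqVneq => // xN1.
by rewrite reduced_cons xN1 far.
Qed.

Lemma reduced_lact a s : reduced s -> reduced (lact a s).
Proof.
case: a => i x; case: s => [|[j y] s] rs.
  exact: reduced_cons_letter.
have [ij|ij] := eqVneq j i.
  move: y rs; rewrite {}ij => y; rewrite reduced_cons => /and3P[_ far rs].
  by rewrite (lact_eq x y); exact: reduced_cons_letter.
rewrite lact_neq //=; apply: reduced_cons_letter => //=.
by rewrite eq_sym.
Qed.

Lemma lact1 i s : reduced s -> lact (Tg (1 : G i)) s = s.
Proof.
case: s => [|[j y] s] rs; first by rewrite /lact /cons_letter eqxx.
have [ij|ij] := eqVneq j i; last by rewrite lact_neq //= /cons_letter eqxx.
move: y rs; rewrite {}ij => y; rewrite reduced_cons => /and3P[y1 _ _].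
by rewrite (lact_eq 1 y) mul1g /cons_letter (negbTE y1).
Qed.

Lemma lact_cons_letter i (x y : G i) s :
  (if s is b :: _ then i != tag b else true) ->
  lact (Tg x) (cons_letter y s) = cons_letter (x * y) s.
Proof.
move=> far; rewrite {1}/cons_letter; case: eqVneq => [->|_].
  by rewrite mulg1 lact_far.
exact: lact_eq.
Qed.

Lemma lactM i (x y : G i) s : reduced s ->
  lact (Tg x) (lact (Tg y) s) = lact (Tg (x * y)) s.
Proof.
case: s => [|[j z] s] rs; first exact: lact_cons_letter.
have [ij|ij] := eqVneq j i.
  move: z rs; rewrite {}ij => z; rewrite reduced_cons => /and3P[_ far _].
  by rewrite (lact_eq y z) (lact_eq (x * y) z) lact_cons_letter // mulgA.
rewrite !(@lact_neq _ (Tg z)) //= lact_cons_letter //=.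
by rewrite eq_sym.
Qed.

Lemma reduced_wmul s t : reduced t -> reduced (wmul s t).
Proof. by move=> rt; elim: s => //= a s; exact: reduced_lact. Qed.

Lemma wmul_cons_letter i (x : G i) s t : reduced t ->
  wmul (cons_letter x s) t = lact (Tg x) (wmul s t).
Proof.
rewrite /cons_letter => rt; case: eqVneq => [->|//].
by rewrite lact1 //; exact: reduced_wmul.
Qed.

Lemma wmul_lact a s t : reduced s -> reduced t ->
  wmul (lact a s) t = lact a (wmul s t).
Proof.
case: a => i x; case: s => [|[j y] s] rs rt; first exact: wmul_cons_letter.
have [ij|ij] := eqVneq j i.
  move: y rs; rewrite {}ij => y _.
  rewrite (lact_eq x y) wmul_cons_letter //= lactM //.
  exact: reduced_wmul.
by rewrite lact_neq // (@wmul_cons_letter i x).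
Qed.

Lemma wmulA s t u : reduced t -> reduced u ->
  wmul s (wmul t u) = wmul (wmul s t) u.
Proof.
move=> rt ru; elim: s => //= a s ->; rewrite wmul_lact //.
exact: reduced_wmul.
Qed.

Lemma wmuls0 s : reduced s -> wmul s [::] = s.
Proof.
elim: s => //= -[i x] s IH rs; rewrite IH ?(reduced_behead rs) //.
move: rs; rewrite reduced_cons => /and3P[x1 far _].
by rewrite lact_far // /cons_letter (negbTE x1).
Qed.

Lemma reduced_winv s : reduced s -> reduced (winv s).
Proof.
rewrite /reduced /winv all_rev rev_sorted all_map sorted_map.
move=> /andP[H1 H2]; apply/andP; split.
  by apply: sub_all H1 => a /=; rewrite invg_eq1.
by apply: sub_sorted H2 => a b /=; rewrite eq_sym.
Qed.

Lemma wmulVs s : reduced s -> wmul (winv s) s = [::].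
Proof.
elim: s => //= -[i x] s IH rs.
have lactV : lact (Tg x^-1) (Tg x :: s) = s.
  by rewrite lact_eq mulVg /cons_letter eqxx.
rewrite /winv map_cons rev_cons -cats1 /wmul foldr_cat.
by rewrite [foldr _ _ [:: _]]lactV; exact: IH (reduced_behead rs).
Qed.

Lemma winvK s : winv (winv s) = s.
Proof.
rewrite /winv map_rev revK -map_comp -[RHS]map_id; apply: eq_map => -[i x] /=.
by rewrite invgK.
Qed.

Lemma wmulsV s : reduced s -> wmul s (winv s) = [::].
Proof.
by move=> rs; rewrite -{1}(winvK s) wmulVs //; exact: reduced_winv.
Qed.

Record free_product : Type :=
  FreeProduct { fp_word :> word; fp_reduced : reduced fp_word }.

HB.instance Definition _ := [isSub for fp_word].
HB.instance Definition _ := [Choice of free_product by <:].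

Implicit Types v w : free_product.

Definition fp_one : free_product := @FreeProduct [::] isT.
Definition fp_mul v w := FreeProduct (reduced_wmul v (fp_reduced w)).
Definition fp_inv v := FreeProduct (reduced_winv (fp_reduced v)).

Lemma fp_mulA : associative fp_mul.
Proof. by move=> ? ? ?; apply/val_inj/wmulA; exact: fp_reduced. Qed.
Lemma fp_mul1g : left_id fp_one fp_mul.
Proof. by move=> ?; exact/val_inj. Qed.
Lemma fp_mulg1 : right_id fp_one fp_mul.
Proof. by move=> ?; apply/val_inj/wmuls0; exact: fp_reduced. Qed.
Lemma fp_mulVg : left_inverse fp_one fp_inv fp_mul.
Proof. by move=> ?; apply/val_inj/wmulVs; exact: fp_reduced. Qed.
Lemma fp_mulgV : right_inverse fp_one fp_inv fp_mul.
Proof. by move=> ?; apply/val_inj/wmulsV; exact: fp_reduced. Qed.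

HB.instance Definition _ :=
  isGroup.Build free_product fp_mulA fp_mul1g fp_mulg1 fp_mulVg fp_mulgV.

Lemma reduced_fp_inj i (x : G i) : reduced (cons_letter x [::]).
Proof. exact: reduced_cons_letter. Qed.

Definition fp_inj i (x : G i) : free_product := FreeProduct (reduced_fp_inj x).

Lemma fp_injM i : {morph @fp_inj i : x y / x * y}.
Proof.
move=> x y; apply/val_inj => /=.
by rewrite wmul_cons_letter ?lact_cons_letter // ; exact: reduced_fp_inj.
Qed.

Definition factor_nontriv i : set free_product :=
  [set fp_inj x | x in [set x : G i | x <> 1]].

End FreeProductWords.

Section Generation.
Variable G : groupType.
Local Open Scope group_scope.

Definition finitely_generated : Prop :=
  exists S : seq G, forall g : G, exists s : seq G,
    {in s, forall x, x \in S \/ x^-1 \in S} /\ g = \prod_(x <- s) x.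

Definition semigroup_generates (A : set G) : Prop :=
  forall g : G, exists s : seq G,
    [/\ s <> [::], {in s, forall x, A x} & g = \prod_(x <- s) x].

End Generation.

Section Sums.
Variable R : realType.

(* Unordered sum of a signed family, valued in the extended reals: it is finite
   only if the family is absolutely summable. *)
Definition usum (T : choiceType) (D : set T) (f : T -> \bar R) : \bar R :=
  (\esum_(x in D) f^\+ x - \esum_(x in D) f^\- x)%E.

Definition prob_mass (T : choiceType) (m : T -> R) : Prop :=
  (forall x, 0 <= m x) /\ (\esum_(x in [set: T]) (m x)%:E = 1)%E.

(* [ln 0 = 0] in the library, so that [0 log 0 = 0]. *)
Definition shannon (T : choiceType) (m : T -> R) : \bar R :=
  (\esum_(x in [set: T]) (- (m x * ln (m x)))%:E)%E.

Definition gen_fun (c : nat -> R) (z : R) : R :=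
  limn (series (fun n => c n * z ^+ n)).

End Sums.

Section RandomWalk.
Context {R : realType} {d : measure_display} {T : measurableType d}.
Variables (P : probability T R) (G : groupType).
Implicit Types (mu : G -> R) (X : nat -> T -> G).

Definition transition mu (x y : G) : R := mu (x^-1 * y)%g.

Definition random_walk mu (x0 : G) X : Prop :=
  [/\ forall n y, measurable (X n @^-1` [set y]),
      P (X 0%N @^-1` [set x0]) = 1%E
    & forall n (x : nat -> G) (y : G),
        P [set w | (forall k, (k <= n)%N -> X k w = x k) /\ X n.+1 w = y] =
        (P [set w | forall k, (k <= n)%N -> X k w = x k]
         * (transition mu (x n) y)%:E)%E].

Definition distribution_at X (n : nat) (y : G) : R :=
  fine (P (X n @^-1` [set y])).

(* For a walk [X] started at [x], the following are [G(x,y|z)] and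
   [F(x,y|z)]. *)
Definition green X (y : G) (z : R) : R :=
  gen_fun (fun n => distribution_at X n y) z.

Definition first_visit X (y : G) (n : nat) : set T :=
  [set w | X n w = y /\ forall m, (m < n)%N -> X m w <> y].

Definition first_passage X (y : G) (z : R) : R :=
  gen_fun (fun n => fine (P (first_visit X y n))) z.

Definition return_time X (y : G) (n : nat) : set T :=
  [set w | [/\ (0 < n)%N, X n w = y
            & forall m, (0 < m < n)%N -> X m w <> y]].

Definition mean_neg_log X (n : nat) : \bar R :=
  ('E_P[fun w => (- ln (distribution_at X n (X n w)))%R])%E.

End RandomWalk.

Section FreeProductWalk.
Context {R : realType} {I : choiceType} (G : I -> groupType).
Variables (alpha : I -> R) (mu : forall i, G i -> R).

Definition fp_measure (w : free_product G) : R :=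
  if fp_word w is [:: a] then alpha (tag a) * mu (tagged a) else 0.

Context {d : measure_display} {T : measurableType d} (P : probability T R).
Variable X : nat -> T -> free_product G.

Definition Hbar (i : I) (z : R) : R :=
  gen_fun (fun n => fine (P (return_time X 1%g n `&`
                             [set w | ~ factor_nontriv i (X 1%N w)]))) z.

Definition xi (i : I) (z : R) : R := alpha i * z / (1 - Hbar i z).

End FreeProductWalk.

(* Main.v *)
Require Import Defs.
From HB Require Import structures.
From mathcomp Require Import all_boot all_order all_algebra.
From mathcomp Require Import all_classical all_reals all_analysis.
From mathcomp Require Import ring lra.

Set Implicit Arguments.
Unset Strict Implicit.
Unset Printing Implicit Defensive.
Import Order.TTheory GRing.Theory Num.Theory.
Import numFieldNormedType.Exports.

Local Open Scope classical_set_scope.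
Local Open Scope ring_scope.

(** By transience the Green function [G] of the walk is finite, and the entropy
    is the rate of escape for the Green distance [L_z(x) = ln G_z(1) - ln G_z(x)]
    with [G_z(x) = \sum_n z^n law_n(x)]. Indeed [law_n <= G_1] bounds the entropy
    of [X_n] below by [E L_1(X_n)] up to a constant, while Gibbs' inequality
    against the probability [(1 - z) G_z] bounds it above by [E L_z(X_n)] up to a
    constant, and [z] may tend to [1] after division by [n].

    As [X_(n+1)] has the law of [s X_n] with [s] an independent step, the
    increment [E L_z(X_(n+1)) - E L_z(X_n)] is the entropy of the step, up to
    [ln z], minus a nonnegative mean slack. By the tree structure of a free
    product, the slack of [g] in the factor [i] at [x] depends only on [g] and on
    the head of [x], the first letter of [x] if it lies in the factor [i] and [1]
    otherwise. The law of the head of [X_n] converges to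
    [(1 - xi_i) G_i(o, . | xi_i)]; this gives the formula.

    Transience holds because a product of letter weights slightly below [1] is
    superharmonic with a defect at [1]. *)

(** * Unordered sums *)

Section UnorderedSums.
Local Open Scope ereal_scope.
Variable R : realType.
Implicit Types (T : choiceType) (c : \bar R).

Lemma ge0_fin_num_le (x y : \bar R) : 0 <= x -> x <= y -> y < +oo ->
  x \is a fin_num.
Proof. by move=> x0 xy yoo; rewrite ge0_fin_numE// (le_lt_trans xy). Qed.

Lemma le_esum_term T (D : set T) (f : T -> \bar R) (t : T) : D t ->
  f t <= \esum_(x in D) f x.
Proof.
move=> Dt; apply: esum_ge; exists [set t]; last by rewrite fsbig_set1.
by split => // _ ->.
Qed.

Lemma eq0_esum T (D : set T) (f : T -> \bar R) :
  (forall x, D x -> 0 <= f x) -> \esum_(x in D) f x = 0 ->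
  forall x, D x -> f x = 0.
Proof.
move=> f0 fD x Dx; apply/eqP; rewrite eq_le f0// andbT.
by rewrite -[leRHS]fD; exact: le_esum_term.
Qed.

Let le_esumZl T (D : set T) c (f : T -> \bar R) : 0 <= c ->
  (forall x, D x -> 0 <= f x) ->
  \esum_(x in D) (c * f x) <= c * \esum_(x in D) f x.
Proof.
move=> c0 f0; apply: ge_ereal_sup => /= _ [A [finA AD] <-].
rewrite fsbig_finite//= big_seq -ge0_sume_distrr; last first.
  by move=> x; rewrite in_fset_set// inE => /AD/f0.
rewrite lee_wpmul2l// -big_seq -fsbig_finite//; apply: ereal_sup_ubound.
by exists A.
Qed.

Lemma esumZl T (D : set T) c (f : T -> \bar R) : 0 <= c ->
  (forall x, D x -> 0 <= f x) ->
  \esum_(x in D) (c * f x) = c * \esum_(x in D) f x.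
Proof.
move=> c0 f0; apply/eqP; rewrite eq_le le_esumZl//=.
have cf0 x : D x -> 0 <= c * f x by move=> Dx; rewrite mule_ge0 ?f0.
have [->|cN0] := eqVneq c 0; first by rewrite mul0e esum_ge0// => x; rewrite mul0e.
have c_gt0 : 0 < c by rewrite lt_neqAle eq_sym cN0.
case: c c0 cf0 cN0 c_gt0 => [c||//] c0 cf0 _ c_gt0.
  rewrite lte_fin in c_gt0; rewrite -lee_pdivlMl// (le_trans _ (le_esumZl _ _))//.
    by apply: le_esum => x Dx; rewrite muleA -EFinM mulVf ?gt_eqF// mul1e.
  by rewrite lee_fin invr_ge0 ltW.
have [all0|/existsNP[x /not_implyP[Dx /eqP fx0]]] :=
    pselect (forall x, D x -> f x = 0).
  by rewrite (esum1 all0) mule0 esum_ge0.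
apply: le_trans (leey _) (le_trans _ (le_esum_term _ Dx)).
by rewrite gt0_mulye// lt_neqAle eq_sym fx0 f0.
Qed.

Lemma esumZr T (D : set T) c (f : T -> \bar R) : 0 <= c ->
  (forall x, D x -> 0 <= f x) ->
  \esum_(x in D) (f x * c) = (\esum_(x in D) f x) * c.
Proof.
by move=> c0 f0; rewrite muleC -esumZl//; apply: eq_esum => x _; rewrite muleC.
Qed.

Lemma esum_pair T1 T2 (a : T1 -> T2 -> \bar R) : (forall x y, 0 <= a x y) ->
  \esum_(x in [set: T1]) \esum_(y in [set: T2]) a x y =
  \esum_(p in [set: (T1 * T2)%type]) a p.1 p.2.
Proof.
move=> a0; rewrite esum_esum//; congr esum.
by apply/seteqP; split => -[x y].
Qed.

Lemma reindex_esumT T1 T2 (e : T1 -> T2) (a : T2 -> \bar R) : bijective e ->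
  \esum_(y in [set: T2]) a y = \esum_(x in [set: T1]) a (e x).
Proof. by move=> be; apply: reindex_esum; rewrite setTT_bijective. Qed.

Lemma exchange_esum T1 T2 (a : T1 -> T2 -> \bar R) : (forall x y, 0 <= a x y) ->
  \esum_(x in [set: T1]) \esum_(y in [set: T2]) a x y =
  \esum_(y in [set: T2]) \esum_(x in [set: T1]) a x y.
Proof.
move=> a0; rewrite !esum_pair//.
rewrite (@reindex_esumT (T2 * T1)%type _ (fun p => (p.2, p.1)))//.
by exists (fun p => (p.2, p.1)) => -[].
Qed.

Lemma esum_pred1 T (t : T) (f : T -> \bar R) : 0 <= f t ->
  \esum_(x in [set: T]) (if x == t then f x else 0) = f t.
Proof.
move=> f0; rewrite -[RHS](@esum_set1 _ _ t f)// [RHS]esum_mkcond.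
apply: eq_esum => x _; rewrite [x \in _](_ : _ = (x == t))//.
by apply/idP/eqP; rewrite inE.
Qed.

Lemma esumD_pred1 T (t : T) (f : T -> \bar R) c :
  (forall x, 0 <= f x) -> 0 <= c ->
  \esum_(x in [set: T]) (f x + if x == t then c else 0) =
  \esum_(x in [set: T]) f x + c.
Proof.
move=> f0 c0; rewrite esumD//; last by move=> x _; case: ifP.
by rewrite (esum_pred1 (f := fun=> c)).
Qed.

Lemma esumD1 T (t : T) (f : T -> \bar R) : (forall x, 0 <= f x) ->
  \esum_(x in [set: T]) f x = f t + \esum_(x in [set x | x <> t]) f x.
Proof.
by move=> f0; rewrite (esumID [set t])// !setTI esum_set1.
Qed.

Lemma esum_nat_recl (f : nat -> \bar R) : (forall n, 0 <= f n) ->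
  \esum_(n in [set: nat]) f n = f 0%N + \esum_(n in [set: nat]) f n.+1.
Proof.
move=> f0; rewrite -!nneseries_esumT// nneseries_recl//; congr (_ + _).
by rewrite -(@nneseries_addn _ _ 1)//; apply: eq_eseriesr => n _; rewrite addn1.
Qed.

Lemma esum_nat_le (f : nat -> \bar R) c : (forall n, 0 <= f n) ->
  (forall N, \sum_(n < N) f n <= c) -> \esum_(n in [set: nat]) f n <= c.
Proof.
move=> f0 fc; rewrite -nneseries_esumT//; apply: lime_le.
  exact: is_cvg_nneseries.
by apply: nearW => N; rewrite big_mkord.
Qed.

Lemma esum_nat_ge (f : nat -> \bar R) N : (forall n, 0 <= f n) ->
  \sum_(n < N) f n <= \esum_(n in [set: nat]) f n.
Proof.
move=> f0; rewrite -nneseries_esumT// -(big_mkord xpredT).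
exact: nneseries_lim_ge.
Qed.

Lemma esum_ltn (f : nat -> \bar R) N : (forall n, 0 <= f n) ->
  \esum_(n in [set: nat]) (if (n < N)%N then f n else 0) = \sum_(n < N) f n.
Proof.
move=> f0; rewrite fsbig_ord -esum_fset//= [RHS]esum_mkcond.
by apply: eq_esum => n _; congr (if _ then _ else _); apply/idP/idP; rewrite inE.
Qed.

Lemma esum_geometric (z : R) : (0 <= z < 1)%R ->
  \esum_(n in [set: nat]) (z ^+ n)%:E = ((1 - z)^-1)%:E.
Proof.
move=> /andP[z0 z1].
rewrite -nneseries_esumT => [|n]; last by rewrite lee_fin exprn_ge0.
apply/cvg_lim => //; under eq_fun do rewrite sumEFin.
apply: cvg_EFin; first exact: nearW.
have := @cvg_geometric_series R 1 z; rewrite -exprn_geometric mul1r.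
by apply; rewrite ger0_norm.
Qed.

Lemma esum_cauchy_product (a b : nat -> \bar R) :
  (forall n, 0 <= a n) -> (forall n, 0 <= b n) ->
  \esum_(n in [set: nat]) \sum_(k < n.+1) (a k * b (n - k)%N) =
  (\esum_(n in [set: nat]) a n) * (\esum_(n in [set: nat]) b n).
Proof.
move=> a0 b0; have ab0 j k : 0 <= a j * b k by rewrite mule_ge0.
rewrite -esumZr//; last exact: esum_ge0.
rewrite (eq_esum (fun n _ => esym (esum_ltn n.+1 (fun k => ab0 k (n - k)%N)))).
rewrite exchange_esum; last by move=> n k; case: ifP.
apply: eq_esum => k _; rewrite -esumZl//.
elim: k (a k) (a0 k) => [|k IH] ak ak0.
  by apply: eq_esum => n _; rewrite subn0.
rewrite [LHS]esum_nat_recl; last by move=> n; case: ifP => // _; rewrite mule_ge0.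
by rewrite ltnS ltn0 add0e -IH//; apply: eq_esum => n _; rewrite ltnS subSS.
Qed.

Section Limits.
Context U (F : set_system U) {FF : ProperFilter F} T.

Lemma esum_fatou (f : U -> T -> \bar R) (l : T -> \bar R) c :
  (\forall u \near F, forall x, 0 <= f u x) -> (forall x, f^~ x @ F --> l x) ->
  c < \esum_(x in [set: T]) l x ->
  \forall u \near F, c < \esum_(x in [set: T]) f u x.
Proof.
move=> f0 fl /ereal_sup_gt[_ [A [finA _] <-]]; rewrite fsbig_finite//= => cA.
have : (\sum_(x <- finmap.enum_fset (fset_set A)) f u x)%R @[u --> F] -->
    (\sum_(x <- finmap.enum_fset (fset_set A)) l x)%R.
  apply: (@cvg_nnesum _ _ _ _ _ _ (fun x u => f u x)) => // x _.
  by apply: filterS f0 => u /(_ x).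
move=> /(_ _ (open_ereal_gt' cA)) near_c; near=> u.
have cu : c < (\sum_(x <- finmap.enum_fset (fset_set A)) f u x)%R.
  by near: u; exact: near_c.
rewrite (lt_le_trans cu)//; apply: ereal_sup_ubound; exists A => //.
by rewrite fsbig_finite.
Unshelve. all: by end_near. Qed.

Section Dominated.
Variables (f : U -> T -> R) (l g : T -> R).
Hypothesis fg : \forall u \near F, forall x, (0 <= f u x <= g x)%R.
Hypothesis fl : forall x, f^~ x @ F --> l x.
Hypothesis g_sum : \esum_(x in [set: T]) (g x)%:E < +oo.

Let esumR (h : T -> R) : \bar R := \esum_(x in [set: T]) (h x)%:E.

Let esumR_fin (h : T -> R) : (forall x, 0 <= h x <= g x)%R ->
  esumR h \is a fin_num.
Proof.
move=> hg; apply: ge0_fin_num_le g_sum.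
  by apply: esum_ge0 => x _; rewrite lee_fin; case/andP: (hg x).
by apply: le_esum => x _; rewrite lee_fin; case/andP: (hg x).
Qed.

Let near_esum_gt (f' : U -> T -> R) (l' : T -> R) (e : R) : (0 < e)%R ->
  (\forall u \near F, forall x, 0 <= f' u x)%R ->
  (forall x, f'^~ x @ F --> l' x) -> (forall x, 0 <= l' x <= g x)%R ->
  \forall u \near F, (fine (esumR l') - e)%:E < esumR (f' u).
Proof.
move=> e0 f0 fl' lg'.
apply: (@esum_fatou (fun u x => (f' u x)%:E) (fun x => (l' x)%:E)).
- by apply: filterS f0 => u f0 x; rewrite lee_fin.
- by move=> x; apply: cvg_EFin; [exact: nearW|exact: fl'].
- rewrite EFinB fineK; last exact: esumR_fin.
  by rewrite lteBlDr// lteDl ?lte_fin//; exact: esumR_fin.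
Qed.

Lemma esum_dominated :
  (fun u => \esum_(x in [set: T]) (f u x)%:E) @ F -->
  \esum_(x in [set: T]) (l x)%:E.
Proof.
have lg x : (0 <= l x <= g x)%R.
  apply/andP; split; [apply: (cvgr_to_ge (@fl x))|apply: (cvgr_to_le (@fl x))];
    by apply: filterS fg => u /(_ x) /andP[].
have compl h x : (0 <= h x <= g x)%R -> (0 <= g x - h x <= g x)%R.
  by move=> /andP[h0 hg]; rewrite subr_ge0 hg gerBl.
have split_g h : (forall x, 0 <= h x <= g x)%R ->
    fine (esumR g) = (fine (esumR h) + fine (esumR (g \- h)%R))%R.
  move=> hg; rewrite -fineD ?esumR_fin//; last by move=> x; exact: compl.
  congr fine; rewrite /esumR -esumD.
  - by apply: eq_esum => x _; rewrite -EFinD addrC subrK.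
  - by move=> x _; rewrite lee_fin; case/andP: (hg x).
  - by move=> x _; rewrite lee_fin; case/andP: (compl h x (hg x)).
rewrite -/(esumR l) -(fineK (esumR_fin lg)); apply/fine_cvgP; split.
  by apply: filterS fg => u /esumR_fin.
apply/cvgrPdist_lt => e e0; near=> u.
have fgu : forall x, (0 <= f u x <= g x)%R by near: u.
have lower : (fine (esumR l) - e)%:E < esumR (f u).
  near: u; apply: near_esum_gt => //.
  by apply: filterS fg => u fgu x; case/andP: (fgu x).
have upper : (fine (esumR (g \- l)%R) - e)%:E < esumR (g \- f u)%R.
  near: u; apply: (near_esum_gt (f' := fun u => g \- f u)%R) => //.
  - by apply: filterS fg => u fgu x /=; case/andP: (compl (f u) x (fgu x)).
  - by move=> x; apply: cvgB; [exact: cvg_cst|exact: fl].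
  - by move=> x; exact: compl.
rewrite -(fineK (esumR_fin fgu)) lte_fin in lower.
rewrite -(fineK (esumR_fin (fun x => compl _ x (fgu x)))) lte_fin in upper.
have := split_g _ lg; have := split_g _ fgu; rewrite /= ltr_norml; lra.
Unshelve. all: by end_near. Qed.

End Dominated.
End Limits.

Lemma cvg_convolution (a c : nat -> R) (l : R) : (forall n, 0 <= a n)%R ->
  (forall n, 0 <= c n <= 1)%R -> \esum_(n in [set: nat]) (a n)%:E < +oo ->
  (c @ \oo --> l)%R ->
  \sum_(k < n.+1) (a k * c (n - k)%N)%:E @[n --> \oo] -->
  \esum_(n in [set: nat]) (a n * l)%:E.
Proof.
move=> a0 c01 a_sum cl; pose t n k := (if (k < n.+1)%N then a k * c (n - k)%N else 0)%R.
have t_bounded n k : (0 <= t n k <= a k)%R.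
  have /andP[c0 c1] := c01 (n - k)%N; rewrite /t.
  case: ifP => _; last by rewrite lexx a0.
  by rewrite mulr_ge0//= ler_piMr.
have -> : (fun n => \sum_(k < n.+1) (a k * c (n - k)%N)%:E) =
    (fun n => \esum_(k in [set: nat]) (t n k)%:E).
  apply/funext => n; rewrite -(esum_ltn (f := fun k => (a k * c (n - k)%N)%:E)).
    by apply: eq_esum => k _; rewrite /t; case: ifP.
  by move=> k; rewrite lee_fin mulr_ge0//; case/andP: (c01 (n - k)%N).
apply: (esum_dominated (g := a)) => // [|k]; first exact: nearW.
have : (a k * c (n - k)%N)%R @[n --> \oo] --> (a k * l)%R.
  apply: cvgM; first exact: cvg_cst.
  by rewrite -(cvg_shiftn k (fun n => c (n - k)%N)); under eq_fun do rewrite addnK.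
apply: cvg_trans; apply: near_eq_cvg; near=> n.
by rewrite /t ifT// ltnS; near: n; exact: nbhs_infty_ge.
Unshelve. all: by end_near. Qed.

Lemma usumB T (D : set T) (f g : T -> R) :
  (forall x, 0 <= f x)%R -> (forall x, 0 <= g x)%R ->
  \esum_(x in D) (f x)%:E < +oo -> \esum_(x in D) (g x)%:E < +oo ->
  usum D (fun x => (f x - g x)%:E) =
  \esum_(x in D) (f x)%:E - \esum_(x in D) (g x)%:E.
Proof.
move=> f0 g0 f_sum g_sum.
have summ (h : T -> R) : (forall x, 0 <= h x)%R ->
    \esum_(x in D) (h x)%:E < +oo -> summable D (fun x => (h x)%:E).
  move=> h0; rewrite /summable; congr (_ < _); apply: eq_esum => x _.
  by rewrite gee0_abs ?lee_fin.
by apply: (esumB (summ f f0 f_sum) (summ g g0 g_sum)) => x _; rewrite lee_fin.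
Qed.

Lemma usumZl T (D : set T) (f : T -> \bar R) (k : R) : (0 < k)%R ->
  k%:E * usum D f = usum D (fun x => k%:E * f x).
Proof.
move=> k0; have k_ge0 := ltW k0; rewrite /usum ge0_funeposM// ge0_funenegM//.
rewrite !esumZl ?lee_fin//.
have := esum_ge0 (fun x (_ : D x) => funepos_ge0 f x).
have := esum_ge0 (fun x (_ : D x) => funeneg_ge0 f x).
case: (\esum_(x in D) f^\+ x) => [a||]//; case: (\esum_(x in D) f^\- x) => [b||]// _ _.
- by rewrite muleBr.
- by rewrite /= gt0_muley ?lte_fin// gt0_muleNy.
- by rewrite /= gt0_muley.
- by rewrite /= gt0_muleNy ?lte_fin// gt0_muley.
Qed.

End UnorderedSums.

Section ProbabilityMass.
Variables (R : realType) (T : choiceType).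
Implicit Types (m p q : T -> R).

Lemma prob_mass_ge0 m x : prob_mass m -> 0 <= m x.
Proof. by case. Qed.

Lemma esum_prob_mass m : prob_mass m -> (\esum_(x in [set: T]) (m x)%:E = 1)%E.
Proof. by case. Qed.

Lemma esum_prob_massZl m (c : \bar R) : prob_mass m -> (0 <= c)%E ->
  (\esum_(x in [set: T]) (c * (m x)%:E) = c)%E.
Proof. by move=> [m0 m1] c0; rewrite esumZl ?m1 ?mule1// => x _; rewrite lee_fin. Qed.

Lemma esum_prob_massZr m (c : \bar R) : prob_mass m -> (0 <= c)%E ->
  (\esum_(x in [set: T]) ((m x)%:E * c) = c)%E.
Proof. by move=> [m0 m1] c0; rewrite esumZr ?m1 ?mul1e// => x _; rewrite lee_fin. Qed.

Lemma prob_mass_le1 m x : prob_mass m -> m x <= 1.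
Proof.
by move=> [_ m1]; rewrite -lee_fin -m1; exact: (le_esum_term (fun x => (m x)%:E)).
Qed.

Lemma prob_mass_gt0 m x : prob_mass m -> (0 < m x) = (m x != 0).
Proof. by move=> [m0 _]; rewrite lt0r m0 andbT. Qed.

Lemma prob_mass_eq0 m x y : prob_mass m -> m x = 1 -> y != x -> m y = 0.
Proof.
move=> [m0 m1] mx yx; have em_ge0 z : (0 <= (m z)%:E)%E by rewrite lee_fin.
have := m1; rewrite (esumD1 x)// mx => rest1.
have rest0 : (\esum_(z in [set z | z <> x]) (m z)%:E = 0)%E.
  have : (0 <= \esum_(z in [set z | z <> x]) (m z)%:E)%E by exact: esum_ge0.
  case: (esum _ _) rest1 => [s||]//=; rewrite -EFinD => -[s1] _.
  by congr (_%:E); apply: (@addrI _ 1); rewrite s1 addr0.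
by have /(_ y (elimN eqP yx))[] := eq0_esum (fun z _ => em_ge0 z) rest0.
Qed.

Lemma entropy_term_ge0 m x : prob_mass m -> 0 <= - (m x * ln (m x)).
Proof.
move=> m_prob; rewrite -mulrN mulr_ge0 ?prob_mass_ge0//.
by rewrite oppr_ge0 ln_le0// prob_mass_le1.
Qed.

Lemma shannon_ge0 m : prob_mass m -> (0 <= shannon m)%E.
Proof. by move=> m_prob; apply: esum_ge0 => x _; rewrite lee_fin entropy_term_ge0. Qed.

Lemma entropy_term_le (a b : R) : 0 <= a -> 0 < b ->
  - (a * ln a) + a <= - (a * ln b) + b.
Proof.
move=> a0 b0; have [->|aN0] := eqVneq a 0; first by rewrite !mul0r oppr0 !add0r ltW.
have a_gt0 : 0 < a by rewrite lt0r aN0.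
have : ln (b / a) <= b / a - 1.
  have := @le_ln1Dx R (b / a - 1); rewrite addrCA subrr addr0; apply.
  by rewrite ltrBrDl subrr divr_gt0.
move=> /(ler_wpM2l a0); rewrite ln_div ?posrE// 2!mulrBr mulr1 (mulrCA a) divff// mulr1.
lra.
Qed.

Lemma gibbs_inequality p q : prob_mass p -> prob_mass q -> (forall x, 0 < q x) ->
  (shannon p <= \esum_(x in [set: T]) (- (p x * ln (q x)))%:E)%E.
Proof.
move=> p_prob q_prob q_gt0.
have p0 x : (0 <= (p x)%:E)%E by rewrite lee_fin prob_mass_ge0.
have cross_ge0 x : (0 <= (- (p x * ln (q x)))%:E)%E.
  by rewrite lee_fin -mulrN mulr_ge0 ?prob_mass_ge0// oppr_ge0 ln_le0// prob_mass_le1.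
rewrite -(@leeD2rE _ 1)// -{1}(esum_prob_mass p_prob) -(esum_prob_mass q_prob).
rewrite -!esumD//; first last.
- by move=> x _; rewrite lee_fin entropy_term_ge0.
- by move=> x _; rewrite lee_fin ltW.
by apply: le_esum => x _; rewrite -!EFinD lee_fin entropy_term_le ?prob_mass_ge0.
Qed.

End ProbabilityMass.

(** * Random walks on a group and their Green functions *)

Lemma mulVg_eq1 (G : groupType) (x y : G) : (x^-1 * y == 1)%g = (x == y).
Proof. by rewrite mulg_eq1 (inj_eq invg_inj). Qed.

Section Translations.
Local Open Scope ereal_scope.
Variables (R : realType) (G : groupType).
Implicit Types (f : G -> \bar R).

Lemma esum_mulgl g f :
  \esum_(x in [set: G]) f (g * x)%g = \esum_(x in [set: G]) f x.
Proof.
rewrite [RHS](@reindex_esumT R G G (fun x => g * x)%g)//.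
by exists (fun x => g^-1 * x)%g => x; rewrite (mulKg, mulVKg).
Qed.

Lemma esum_mulgr g f :
  \esum_(x in [set: G]) f (x * g)%g = \esum_(x in [set: G]) f x.
Proof.
rewrite [RHS](@reindex_esumT R G G (fun x => x * g)%g)//.
by exists (fun x => x * g^-1)%g => x; rewrite (mulgK, mulgVK).
Qed.

Lemma esum_invg f : \esum_(x in [set: G]) f x^-1%g = \esum_(x in [set: G]) f x.
Proof.
rewrite [RHS](@reindex_esumT R G G (fun x => x^-1)%g)//.
by exists (fun x => x^-1)%g => x; rewrite invgK.
Qed.

End Translations.

Section Walk.
Local Open Scope ereal_scope.
Variables (R : realType) (G : groupType) (m : G -> R).
Hypothesis m_prob : prob_mass m.
Implicit Types (u v : G -> \bar R) (x y g s : G) (A : nat -> pred G).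

Let m0 x : 0 <= (m x)%:E. Proof. by rewrite lee_fin; exact: prob_mass_ge0. Qed.

Definition dirac_mass (x : G) : \bar R := if x == 1%g then 1 else 0.

Definition walk_step u y : \bar R :=
  \esum_(x in [set: G]) (u x * (m (x^-1 * y)%g)%:E).

(* Law at time [n] of the walk killed as soon as it violates [A]. *)
Fixpoint restricted_law A (n : nat) : G -> \bar R :=
  if n is n'.+1 then
    fun y => if A n'.+1 y then walk_step (restricted_law A n') y else 0
  else fun y => if A 0%N y then dirac_mass y else 0.

Definition law : nat -> G -> \bar R := restricted_law (fun _ _ => true).

Lemma dirac_mass_ge0 x : 0 <= dirac_mass x.
Proof. by rewrite /dirac_mass; case: ifP. Qed.

Lemma esum_dirac_mass_mul (f : G -> \bar R) : 0 <= f 1%g ->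
  \esum_(x in [set: G]) (dirac_mass x * f x) = f 1%g.
Proof.
move=> f0; rewrite -[RHS](esum_pred1 f0); apply: eq_esum => x _.
by rewrite /dirac_mass; case: ifP; rewrite (mul1e, mul0e).
Qed.

Lemma esum_dirac_mass : \esum_(x in [set: G]) dirac_mass x = 1.
Proof. exact: (esum_pred1 (f := fun=> 1)). Qed.

Lemma walk_step_ge0 u : (forall x, 0 <= u x) -> forall y, 0 <= walk_step u y.
Proof. by move=> u0 y; apply: esum_ge0 => x _; rewrite mule_ge0. Qed.

Lemma restricted_law_ge0 A n x : 0 <= restricted_law A n x.
Proof.
elim: n x => [|n IH] x /=; case: ifP => // _; first exact: dirac_mass_ge0.
exact: walk_step_ge0.
Qed.

Lemma law_ge0 n x : 0 <= law n x. Proof. exact: restricted_law_ge0. Qed.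

Lemma law0 x : law 0 x = dirac_mass x. Proof. by []. Qed.

Lemma lawS n x : law n.+1 x = walk_step (law n) x. Proof. by []. Qed.

Lemma eq_walk_step u v : u =1 v -> walk_step u =1 walk_step v.
Proof. by move=> uv y; apply: eq_esum => x _; rewrite uv. Qed.

Lemma eq_walk_step_supp u v y :
  (forall x, m (x^-1 * y)%g != 0%R -> u x = v x) -> walk_step u y = walk_step v y.
Proof.
move=> uv; apply: eq_esum => x _.
by have [->|/uv ->//] := eqVneq (m (x^-1 * y)%g) 0%R; rewrite !mule0.
Qed.

Lemma walk_step_eq0 u y :
  (forall x, m (x^-1 * y)%g != 0%R -> u x = 0) -> walk_step u y = 0.
Proof.
move=> u0; rewrite (@eq_walk_step_supp u (fun=> 0) y)//.
by apply: esum1 => x _; rewrite mul0e.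
Qed.

Lemma le_walk_step u v : (forall x, u x <= v x) ->
  forall y, walk_step u y <= walk_step v y.
Proof. by move=> uv y; apply: le_esum => x _; rewrite lee_wpmul2r. Qed.

Lemma walk_stepD u v y : (forall x, 0 <= u x) -> (forall x, 0 <= v x) ->
  walk_step (fun x => u x + v x) y = walk_step u y + walk_step v y.
Proof.
move=> u0 v0; rewrite /walk_step -esumD; try by move=> x _; rewrite mule_ge0.
by apply: eq_esum => x _; rewrite ge0_muleDl.
Qed.

Lemma walk_stepZ (c : \bar R) u y : 0 <= c -> (forall x, 0 <= u x) ->
  walk_step (fun x => c * u x) y = c * walk_step u y.
Proof.
move=> c0 u0; rewrite /walk_step -esumZl//; last by move=> x _; rewrite mule_ge0.
by apply: eq_esum => x _; rewrite muleA.
Qed.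

Lemma walk_step_esum (T : choiceType) (f : T -> G -> \bar R) y :
  (forall t x, 0 <= f t x) ->
  walk_step (fun x => \esum_(t in [set: T]) f t x) y =
  \esum_(t in [set: T]) walk_step (f t) y.
Proof.
move=> f0; rewrite /walk_step exchange_esum; last by move=> *; rewrite mule_ge0.
by apply: eq_esum => x _; rewrite esumZr.
Qed.

Lemma walk_step_sum (n : nat) (f : 'I_n -> G -> \bar R) y :
  (forall k x, 0 <= f k x) ->
  walk_step (fun x => \sum_(k < n) f k x) y = \sum_(k < n) walk_step (f k) y.
Proof.
move=> f0; rewrite /walk_step -esum_sum; last by move=> *; rewrite mule_ge0.
by apply: eq_esum => x _; rewrite ge0_sume_distrl.
Qed.

Lemma walk_step_cst (c : \bar R) y : 0 <= c -> walk_step (fun=> c) y = c.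
Proof.
move=> c0; rewrite -[RHS](esum_prob_massZl m_prob c0) -[RHS](esum_mulgr y).
exact: (esum_invg (fun x => c * (m (x * y)%g)%:E)).
Qed.

Lemma walk_step_translate g u y :
  walk_step (fun x => u (g^-1 * x)%g) y = walk_step u (g^-1 * y)%g.
Proof.
rewrite /walk_step -[LHS](esum_mulgl g); apply: eq_esum => x _.
by rewrite mulKg invgM !mulgA.
Qed.

Lemma walk_step_dirac y : walk_step dirac_mass y = (m y)%:E.
Proof.
by rewrite /walk_step esum_dirac_mass_mul// invg1 mul1g.
Qed.

Lemma esum_walk_step_mul u (f : G -> \bar R) :
  (forall x, 0 <= u x) -> (forall x, 0 <= f x) ->
  \esum_(y in [set: G]) (walk_step u y * f y) =
  \esum_(x in [set: G]) (u x * \esum_(s in [set: G]) ((m s)%:E * f (x * s)%g)).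
Proof.
move=> u0 f0; rewrite /walk_step.
transitivity (\esum_(y in [set: G]) \esum_(x in [set: G])
   (u x * ((m (x^-1 * y)%g)%:E * f y))).
  apply: eq_esum => y _; rewrite -esumZr//; last first.
    by move=> x _; rewrite mule_ge0.
  by apply: eq_esum => x _; rewrite muleA.
rewrite exchange_esum; last by move=> *; rewrite !mule_ge0.
apply: eq_esum => x _; rewrite -esumZl//; last by move=> s _; rewrite mule_ge0.
by rewrite -[LHS](esum_mulgl x); apply: eq_esum => s _; rewrite mulKg.
Qed.

Lemma esum_walk_step u : (forall x, 0 <= u x) ->
  \esum_(y in [set: G]) walk_step u y = \esum_(x in [set: G]) u x.
Proof.
move=> u0; have := @esum_walk_step_mul u (fun=> 1) u0 (fun=> @lee01 R).
under eq_esum do rewrite mule1.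
by move=> ->; apply: eq_esum => x _; rewrite esum_prob_massZr ?mule1.
Qed.

Lemma esum_law n : \esum_(x in [set: G]) law n x = 1.
Proof.
elim: n => [|n IH]; first exact: esum_dirac_mass.
by rewrite -IH -(esum_walk_step (law_ge0 n)).
Qed.

Lemma law_le1 n x : law n x <= 1.
Proof. by rewrite -(esum_law n); exact: le_esum_term. Qed.

Lemma law_fin n x : law n x \is a fin_num.
Proof. exact: ge0_fin_num_le (law_ge0 n x) (law_le1 n x) (ltry _). Qed.

Lemma law_prob n : prob_mass (fun x => fine (law n x)).
Proof.
split; first by move=> x; rewrite fine_ge0 ?law_ge0.
by rewrite -(esum_law n); apply: eq_esum => x _; rewrite fineK ?law_fin.
Qed.

Lemma lawSl n y :
  law n.+1 y = \esum_(s in [set: G]) ((m s)%:E * law n (s^-1 * y)%g).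
Proof.
elim: n y => [|n IH] y.
  rewrite lawS walk_step_dirac -[LHS](@esum_pred1 R G y (fun x => (m x)%:E))//.
  apply: eq_esum => s _; rewrite law0 /dirac_mass mulVg_eq1.
  by case: eqVneq; rewrite (mule1, mule0).
rewrite lawS (eq_walk_step IH) walk_step_esum; last first.
  by move=> s x; rewrite mule_ge0 ?law_ge0.
apply: eq_esum => s _; rewrite walk_stepZ//; last by move=> x; exact: law_ge0.
by rewrite walk_step_translate.
Qed.

Lemma esum_lawS_mul n (f : G -> \bar R) : (forall x, 0 <= f x) ->
  \esum_(x in [set: G]) (law n.+1 x * f x) =
  \esum_(s in [set: G]) ((m s)%:E *
    \esum_(x in [set: G]) (law n x * f (s * x)%g)).
Proof.
move=> f0; have lf0 x y : 0 <= law n x * f y by rewrite mule_ge0 ?law_ge0.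
transitivity (\esum_(y in [set: G]) \esum_(s in [set: G])
    ((m s)%:E * (law n (s^-1 * y)%g * f y))).
  apply: eq_esum => y _; rewrite lawSl -esumZr//; last first.
    by move=> s _; rewrite mule_ge0 ?law_ge0.
  by apply: eq_esum => s _; rewrite muleA.
rewrite exchange_esum; last by move=> *; rewrite mule_ge0.
apply: eq_esum => s _; rewrite esumZl//; congr (_ * _).
by rewrite -[LHS](esum_mulgl s); apply: eq_esum => x _; rewrite mulKg.
Qed.

Definition avoiding g : nat -> G -> \bar R := restricted_law (fun _ x => x != g).

Definition hitting g (n : nat) : \bar R :=
  if n is n'.+1 then walk_step (avoiding g n') g else dirac_mass g.

Lemma avoiding_ge0 g n x : 0 <= avoiding g n x.
Proof. exact: restricted_law_ge0. Qed.

Lemma hitting_ge0 g n : 0 <= hitting g n.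
Proof.
case: n => [|n]; first exact: dirac_mass_ge0.
exact/walk_step_ge0/avoiding_ge0.
Qed.

Lemma avoiding_self g n : avoiding g n g = 0.
Proof. by rewrite /avoiding; case: n => [|n] /=; rewrite eqxx. Qed.

Lemma dirac_mass_avoiding g y :
  dirac_mass y = avoiding g 0 y + (if y == g then hitting g 0 else 0).
Proof.
by rewrite /avoiding /=; case: eqVneq => [->|_]; rewrite /= ?add0e ?adde0.
Qed.

Lemma walk_step_avoiding g n y :
  walk_step (avoiding g n) y =
  avoiding g n.+1 y + (if y == g then hitting g n.+1 else 0).
Proof.
rewrite {2}/avoiding /=; case: eqVneq => [->|_] /=; first by rewrite add0e.
by rewrite adde0.
Qed.

Let hitting_law0 g x c : c * law 0 (g^-1 * x)%g = if x == g then c else 0.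
Proof.
by rewrite law0 /dirac_mass mulVg_eq1 eq_sym; case: ifP; rewrite (mule1, mule0).
Qed.

Lemma law_first_visit g n x :
  law n x = avoiding g n x + \sum_(k < n.+1) (hitting g k * law (n - k) (g^-1 * x)%g).
Proof.
elim: n x => [|n IH] x; first by rewrite big_ord1 hitting_law0 -dirac_mass_avoiding.
have hl0 k j y : 0 <= hitting g k * law j (g^-1 * y)%g.
  by rewrite mule_ge0 ?hitting_ge0 ?law_ge0.
rewrite lawS (eq_walk_step IH) walk_stepD; last 2 first.
- by move=> y; exact: avoiding_ge0.
- by move=> y; exact: sume_ge0.
rewrite walk_step_avoiding -addeA; congr (_ + _).
rewrite walk_step_sum//= [RHS]big_ord_recr /= subnn addeC hitting_law0; congr (_ + _).
apply: eq_bigr => k _; rewrite walk_stepZ ?hitting_ge0//; last first.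
  by move=> y; exact: law_ge0.
by rewrite (walk_step_translate g (law (n - k))) -lawS subSn// -ltnS.
Qed.

Lemma esum_avoiding_hitting g n :
  \esum_(x in [set: G]) avoiding g n x + \sum_(k < n.+1) hitting g k = 1.
Proof.
have avoiding_hitting n' := esumD_pred1 g (avoiding_ge0 g n') (hitting_ge0 g n').
elim: n => [|n IH].
  rewrite big_ord1 -avoiding_hitting -esum_dirac_mass.
  by apply: eq_esum => x _; rewrite [RHS](dirac_mass_avoiding g).
rewrite -[RHS]IH -(esum_walk_step (avoiding_ge0 g n)) big_ord_recr /= addeA addeAC.
rewrite -(avoiding_hitting n.+1); congr (_ + _).
by apply: eq_esum => x _; rewrite walk_step_avoiding.
Qed.

Lemma hitting_fin g n : hitting g n \is a fin_num.
Proof.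
apply: (ge0_fin_num_le (hitting_ge0 g n) _ (ltry 1)).
rewrite -(esum_avoiding_hitting g n) big_ord_recr /= addeA leeDr// adde_ge0//.
  by apply: esum_ge0 => x _; exact: avoiding_ge0.
by apply: sume_ge0 => k _; exact: hitting_ge0.
Qed.

Definition green_fun (z : R) x : \bar R :=
  \esum_(n in [set: nat]) ((z ^+ n)%:E * law n x).

Definition hitting_fun (z : R) g : \bar R :=
  \esum_(n in [set: nat]) ((z ^+ n)%:E * hitting g n).

Lemma green_fun1E x : green_fun 1 x = \esum_(n in [set: nat]) law n x.
Proof. by apply: eq_esum => n _; rewrite expr1n mul1e. Qed.

Section FixedParameter.
Variable z : R.
Hypothesis z0 : (0 <= z)%R.

Let zn0 n : 0 <= (z ^+ n)%:E. Proof. by rewrite lee_fin exprn_ge0. Qed.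

Let green_term_ge0 n x : 0 <= (z ^+ n)%:E * law n x.
Proof. by rewrite mule_ge0 ?law_ge0. Qed.

Let hitting_term_ge0 n g : 0 <= (z ^+ n)%:E * hitting g n.
Proof. by rewrite mule_ge0 ?hitting_ge0. Qed.

Lemma green_fun_ge0 x : 0 <= green_fun z x.
Proof. exact: esum_ge0. Qed.

Lemma hitting_fun_ge0 g : 0 <= hitting_fun z g.
Proof. exact: esum_ge0. Qed.

Lemma green_fun_recl y : green_fun z y =
  dirac_mass y + z%:E * \esum_(s in [set: G]) ((m s)%:E * green_fun z (s^-1 * y)%g).
Proof.
rewrite {1}/green_fun esum_nat_recl// expr0 mul1e; congr (_ + _).
transitivity (z%:E * \esum_(s in [set: G]) \esum_(n in [set: nat])
    ((m s)%:E * ((z ^+ n)%:E * law n (s^-1 * y)%g))); last first.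
  by congr (_ * _); apply: eq_esum => s _; rewrite esumZl.
rewrite exchange_esum; last by move=> *; rewrite mule_ge0.
rewrite -esumZl//; last by move=> n _; apply: esum_ge0 => s _; rewrite mule_ge0.
apply: eq_esum => n _; rewrite lawSl exprS EFinM -muleA; congr (_ * _).
rewrite -esumZl//; last by move=> s _; rewrite mule_ge0 ?law_ge0.
by apply: eq_esum => s _; rewrite muleCA.
Qed.

Lemma green_fun_step_ge s x :
  z%:E * ((m s)%:E * green_fun z x) <= green_fun z (s * x)%g.
Proof.
rewrite [leRHS]green_fun_recl; apply: lee_paddl; first exact: dirac_mass_ge0.
rewrite lee_wpmul2l// -[in leLHS](mulKg s x).
exact: (le_esum_term (fun t => (m t)%:E * green_fun z (t^-1 * (s * x))%g)).
Qed.

Lemma green_fun_first_visit g x : (forall n, avoiding g n x = 0) ->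
  green_fun z x = hitting_fun z g * green_fun z (g^-1 * x)%g.
Proof.
move=> gx; rewrite -esum_cauchy_product//.
apply: eq_esum => n _; rewrite (law_first_visit g) gx add0e ge0_sume_distrr.
  apply: eq_bigr => k _; rewrite muleACA -EFinM -exprD subnKC//.
  by rewrite -ltnS.
by move=> k _; rewrite mule_ge0 ?hitting_ge0 ?law_ge0.
Qed.

Lemma green_funE g : green_fun z g = hitting_fun z g * green_fun z 1%g.
Proof. by rewrite (green_fun_first_visit (avoiding_self g)) mulVg. Qed.

Lemma hitting_fun_le1 g : (z <= 1)%R -> hitting_fun z g <= 1.
Proof.
move=> z1; apply: esum_nat_le => [//|N].
rewrite (@le_trans _ _ (\sum_(k < N.+1) hitting g k))//; last first.
  rewrite -(esum_avoiding_hitting g N) leeDr// esum_ge0// => x _.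
  exact: avoiding_ge0.
rewrite big_ord_recr/= lee_paddr ?hitting_ge0//; apply: lee_sum => k _.
by rewrite gee_pMl ?hitting_ge0// ?lee_fin ?exprn_ile1//.
Qed.

Lemma hitting_fun_fin g : (z <= 1)%R -> hitting_fun z g \is a fin_num.
Proof.
move=> z1.
exact: ge0_fin_num_le (hitting_fun_ge0 g) (hitting_fun_le1 g z1) (ltry _).
Qed.

Lemma green_fun_le g : (z <= 1)%R -> green_fun z g <= green_fun z 1%g.
Proof.
move=> z1; rewrite green_funE.
by rewrite gee_pMl ?green_fun_ge0 ?hitting_fun_le1 ?hitting_fun_fin.
Qed.

Lemma esum_green_fun : (z < 1)%R ->
  \esum_(x in [set: G]) green_fun z x = ((1 - z)^-1)%:E.
Proof.
move=> z1; rewrite /green_fun exchange_esum// -esum_geometric ?z0//.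
apply: eq_esum => n _; rewrite esumZl// => [|x _]; last exact: law_ge0.
by rewrite esum_law mule1.
Qed.

Section Uniqueness.
Variables (phi : G -> \bar R) (C : R).
Hypothesis phi_bounded : forall x, 0 <= phi x <= C%:E.
Hypothesis phi_rec : forall y, phi y = dirac_mass y + z%:E * walk_step phi y.

Let partial_green N y : \bar R := \sum_(n < N) ((z ^+ n)%:E * law n y).

Let partial_green_ge0 N y : 0 <= partial_green N y.
Proof. exact: sume_ge0. Qed.

Let partial_greenS N y :
  partial_green N.+1 y = dirac_mass y + z%:E * walk_step (partial_green N) y.
Proof.
rewrite {1}/partial_green big_ord_recl expr0 mul1e; congr (_ + _).
rewrite (walk_step_sum (f := fun n x => (z ^+ n)%:E * law n x))//.
rewrite ge0_sume_distrr//; last by move=> n _; exact: walk_step_ge0.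
apply: eq_bigr => n _; rewrite walk_stepZ//; last exact: law_ge0.
by rewrite -lawS muleA -EFinM -exprS.
Qed.

Let C0 : (0 <= C)%R.
Proof. by rewrite -lee_fin; have /andP[/le_trans] := phi_bounded 1%g; apply. Qed.

Let partial_green_le N y : partial_green N y <= phi y.
Proof.
elim: N y => [|N IH] y.
  by rewrite /partial_green big_ord0; case/andP: (phi_bounded y).
by rewrite partial_greenS phi_rec leeD2l// lee_wpmul2l//; exact: le_walk_step.
Qed.

Let partial_green_ge N y : phi y <= partial_green N y + (z ^+ N * C)%:E.
Proof.
have zC0 n : 0 <= (z ^+ n * C)%:E by rewrite lee_fin mulr_ge0 ?exprn_ge0.
elim: N y => [|N IH] y.
  by rewrite /partial_green big_ord0 expr0 mul1r add0e; case/andP: (phi_bounded y).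
rewrite partial_greenS phi_rec -addeA leeD2l//.
apply: le_trans (lee_wpmul2l _ (le_walk_step IH _)) _; first exact: z0.
rewrite walk_stepD// walk_step_cst// ge0_muleDr ?walk_step_ge0//.
by rewrite exprS -mulrA [in leRHS]EFinM.
Qed.

Lemma green_fun_unique : (z < 1)%R -> phi =1 green_fun z.
Proof.
move=> z1 y; apply/eqP; rewrite eq_le; apply/andP; split; last first.
  by apply: esum_nat_le => // N; exact: partial_green_le.
apply/lee_addgt0Pr => e e0.
have [N zN] : exists N, (z ^+ N * C <= e)%R.
  have : (z ^+ n * C)%R @[n --> \oo] --> (0 * C)%R.
    by apply: cvgM; [apply: cvg_expr; rewrite ger0_norm|exact: cvg_cst].
  rewrite mul0r => /cvgrPdist_le /(_ e e0)[N _ /(_ N (leqnn N))] /=.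
  by rewrite sub0r normrN => zN; exists N; rewrite (le_trans (ler_norm _)).
by rewrite (le_trans (partial_green_ge N y))// leeD//; exact: esum_nat_ge.
Qed.

End Uniqueness.
End FixedParameter.

Section Irreducible.
Hypothesis m_gen : semigroup_generates [set g | m g != 0%R].

Lemma law_gt0 x : exists n, 0 < law n x.
Proof.
have [s [_ sA ->]] := m_gen x.
elim: s sA => [|a s IH] sA.
  by exists 0%N; rewrite big_nil law0 /dirac_mass eqxx.
have [t ts|n n0] := IH; first by apply: sA; rewrite inE ts orbT.
have ma : (0 < m a)%R by rewrite prob_mass_gt0//; apply: sA; rewrite mem_head.
exists n.+1; rewrite big_cons lawSl.
apply: (lt_le_trans _ (le_esum_term (t := a) _ _)) => //.
by rewrite mulKg mule_gt0// lte_fin.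
Qed.

Lemma green_fun_gt0 z x : (0 < z)%R -> 0 < green_fun z x.
Proof.
move=> z0; have [n n0] := law_gt0 x.
apply: (lt_le_trans _ (le_esum_term (t := n) _ _)) => //.
by rewrite mule_gt0// lte_fin exprn_gt0.
Qed.

End Irreducible.

(* The walk started at [1] and killed when it enters [A] at a positive time. *)
Section Excursions.
Variable A : pred G.

Definition excursion : nat -> G -> \bar R :=
  restricted_law (fun k x => (k == 0)%N || ~~ A x).

Definition excursion_return (n : nat) : \bar R :=
  if n is k.+1 then walk_step (excursion k) 1%g else 0.

Definition excursion_mass (n : nat) : \bar R :=
  \esum_(x in [set: G]) excursion n x.

Definition return_mass : \bar R := \esum_(n in [set: nat]) excursion_return n.

Lemma excursion_ge0 n x : 0 <= excursion n x.
Proof. exact: restricted_law_ge0. Qed.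

Lemma excursion_return_ge0 n : 0 <= excursion_return n.
Proof. by case: n => //= n; apply: walk_step_ge0 => // x; exact: excursion_ge0. Qed.

Lemma excursion_mass_ge0 n : 0 <= excursion_mass n.
Proof. by apply: esum_ge0 => x _; exact: excursion_ge0. Qed.

Lemma return_mass_ge0 : 0 <= return_mass.
Proof. by apply: esum_ge0 => n _; exact: excursion_return_ge0. Qed.

Lemma excursion0 x : excursion 0 x = dirac_mass x. Proof. by []. Qed.

Lemma excursion_mass0 : excursion_mass 0 = 1.
Proof. exact: esum_dirac_mass. Qed.

Lemma excursionS n x :
  excursion n.+1 x = if A x then 0 else walk_step (excursion n) x.
Proof. by rewrite /excursion /=; case: (A x). Qed.

Lemma excursion_in n x : A x -> excursion n.+1 x = 0.
Proof. by rewrite excursionS => ->. Qed.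

Lemma excursion_massS n : excursion_mass n.+1 +
    \esum_(x in [set: G]) (if A x then walk_step (excursion n) x else 0) =
  excursion_mass n.
Proof.
have step0 := walk_step_ge0 (excursion_ge0 n).
rewrite /excursion_mass -[RHS](esum_walk_step (excursion_ge0 n)) -esumD; last 2 first.
- by move=> x _; exact: excursion_ge0.
- by move=> x _; case: ifP.
by apply: eq_esum => x _; rewrite excursionS; case: ifP; rewrite (add0e, adde0).
Qed.

End Excursions.

Definition superharmonic (f : G -> R) : Prop :=
  forall x, \esum_(s in [set: G]) ((m s)%:E * (f (x * s)%g)%:E) <= (f x)%:E.

Section Superharmonic.
Variable f : G -> R.
Hypotheses (f0 : forall x, (0 <= f x)%R) (f1 : f 1%g = 1%R).
Hypothesis f_super : superharmonic f.

Let ef_ge0 x : 0 <= (f x)%:E. Proof. by rewrite lee_fin. Qed.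

Lemma esum_walk_step_superharmonic (eta : R) u : (0 <= eta)%R ->
  \esum_(s in [set: G]) ((m s)%:E * (f s)%:E) + eta%:E <= 1 ->
  (forall x, 0 <= u x) ->
  \esum_(y in [set: G]) (walk_step u y * (f y)%:E) + eta%:E * u 1%g <=
  \esum_(x in [set: G]) (u x * (f x)%:E).
Proof.
move=> eta0 defect u0.
have step0 x : 0 <= \esum_(s in [set: G]) ((m s)%:E * (f (x * s)%g)%:E).
  by apply: esum_ge0 => s _; rewrite mule_ge0.
rewrite esum_walk_step_mul// -(esumD_pred1 1%g); last 2 first.
- by move=> x; rewrite mule_ge0.
- by rewrite mule_ge0// lee_fin.
apply: le_esum => x _; case: eqVneq => [->|_]; last by rewrite adde0 lee_wpmul2l.
rewrite [eta%:E * _]muleC -ge0_muleDr ?lee_fin// lee_wpmul2l// f1.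
by under eq_esum do rewrite mul1g.
Qed.

Lemma green_fun_superharmonic (eta : R) : (0 < eta)%R ->
  \esum_(s in [set: G]) ((m s)%:E * (f s)%:E) + eta%:E <= 1 ->
  green_fun 1 1%g <= (eta^-1)%:E.
Proof.
move=> eta0 defect; have eta_ge0 := ltW eta0; have l0 := law_ge0.
have lf0 n x : 0 <= law n x * (f x)%:E by rewrite mule_ge0 ?law_ge0.
have telescope N : \esum_(x in [set: G]) (law N x * (f x)%:E) +
    eta%:E * \sum_(n < N) law n 1%g <= 1.
  elim: N => [|N IH].
    by rewrite big_ord0 mule0 adde0 esum_dirac_mass_mul// f1.
  rewrite big_ord_recr /= ge0_muleDr ?sume_ge0// addeCA addeC (le_trans _ IH)// leeD2r//.
  exact: esum_walk_step_superharmonic.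
rewrite green_fun1E; apply: esum_nat_le => [n|N]; first exact: law_ge0.
rewrite -[leRHS]mule1 lee_pdivlMl// (le_trans _ (telescope N))// leeDr//.
exact: esum_ge0.
Qed.

Lemma return_mass_le (A : pred G) : A 1%g -> m 1%g = 0%R ->
  return_mass A <= \esum_(s in [set: G]) (if A s then 0 else (m s * f s)%:E).
Proof.
move=> A1 m1; have e0 := excursion_ge0 A.
have ef0 n x : 0 <= excursion A n x * (f x)%:E by rewrite mule_ge0.
have f1_defect : \esum_(s in [set: G]) ((m s)%:E * (f s)%:E) + 0%:E <= 1.
  rewrite adde0 -f1; apply: le_trans (f_super 1%g).
  by apply: le_esum => s _; rewrite mul1g.
have start : \esum_(x in [set: G]) (excursion A 1 x * (f x)%:E) =
    \esum_(s in [set: G]) (if A s then 0 else (m s * f s)%:E).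
  apply: eq_esum => x _; rewrite excursionS; case: ifP => _; first by rewrite mul0e.
  by rewrite walk_step_dirac EFinM.
have telescope n : \esum_(x in [set: G]) (excursion A n.+1 x * (f x)%:E) +
    \sum_(k < n.+2) excursion_return A k <=
    \esum_(x in [set: G]) (excursion A 1 x * (f x)%:E).
  elim: n => [|n IH].
    by rewrite !big_ord_recr big_ord0 /= walk_step_dirac m1 !adde0.
  rewrite (le_trans _ IH)// big_ord_recr /= addeA addeAC leeD2r//.
  have := esum_walk_step_superharmonic (lexx 0%R) f1_defect (e0 n.+1).
  rewrite mul0e adde0; apply: le_trans; rewrite -(esumD_pred1 1%g) ?walk_step_ge0//.
  apply: le_esum => x _; rewrite excursionS; case: (eqVneq x 1%g) => [->|_].
    by rewrite A1 mul0e add0e f1 mule1.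
  by rewrite adde0; case: ifP => // _; rewrite mul0e mule_ge0 ?walk_step_ge0.
rewrite -start; apply: esum_nat_le => [n|N]; first exact: excursion_return_ge0.
case: N => [|N]; first by rewrite big_ord0 esum_ge0.
apply: le_trans (telescope N); rewrite [X in _ <= _ + X]big_ord_recr /= addeCA leeDl//.
by apply: adde_ge0; [exact: esum_ge0|exact: (excursion_return_ge0 A N.+1)].
Qed.

End Superharmonic.
End Walk.

(** * Path events *)

Lemma finitely_generated_countable (G : groupType) :
  finitely_generated G -> countable [set: G].
Proof.
move=> [S Sgen].
pose letter (c : bool * nat) : G :=
  (if c.1 then nth 1 S c.2 else (nth 1 S c.2)^-1)%g.
pose eval (s : seq (bool * nat)) : G := (\prod_(c <- s) letter c)%g.
suff -> : [set: G] = eval @` setT.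
  exact: card_le_trans (card_image_le _ _) (countableP _).
apply/seteqP; split => // g _; have [s [sS ->]] := Sgen g.
elim: s sS => [|x s IH] sS; first by exists [::] => //; rewrite /eval !big_nil.
have [y ys|l _ lE] := IH; first by apply: sS; rewrite inE ys orbT.
have [xS|xS] := sS x (mem_head _ _).
  exists ((true, index x S) :: l) => //; rewrite /eval big_cons -/(eval l) lE big_cons.
  by rewrite /letter /= nth_index.
exists ((false, index x^-1%g S) :: l) => //.
rewrite /eval big_cons -/(eval l) lE big_cons.
by rewrite /letter /= nth_index// invgK.
Qed.

Lemma free_product_countable (I : countType) (Gam : I -> groupType) :
  (forall i, countable [set: Gam i]) -> countable [set: free_product Gam].
Proof.
move=> Gc.
have code_exists i : {e : Gam i -> nat | injective e}.
  apply: cid; have /countable_injP[e einj] := Gc i.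
  by exists e => x y; apply: einj; rewrite inE.
pose e i := sval (code_exists i); have e_inj i := svalP (code_exists i).
pose code (a : {i & Gam i}) := (tag a, e (tag a) (tagged a)).
have code_inj : injective code.
  by move=> [i x] [j y] [ij]; case: _ / ij y => y /= /e_inj ->.
apply/countable_injP; exists (fun x => pickle (map code (fp_word x))).
move=> x y _ _ /(pcan_inj pickleK)/(inj_map code_inj) xy.
exact: val_inj.
Qed.

Section PathEvents.
Local Open Scope ereal_scope.
Context {R : realType} {d : measure_display} {T : measurableType d}.
Variables (P : probability T R) (G : groupType).
Hypothesis G_countable : countable [set: G].

Section Fibers.
Variable Z : T -> G.
Hypothesis Z_meas : forall y, measurable (Z @^-1` [set y]).

Lemma measurable_fibers (A : set G) : measurable (Z @^-1` A).
Proof.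
have -> : Z @^-1` A = \bigcup_x (if x \in A then Z @^-1` [set x] else set0).
  apply/seteqP; split => [w Aw|w [x _]].
    by exists (Z w) => //; rewrite mem_set.
  by case: ifPn => //; rewrite inE /= => Ax ->.
apply: countable_bigcupT_measurable => // x.
by case: ifP.
Qed.

Let enum_fibers : exists e : G -> nat,
  [/\ injective e, trivIset setT (fun n => [set w | e (Z w) = n]),
      forall n, measurable [set w | e (Z w) = n] &
      forall a : set T -> \bar R, (forall E, 0 <= a E) -> a set0 = 0 ->
      \esum_(n in [set: nat]) a [set w | e (Z w) = n] =
      \esum_(x in [set: G]) a (Z @^-1` [set x])].
Proof.
have /countable_injP[e einj] := G_countable.
have {}einj : injective e by move=> x y; apply: einj; rewrite inE.
exists e; split => //.
- by move=> i j _ _ [w [/= <- <-]].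
- by move=> n; exact: (measurable_fibers [set x | e x = n]).
move=> a a0 a00; transitivity (\esum_(n in e @` [set: G]) a [set w | e (Z w) = n]).
  rewrite [RHS]esum_mkcond; apply: eq_esum => n _; case: ifPn => //.
  rewrite notin_setE => /= nN; rewrite -[RHS]a00; congr a.
  by rewrite -subset0 => w /= wn; apply: nN; exists (Z w).
rewrite esum_image; last by move=> x y _ _ /einj.
apply: eq_esum => x _; congr a; apply/seteqP; split => w /=; first by move/einj.
by move=> ->.
Qed.

Lemma prob_fibers (E : set T) : measurable E ->
  P E = \esum_(x in [set: G]) P (E `&` Z @^-1` [set x]).
Proof.
move=> mE; have [e [einj etriv emeas eE]] := enum_fibers.
rewrite -(eE (fun F => P (E `&` F)))//; last by rewrite setI0 measure0.
rewrite -nneseries_esumT//.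
rewrite -[in LHS](setIT E) (_ : setT = \bigcup_n [set w | e (Z w) = n]); last first.
  by apply/seteqP; split => // w _; exists (e (Z w)).
rewrite setI_bigcupr measure_bigcup//.
- by apply: eq_eseriesl => n; rewrite in_setT.
- by move=> n _; exact: measurableI.
- exact: trivIset_setIl.
Qed.

Lemma integral_fibers (f : G -> R) : (forall x, 0 <= f x)%R ->
  \int[P]_w (f (Z w))%:E =
  \esum_(x in [set: G]) ((f x)%:E * P (Z @^-1` [set x])).
Proof.
move=> f0; have [e [einj etriv emeas eE]] := enum_fibers.
have -> : setT = \bigcup_n [set w | e (Z w) = n] :> set T.
  by apply/seteqP; split => // w _; exists (e (Z w)).
rewrite ge0_integral_bigcup//; last 2 first.
- move=> _ Y mY; apply: measurableI; first exact: bigcup_measurable.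
  exact: (measurable_fibers [set x | Y (f x)%:E]).
- by move=> w _; rewrite lee_fin.
rewrite nneseries_esumT; last by move=> n; apply: integral_ge0 => w _; rewrite lee_fin.
rewrite (eE (fun F => \int[P]_(w in F) (f (Z w))%:E)); last 2 first.
- by move=> E; apply: integral_ge0 => w _; rewrite lee_fin.
- by rewrite integral_set0.
apply: eq_esum => x _; rewrite -integral_cst//.
by apply: eq_integral => w; rewrite inE/= => ->.
Qed.

End Fibers.

Variables (m : G -> R) (X : nat -> T -> G).
Hypotheses (m_prob : prob_mass m) (X_walk : random_walk P m 1%g X).
Implicit Types (A : nat -> set G).

Let X_meas n y : measurable (X n @^-1` [set y]).
Proof. by case: X_walk. Qed.

Definition history A n : set T := [set w | forall k, (k <= n)%N -> A k (X k w)].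

Lemma measurable_history A n : measurable (history A n).
Proof.
have -> : history A n = \bigcap_(k in `I_n.+1) (X k @^-1` A k) by [].
by apply: bigcap_measurableType => k _; exact: measurable_fibers.
Qed.

Let pin A j x : nat -> set G := fun k => if k == j then A k `&` [set x] else A k.

Let history_pin A n j x : (j <= n)%N ->
  history A n `&` X j @^-1` [set x] = history (pin A j x) n.
Proof.
move=> jn; apply/seteqP; split => w /=.
  move=> [wA wx] k kn; rewrite /pin; case: eqVneq => [kj|_]; last exact: wA.
  by split; [exact: wA|rewrite kj].
move=> wA; split=> [k /wA|]; first by rewrite /pin; case: ifP => // _ [].
by have := wA j jn; rewrite /pin eqxx => -[].
Qed.

(* Pinning the positions at times [j - 1, ..., 0] one after the other reduces
   the claim to the Markov property for fully prescribed pasts. *)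
Let markov_history_pinned A n j (x : nat -> G) y : (j <= n)%N ->
  (forall k, (j <= k <= n)%N -> A k `<=` [set x k]) ->
  P (history A n `&` X n.+1 @^-1` [set y]) =
  P (history A n) * (m ((x n)^-1 * y)%g)%:E.
Proof.
elim: j A x => [|j IH] A x jn Ax.
  have [AxT|/existsNP[k /not_implyP[kn NAk]]] :=
      pselect (forall k, (k <= n)%N -> A k (x k)).
    have [_ _ /(_ n x y)] := X_walk; congr (P _ = P _ * _);
      apply/seteqP; split=> w /=.
    - by move=> [wx ?]; split => // k kn; rewrite wx//; exact: AxT.
    - by move=> [wA ?]; split => // k kn; apply: Ax => //; exact: wA.
    - by move=> wx k kn; rewrite wx//; exact: AxT.
    - by move=> wA k kn; apply: Ax => //; exact: wA.
  have -> : history A n = set0.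
    rewrite -subset0 => w /= /(_ k kn) wA; apply: NAk.
    by rewrite -(Ax k kn _ wA).
  by rewrite set0I measure0 mul0e.
have mA := measurable_history A n.
rewrite (prob_fibers (X_meas j) mA) (prob_fibers (X_meas j)); last exact: measurableI.
rewrite -esumZr//; last by rewrite lee_fin prob_mass_ge0.
apply: eq_esum => a _; rewrite setIAC history_pin ?(ltnW jn)//.
pose xa k := if k == j then a else x k.
have -> : x n = xa n by rewrite /xa gtn_eqF.
apply: IH; first exact: ltnW.
move=> k /andP[jk kn]; rewrite /pin /xa; case: eqVneq => [_ z []//|kj].
by apply: Ax; rewrite kn andbT ltn_neqAle eq_sym kj.
Qed.

Lemma markov_history A n x y :
  P (history A n `&` X n @^-1` [set x] `&` X n.+1 @^-1` [set y]) =
  P (history A n `&` X n @^-1` [set x]) * (m (x^-1 * y)%g)%:E.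
Proof.
rewrite history_pin//; apply: (@markov_history_pinned _ n n (fun=> x)) => // k.
by rewrite -eqn_leq => /eqP <-; rewrite /pin eqxx => z [].
Qed.

Lemma prob_history_step A n y :
  P (history A n `&` X n.+1 @^-1` [set y]) =
  walk_step m (fun x => P (history A n `&` X n @^-1` [set x])) y.
Proof.
have mA := measurable_history A n.
rewrite (prob_fibers (X_meas n)); last exact: measurableI.
by apply: eq_esum => x _; rewrite setIAC markov_history.
Qed.

Let prob_start x : P (X 0%N @^-1` [set x]) = dirac_mass R x.
Proof.
have [_ X0 _] := X_walk; rewrite /dirac_mass; case: eqVneq => [->//|xN1].
apply/eqP; rewrite eq_le measure_ge0 andbT.
rewrite (@le_trans _ _ (P (~` (X 0%N @^-1` [set 1%g]))))//.
  apply: le_measure; rewrite ?inE//; first exact: measurableC.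
  by move=> w /= wx w1; move/eqP: xN1; apply; rewrite -wx.
by rewrite probability_setC// X0 subee.
Qed.

Let history_last A n x : ~ A n x -> history A n `&` X n @^-1` [set x] = set0.
Proof.
move=> NAx; rewrite -subset0 => w /= [wA wx]; apply: NAx.
by rewrite -wx; exact: wA.
Qed.

Lemma prob_restricted_law (A : nat -> pred G) n x :
  P (history (fun k => [set z | A k z]) n `&` X n @^-1` [set x]) =
  restricted_law m A n x.
Proof.
elim: n x => [|n IH] x /=; case: ifPn => [Ax|/negP NAx].
- rewrite -prob_start; congr (P _); apply/seteqP; split => w /=; first by case.
  by move=> wx; split=> // k; rewrite leqn0 => /eqP ->; rewrite wx.
- by rewrite history_last ?measure0.
- rewrite -(eq_walk_step m IH) -prob_history_step; congr (P _).
  apply/seteqP; split => w /= [wA wx]; split => // k kn.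
    by apply: wA; exact: leqW.
  move: kn; rewrite leq_eqVlt => /predU1P[->|]; first by rewrite wx.
  by rewrite ltnS; exact: wA.
- by rewrite history_last ?measure0.
Qed.

Lemma prob_restricted_step (A : nat -> pred G) n y :
  P (history (fun k => [set z | A k z]) n `&` X n.+1 @^-1` [set y]) =
  walk_step m (restricted_law m A n) y.
Proof.
by rewrite prob_history_step; apply: eq_walk_step => x; exact: prob_restricted_law.
Qed.

Lemma prob_law n x : P (X n @^-1` [set x]) = law m n x.
Proof.
rewrite /law -prob_restricted_law; congr (P _).
by apply/seteqP; split => w //= [].
Qed.

Lemma distribution_atE n x : distribution_at P X n x = fine (law m n x).
Proof. by rewrite /distribution_at prob_law. Qed.

Lemma prob_first_visit y n : P (first_visit X y n) = hitting m y n.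
Proof.
case: n => [|n] /=.
  rewrite -(law0 m) -prob_law; congr (P _).
  by apply/seteqP; split => w /=; [case|move=> ?; split].
rewrite -(prob_restricted_step (fun _ x => x != y)); congr (P _).
apply/seteqP; split => w /=.
  by move=> [wy wN]; split=> // k kn; apply/eqP; exact: wN.
by move=> [wN wy]; split=> // k kn; apply/eqP; exact: wN.
Qed.

Lemma mean_neg_logE n : mean_neg_log P X n = shannon (fun x => fine (law m n x)).
Proof.
rewrite /mean_neg_log unlock.
rewrite (integral_fibers (X_meas n)
  (f := fun x => (- ln (distribution_at P X n x))%R)); last first.
  move=> x; rewrite oppr_ge0 ln_le0// distribution_atE.
  exact: (prob_mass_le1 x (law_prob m_prob n)).
apply: eq_esum => x _; rewrite prob_law distribution_atE.
by rewrite -[X in _ * X]fineK ?law_fin// -EFinM mulNr mulrC.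
Qed.

End PathEvents.

Section GeneratingFunctions.
Local Open Scope ereal_scope.
Variable R : realType.

Lemma gen_funE (a : nat -> \bar R) (z : R) : (0 <= z)%R ->
  (forall n, 0 <= a n) -> (forall n, a n \is a fin_num) ->
  \esum_(n in [set: nat]) ((z ^+ n)%:E * a n) < +oo ->
  (gen_fun (fun n => fine (a n)) z)%:E = \esum_(n in [set: nat]) ((z ^+ n)%:E * a n).
Proof.
move=> z0 a0 afin a_sum.
have termE n : (z ^+ n)%:E * a n = (fine (a n) * z ^+ n)%:E.
  by rewrite mulrC EFinM fineK.
have term_ge0 n : (0 <= fine (a n) * z ^+ n)%R.
  by rewrite mulr_ge0 ?exprn_ge0 ?fine_ge0.
rewrite (eq_esum (fun n _ => termE n)) in a_sum *.
rewrite -nneseries_esumT// in a_sum *.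
rewrite /gen_fun -EFin_lim; last exact: nnseries_is_cvg.
by apply: congr_lim; apply/funext => n /=; rewrite /series /= sumEFin.
Qed.

Context {d : measure_display} {T : measurableType d}.
Variables (P : probability T R) (G : groupType) (m : G -> R) (X : nat -> T -> G).
Hypotheses (G_countable : countable [set: G]) (m_prob : prob_mass m).
Hypothesis X_walk : random_walk P m 1%g X.

Lemma greenE y z : (0 <= z)%R -> green_fun m z y < +oo ->
  (green P X y z)%:E = green_fun m z y.
Proof.
move=> z0 Gfin; rewrite /green /green_fun -(gen_funE z0 _ _ Gfin).
- congr (gen_fun _ z)%:E; apply/funext => n.
  by rewrite (distribution_atE G_countable m_prob X_walk).
- by move=> n; exact: law_ge0.
- by move=> n; exact: law_fin.
Qed.

Lemma first_passageE y z : (0 <= z <= 1)%R ->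
  (first_passage P X y z)%:E = hitting_fun m z y.
Proof.
move=> /andP[z0 z1]; rewrite /first_passage /hitting_fun -gen_funE//.
- congr (gen_fun _ z)%:E; apply/funext => n.
  by rewrite (prob_first_visit G_countable m_prob X_walk).
- by move=> n; exact: hitting_ge0.
- by move=> n; exact: hitting_fin.
- exact: le_lt_trans (hitting_fun_le1 m_prob z0 y z1) (ltry _).
Qed.

End GeneratingFunctions.

(** * Entropy as a rate of escape *)

Section RealLimits.
Variable R : realType.
Implicit Types (u : R^nat).

Lemma cesaro_ord u (l : R) : u @ \oo --> l ->
  n%:R^-1 * (\sum_(k < n) u k) @[n --> \oo] --> l.
Proof.
move=> /cesaro ul; rewrite -cvg_shiftS; apply: cvg_trans ul.
apply: near_eq_cvg; apply: nearW => n.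
by rewrite /arithmetic_mean /= /series /= big_mkord.
Qed.

Lemma near_average_ge u (a e : R) : 0 < e -> (\forall n \near \oo, a <= u n) ->
  \forall n \near \oo, a - e <= n%:R^-1 * (\sum_(k < n) u k).
Proof.
move=> e0 ua; pose v n := Num.min (u n) a.
have va : v @ \oo --> a.
  apply: cvg_near_cst; apply: filterS ua => n au.
  by rewrite /v min_r.
have near_a : \forall n \near \oo, a - e <= n%:R^-1 * (\sum_(k < n) v k).
  by apply: (cvgr_ge _ (cesaro_ord va)); rewrite gtrBl.
apply: filterS near_a => n /le_trans; apply.
rewrite ler_wpM2l ?invr_ge0//; apply: ler_sum => k _.
by rewrite ge_min lexx.
Qed.

Lemma cvg_inv_mulr (c : R) : n%:R^-1 * c @[n --> \oo] --> 0.
Proof.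
rewrite -(mul0r c); apply: cvgM; last exact: cvg_cst.
by rewrite -cvg_shiftS; exact: cvg_harmonic.
Qed.

Lemma near_left1 : \forall z \near (1 : R)^'-, 0 < z < 1.
Proof.
by near=> z; apply/andP; split; near: z; [exact: nbhs_left_gt|exact: nbhs_left_lt].
Unshelve. all: by end_near. Qed.

Lemma near0_mulr_lt (c d : R) : 0 < d -> \forall e \near 0^'+, e * c < d.
Proof.
move=> d0; have : (e * c) @[e --> (0 : R)^'+] --> 0 * c.
  by apply: cvg_at_right_filter; apply: cvgM; [exact: cvg_id|exact: cvg_cst].
by move=> ec; apply: (cvgr_lt _ ec); rewrite mul0r.
Qed.

End RealLimits.

Section GreenSpeed.
Local Open Scope ereal_scope.
Variables (R : realType) (G : groupType) (m : G -> R).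
Hypotheses (m_prob : prob_mass m).
Hypothesis m_gen : semigroup_generates [set g | m g != 0%R].
Hypothesis transient : green_fun m 1 1%g < +oo.
Implicit Types (z : R) (s x : G) (n : nat).

Let m_ge0 x : (0 <= m x)%R. Proof. exact: prob_mass_ge0. Qed.
Let m0 x : 0 <= (m x)%:E. Proof. by rewrite lee_fin. Qed.
Let law_nonneg := law_ge0 m_prob.

Let itv_oc_cc z : (0 < z <= 1)%R -> (0 <= z <= 1)%R.
Proof. by move=> /andP[/ltW -> ->]. Qed.

Let itv_oo_oc z : (0 < z < 1)%R -> (0 < z <= 1)%R.
Proof. by move=> /andP[-> /ltW ->]. Qed.

Let one_oc : (0 < (1 : R) <= 1)%R. Proof. by rewrite ltr01 lexx. Qed.

Definition green_real z x : R := fine (green_fun m z x).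

Lemma green_fun_fin z x : (0 <= z <= 1)%R -> green_fun m z x \is a fin_num.
Proof.
move=> /andP[z0 z1]; apply: ge0_fin_num_le transient; first exact: green_fun_ge0.
apply: le_trans (green_fun_le m_prob ler01 x (lexx _)).
by apply: le_esum => n _; rewrite lee_wpmul2r// lee_fin expr1n exprn_ile1.
Qed.

Lemma green_realK z x : (0 <= z <= 1)%R -> (green_real z x)%:E = green_fun m z x.
Proof. by move=> z01; rewrite fineK ?green_fun_fin. Qed.

Lemma green_real_gt0 z x : (0 < z <= 1)%R -> (0 < green_real z x)%R.
Proof.
move=> z01; rewrite -lte_fin green_realK ?itv_oc_cc//.
by case/andP: z01 => z0 _; exact: green_fun_gt0.
Qed.

Lemma green_real_le z x : (0 <= z <= 1)%R -> (green_real z x <= green_real z 1%g)%R.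
Proof.
move=> z01; rewrite -lee_fin !green_realK//; case/andP: z01 => z0.
exact: green_fun_le.
Qed.

Lemma law_le_green n x : law m n x <= (green_real 1 x)%:E.
Proof. by rewrite green_realK ?ler01 ?lexx// green_fun1E; exact: le_esum_term. Qed.

Lemma green_real_step_ge z s x : (0 <= z <= 1)%R ->
  (z * m s * green_real z x <= green_real z (s * x)%g)%R.
Proof.
move=> z01; rewrite -lee_fin 2!EFinM !green_realK// -muleA.
by case/andP: z01 => z0 _; exact: green_fun_step_ge.
Qed.

Lemma green_real_cvg x : green_real z x @[z --> 1%R^'-] --> green_real 1 x.
Proof.
pose p k := fine (law m k x).
have p_ge0 k : (0 <= p k)%R by rewrite fine_ge0.
have pE k : (p k)%:E = law m k x by rewrite fineK// law_fin.
have greenE z : (0 <= z <= 1)%R ->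
    \esum_(k in [set: nat]) (z ^+ k * p k)%:E = (green_real z x)%:E.
  by move=> z1; rewrite green_realK//; apply: eq_esum => k _; rewrite EFinM pE.
have : \esum_(k in [set: nat]) (z ^+ k * p k)%:E @[z --> 1%R^'-] -->
    \esum_(k in [set: nat]) (1 ^+ k * p k)%:E.
  apply: (esum_dominated (g := p)).
  - apply: filterS (near_left1 R) => z /itv_oo_oc/itv_oc_cc/andP[z0 z1] k.
    by rewrite mulr_ge0 ?exprn_ge0//= ler_piMl// exprn_ile1.
  - move=> k; apply: cvgM; last exact: cvg_cst.
    by apply: cvg_at_left_filter; exact: exprn_continuous.
  - have := greenE _ (itv_oc_cc one_oc); under eq_esum do rewrite expr1n mul1r.
    by move=> ->; rewrite ltry.
rewrite greenE ?itv_oc_cc// => green_cvg.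
suff : (green_real z x)%:E @[z --> 1%R^'-] --> (green_real 1 x)%:E by case/fine_cvgP.
apply: cvg_trans green_cvg; apply: near_eq_cvg.
by apply: filterS (near_left1 R) => z /itv_oo_oc/itv_oc_cc/greenE.
Qed.

Definition green_dist z x : R := (ln (green_real z 1%g) - ln (green_real z x))%R.

Definition mean_green_dist z n : \bar R :=
  \esum_(x in [set: G]) (law m n x * (green_dist z x)%:E).

Definition step_cost z s : R := (- ln (z * m s))%R.

(* By how much the increment of the Green distance along a step [s] falls short
   of its a priori bound [step_cost z s]. *)
Definition slack z s x : R :=
  (step_cost z s + green_dist z x - green_dist z (s * x)%g)%R.

Definition mean_slack z n : \bar R :=
  \esum_(s in [set: G]) \esum_(x in [set: G]) (law m n x * (m s * slack z s x)%:E).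

Lemma green_dist_ge0 z x : (0 < z <= 1)%R -> (0 <= green_dist z x)%R.
Proof.
move=> z01; rewrite subr_ge0 ler_ln ?posrE ?green_real_gt0// green_real_le//.
exact: itv_oc_cc.
Qed.

Lemma step_cost_ge0 z s : (0 <= z <= 1)%R -> (0 <= step_cost z s)%R.
Proof.
move=> /andP[z0 z1]; rewrite oppr_ge0 ln_le0//.
by rewrite (le_trans (ler_pM _ _ z1 (prob_mass_le1 s m_prob))) ?mulr1.
Qed.

Lemma mul_step_cost_ge0 z s : (0 <= z <= 1)%R -> (0 <= m s * step_cost z s)%R.
Proof. by move=> z01; rewrite mulr_ge0 ?step_cost_ge0. Qed.

Lemma mul_slack_ge0 z s x : (0 < z <= 1)%R -> (0 <= m s * slack z s x)%R.
Proof.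
move=> z01; have [->|ms0] := eqVneq (m s) 0%R; first by rewrite mul0r.
have ms : (0 < m s)%R by rewrite prob_mass_gt0.
rewrite mulr_ge0//; have z0 : (0 < z)%R by case/andP: z01.
have := green_real_step_ge s x (itv_oc_cc z01).
rewrite -ler_ln ?posrE ?mulr_gt0 ?green_real_gt0//.
rewrite lnM ?posrE ?mulr_gt0 ?green_real_gt0//.
by rewrite /slack /step_cost /green_dist; lra.
Qed.

Lemma slack_ge0 z s x : (0 < z <= 1)%R -> (0 < m s)%R -> (0 <= slack z s x)%R.
Proof. by move=> z01 ms; have := mul_slack_ge0 s x z01; rewrite pmulr_rge0. Qed.

Lemma esum_step_cost z : (0 < z <= 1)%R ->
  \esum_(s in [set: G]) (m s * step_cost z s)%:E = shannon m + (- ln z)%:E.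
Proof.
move=> /andP[z0 z1]; have lnz : 0 <= (- ln z)%:E by rewrite lee_fin oppr_ge0 ln_le0.
rewrite -[X in _ + X](esum_prob_massZr m_prob lnz) /shannon -esumD.
- apply: eq_esum => s _; rewrite -EFinM -EFinD; congr (_%:E).
  have [->|ms0] := eqVneq (m s) 0%R; first by rewrite !mul0r oppr0 addr0.
  by rewrite /step_cost lnM ?posrE ?prob_mass_gt0//; ring.
- by move=> s _; rewrite lee_fin entropy_term_ge0.
- by move=> s _; rewrite mule_ge0.
Qed.

Lemma mean_green_dist0 z : mean_green_dist z 0 = 0.
Proof.
by rewrite /mean_green_dist esum_dirac_mass_mul /green_dist subrr.
Qed.

Lemma mean_green_dist_ge0 z n : (0 < z <= 1)%R -> 0 <= mean_green_dist z n.
Proof.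
by move=> z01; apply: esum_ge0 => x _; rewrite mule_ge0// lee_fin green_dist_ge0.
Qed.

Lemma mean_slack_ge0 z n : (0 < z <= 1)%R -> 0 <= mean_slack z n.
Proof.
move=> z01; apply: esum_ge0 => s _; apply: esum_ge0 => x _.
by rewrite mule_ge0// lee_fin mul_slack_ge0.
Qed.

Lemma esum_law_affine n (a b : R) (f : G -> R) : (0 <= a)%R -> (0 <= b)%R ->
  (forall x, 0 <= f x)%R ->
  \esum_(x in [set: G]) (law m n x * (a * f x + b)%:E) =
  a%:E * (\esum_(x in [set: G]) (law m n x * (f x)%:E)) + b%:E.
Proof.
move=> a0 b0 f0; have lf0 x : 0 <= law m n x * (f x)%:E by rewrite mule_ge0 ?lee_fin.
rewrite -[X in _ + X](mul1e b%:E) -(esum_law m_prob n) -esumZl ?lee_fin//.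
rewrite -esumZr ?lee_fin// -esumD => [|x _|x _]; try by rewrite !mule_ge0 ?lee_fin.
apply: eq_esum => x _; rewrite EFinD ge0_muleDr ?lee_fin ?mulr_ge0//.
by rewrite EFinM muleCA.
Qed.

Lemma mean_green_dist_rec z n : (0 < z <= 1)%R ->
  mean_green_dist z n.+1 + mean_slack z n =
  mean_green_dist z n + (shannon m + (- ln z)%:E).
Proof.
move=> z01; have zcc := itv_oc_cc z01.
have d0 x : (0 <= green_dist z x)%R by exact: green_dist_ge0.
have c0 s := mul_step_cost_ge0 s zcc.
have md0 s x : (0 <= m s * green_dist z x)%R by rewrite mulr_ge0.
have -> : mean_green_dist z n.+1 = \esum_(s in [set: G]) \esum_(x in [set: G])
    (law m n x * (m s * green_dist z (s * x)%g)%:E).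
  rewrite /mean_green_dist esum_lawS_mul//.
  apply: eq_esum => s _; rewrite -esumZl//; last first.
    by move=> x _; rewrite mule_ge0 ?lee_fin.
  by apply: eq_esum => x _; rewrite EFinM muleCA.
rewrite -esum_step_cost// -(esum_prob_massZr m_prob (mean_green_dist_ge0 n z01)).
rewrite -!esumD => [|s _|s _|s _|s _]; last 4 first.
- by rewrite mule_ge0 ?mean_green_dist_ge0.
- by rewrite lee_fin.
- by apply: esum_ge0 => x _; rewrite mule_ge0 ?lee_fin.
- by apply: esum_ge0 => x _; rewrite mule_ge0 ?lee_fin ?mul_slack_ge0.
apply: eq_esum => s _; rewrite -esum_law_affine// -esumD => [|x _|x _].
- apply: eq_esum => x _; rewrite -ge0_muleDr ?lee_fin ?mul_slack_ge0//.
  by rewrite -EFinD; congr (_ * _%:E); rewrite /slack; ring.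
- by rewrite mule_ge0 ?lee_fin.
- by rewrite mule_ge0 ?lee_fin ?mul_slack_ge0.
Qed.

Lemma mean_green_dist_sum z n : (0 < z <= 1)%R ->
  mean_green_dist z n + \sum_(k < n) mean_slack z k =
  n%:R%:E * (shannon m + (- ln z)%:E).
Proof.
move=> z01; elim: n => [|n IH].
  by rewrite mean_green_dist0 big_ord0 adde0 mul0e.
rewrite big_ord_recr /= addeCA addeC mean_green_dist_rec// -addeA addeCA.
by rewrite IH addeC -natr1 EFinD ge0_muleDl ?mul1e.
Qed.

Local Notation entropy n := (shannon (fun x => fine (law m n x))).

Lemma entropy_le z n : (0 < z < 1)%R ->
  entropy n <= mean_green_dist z n + (- ln ((1 - z) * green_real z 1%g))%:E.
Proof.
move=> zoo; have zoc := itv_oo_oc zoo; have zcc := itv_oc_cc zoc.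
have [z0 z1] := andP zoo; have one_sub_z_gt0 : (0 < 1 - z)%R by rewrite subr_gt0.
pose q x := ((1 - z) * green_real z x)%R.
have q_gt0 x : (0 < q x)%R by rewrite mulr_gt0// green_real_gt0.
have q_prob : prob_mass q.
  split; first by move=> x; exact: ltW.
  under eq_esum do rewrite EFinM green_realK//.
  rewrite esumZl ?lee_fin ?ltW// => [|x _]; last exact: green_fun_ge0 (ltW z0) _.
  by rewrite esum_green_fun ?ltW// -EFinM mulfV// gt_eqF.
apply: le_trans (gibbs_inequality (law_prob m_prob n) q_prob q_gt0) _.
rewrite -[mean_green_dist _ _]mul1e -esum_law_affine//; last 2 first.
- by rewrite oppr_ge0 ln_le0// (prob_mass_le1 1%g q_prob).
- by move=> x; exact: green_dist_ge0.
apply: le_esum => x _; rewrite -[law m n x]fineK ?law_fin// -EFinM lee_fin.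
by rewrite /green_dist /q !lnM ?posrE ?green_real_gt0//=; lra.
Qed.

Lemma entropy_ge n : mean_green_dist 1 n <= entropy n + (ln (green_real 1 1%g))%:E.
Proof.
have G1 : 0 <= (ln (green_real 1 1%g))%:E.
  rewrite lee_fin ln_ge0// -lee_fin (le_trans _ (law_le_green 0 1%g))//.
  by rewrite law0 /dirac_mass eqxx.
have p_prob := law_prob m_prob n.
rewrite -[X in _ <= _ + X](esum_prob_massZr p_prob G1) /shannon -esumD.
- apply: le_esum => x _; rewrite -[law m n x]fineK ?law_fin// -!EFinM -EFinD lee_fin.
  have pG : (fine (law m n x) <= green_real 1 x)%R.
    by rewrite -lee_fin fineK ?law_fin ?law_le_green.
  have := prob_mass_ge0 x p_prob; rewrite le_eqVlt => /predU1P[<-|p_gt0].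
    by rewrite !mul0r oppr0 addr0.
  have : (ln (fine (law m n x)) <= ln (green_real 1 x))%R.
    by rewrite ler_ln ?posrE ?green_real_gt0.
  by move=> /(ler_wpM2l (ltW p_gt0)); rewrite /green_dist /=; lra.
- by move=> x _; rewrite lee_fin (entropy_term_ge0 _ p_prob).
- by move=> x _; rewrite mule_ge0// lee_fin (prob_mass_ge0 _ p_prob).
Qed.

Hypothesis m_entropy : shannon m < +oo.

Let cost_fin z : shannon m + (- ln z)%:E \is a fin_num.
Proof. by rewrite fin_numD andbT ge0_fin_numE// shannon_ge0. Qed.

Let rate_fin z n : n%:R%:E * (shannon m + (- ln z)%:E) < +oo.
Proof. by rewrite -(fineK (cost_fin z)) -EFinM ltry. Qed.

Let sum_mean_slack_ge0 z n : (0 < z <= 1)%R -> 0 <= \sum_(k < n) mean_slack z k.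
Proof. by move=> z01; apply: sume_ge0 => k _; exact: mean_slack_ge0. Qed.

Lemma mean_green_dist_fin z n : (0 < z <= 1)%R -> mean_green_dist z n \is a fin_num.
Proof.
move=> z01; apply: ge0_fin_num_le (mean_green_dist_ge0 n z01) _ (rate_fin z n).
by rewrite -mean_green_dist_sum// leeDl// sum_mean_slack_ge0.
Qed.

Lemma mean_slack_fin z n : (0 < z <= 1)%R -> mean_slack z n \is a fin_num.
Proof.
move=> z01; apply: ge0_fin_num_le (mean_slack_ge0 n z01) _ (rate_fin z n.+1).
rewrite -mean_green_dist_sum// big_ord_recr /= addeA leeDr//.
by rewrite adde_ge0 ?mean_green_dist_ge0 ?sum_mean_slack_ge0.
Qed.

Lemma entropy_fin n : entropy n \is a fin_num.
Proof.
have [z z01] := filter_ex (near_left1 R).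
apply: ge0_fin_num_le (shannon_ge0 (law_prob m_prob n)) (entropy_le n z01) _.
by rewrite -(fineK (mean_green_dist_fin n (itv_oo_oc z01))) -EFinD ltry.
Qed.

Let average_slack z n : R := (n%:R^-1 * (\sum_(k < n) fine (mean_slack z k)))%R.

Lemma mean_green_dist_average z n : (0 < z <= 1)%R -> (0 < n)%N ->
  (n%:R^-1 * fine (mean_green_dist z n) =
   fine (shannon m) - ln z - average_slack z n)%R.
Proof.
move=> z01 n0; have := mean_green_dist_sum n z01.
rewrite -(fineK (mean_green_dist_fin n z01)) -(fineK (cost_fin z)).
under eq_bigr do rewrite -(fineK (mean_slack_fin _ z01)).
rewrite sumEFin -EFinM -EFinD => -[/(canRL (addrK _)) ->].
rewrite mulrBr mulKf ?pnatr_eq0 -?lt0n// fineD//.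
by rewrite ge0_fin_numE// shannon_ge0.
Qed.

(* The gap [1 - z] has to be chosen before [n] tends to infinity, since the
   constant in [entropy_le] blows up as [z] tends to [1]. *)
Section Rate.
Variable slack_limit : R.
Hypothesis slack_cvg : mean_slack 1 n @[n --> \oo] --> slack_limit%:E.
Hypothesis slack_near : forall e : R, (0 < e)%R -> \forall z \near 1%R^'-,
  \forall n \near \oo, (slack_limit - e)%:E <= mean_slack z n.

Let near_rate_ge (e : R) : (0 < e)%R -> \forall n \near \oo,
  (fine (shannon m) - slack_limit - e <= n%:R^-1 * fine (entropy n))%R.
Proof.
move=> e0; pose C := ln (green_real 1 1%g).
have lower_cvg : (fine (shannon m) - average_slack 1 n - n%:R^-1 * C)%R @[n --> \oo] -->
    (fine (shannon m) - slack_limit - 0)%R.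
  apply: cvgB; last exact: cvg_inv_mulr.
  apply: cvgB; first exact: cvg_cst.
  by have /fine_cvgP[_ real_cvg] := slack_cvg; exact: (cesaro_ord real_cvg).
rewrite subr0 in lower_cvg; near=> n.
have n0 : (0 < n)%N by near: n; exact: nbhs_infty_gt.
apply: (@le_trans _ _ (fine (shannon m) - average_slack 1 n - n%:R^-1 * C)%R).
  by near: n; apply: (cvgr_ge _ lower_cvg); rewrite gtrBl.
rewrite lerBlDr -mulrDr -[X in (X - _)%R]subr0 -(ln1 R) -mean_green_dist_average//.
rewrite ler_wpM2l ?invr_ge0// -lee_fin EFinD !fineK ?entropy_fin ?mean_green_dist_fin//.
exact: entropy_ge.
Unshelve. all: by end_near. Qed.

Let near_rate_le (e : R) : (0 < e)%R -> \forall n \near \oo,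
  (n%:R^-1 * fine (entropy n) <= fine (shannon m) - slack_limit + e)%R.
Proof.
move=> e0; have e4 : (0 < e / 4)%R by rewrite divr_gt0.
have ln_near : \forall z \near 1%R^'-, (- ln z < e / 4 :> R)%R.
  have : (- ln z)%R @[z --> (1 : R)%R^'-] --> (- ln 1 : R)%R.
    by apply: cvgN; apply: cvg_at_left_filter; exact: continuous_ln.
  by move=> ln_cvg; apply: (cvgr_lt _ ln_cvg); rewrite ln1 oppr0.
have [z [[z01 lnz] slack_ge]] :=
  filter_ex (filterI (filterI (near_left1 R) ln_near) (slack_near e4)).
have zoc := itv_oo_oc z01; pose C := (- ln ((1 - z) * green_real z 1%g))%R.
have average_ge : \forall n \near \oo,
    (slack_limit - e / 4 - e / 4 <= average_slack z n)%R.
  apply: (@near_average_ge _ (fun k => fine (mean_slack z k))) => //.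
  apply: filterS slack_ge => n.
  by rewrite -[X in _ <= X]fineK ?mean_slack_fin.
near=> n; have n0 : (0 < n)%N by near: n; exact: nbhs_infty_gt.
have C_small : (n%:R^-1 * C <= e / 4)%R.
  by near: n; apply: (cvgr_le _ (cvg_inv_mulr C)).
have average_n : (slack_limit - e / 4 - e / 4 <= average_slack z n)%R by near: n.
have entropy_n : (n%:R^-1 * fine (entropy n) <=
    n%:R^-1 * fine (mean_green_dist z n) + n%:R^-1 * C)%R.
  rewrite -mulrDr ler_wpM2l ?invr_ge0// -lee_fin EFinD.
  by rewrite !fineK ?entropy_fin ?mean_green_dist_fin//; exact: entropy_le.
rewrite (le_trans entropy_n)// mean_green_dist_average//; lra.
Unshelve. all: by end_near. Qed.

Theorem entropy_rate : (n%:R^-1)%:E * entropy n @[n --> \oo] -->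
  (fine (shannon m) - slack_limit)%:E.
Proof.
under eq_fun do rewrite -(fineK (entropy_fin _)) -EFinM.
apply: cvg_EFin; first exact: nearW.
apply/cvgrPdist_le => e e0; near=> n; rewrite /= distrC ler_distl.
by apply/andP; split; near: n; [exact: near_rate_ge|exact: near_rate_le].
Unshelve. all: by end_near. Qed.

End Rate.
End GreenSpeed.

(** * The factors of a free product *)

Section Projection.
Context {I : choiceType} (G : I -> groupType).
Local Open Scope group_scope.
Local Notation letter := {i : I & G i}.
Local Notation Tg := (Tagged G).
Implicit Types (x y : free_product G) (s t : seq letter).

(* The first letter of [x] if it belongs to the factor [i], else [1]; the
   default of [tagged_as] is its first argument. *)
Definition fp_head (i : I) x : G i :=
  if fp_word x is b :: _ then tagged_as (Tg (1 : G i)) b else 1.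

Definition fp_tail (i : I) x : free_product G := (fp_inj (fp_head i x))^-1 * x.

Definition in_factor (i : I) x : bool := x == fp_inj (fp_head i x).

Lemma tagged_as1_neq i (b : letter) :
  tag b != i -> tagged_as (Tg (1 : G i)) b = 1.
Proof.
case: b => j y /= ji; rewrite /tagged_as /=; case: eqP => // ij.
by exfalso; move/eqP: ji; apply; exact: esym.
Qed.

Lemma tagged_as_self i (g h : G i) : tagged_as (Tg g) (Tg h) = h.
Proof. exact: (@tagged_asE I (fun i => G i) (Tg g) h). Qed.

Lemma fp_word_inj i (g : G i) : fp_word (fp_inj g) = cons_letter g [::].
Proof. by []. Qed.

Lemma fp_inj1 i : fp_inj (1 : G i) = 1.
Proof. by apply: val_inj; rewrite /= /cons_letter eqxx. Qed.

Lemma fp_injV i (g : G i) : fp_inj g^-1 = (fp_inj g)^-1.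
Proof. by apply: (@mulgI _ (fp_inj g)); rewrite -fp_injM !mulgV fp_inj1. Qed.

Lemma fp_word_injM i (g : G i) x :
  fp_word (fp_inj g * x) = lact (Tg g) (fp_word x).
Proof.
rewrite [LHS]/= wmul_cons_letter//; exact: fp_reduced.
Qed.

Lemma fp_head_injM i (g : G i) x : fp_head i (fp_inj g * x) = g * fp_head i x.
Proof.
rewrite /fp_head fp_word_injM; case: x => -[|[j y] s] rs /=.
  rewrite /cons_letter mulg1; case: eqVneq => [->//|_].
  by rewrite tagged_as_self.
have [ij|ij] := eqVneq j i; last first.
  rewrite tagged_as1_neq// mulg1 /cons_letter; case: eqVneq => [->|_].
    by rewrite tagged_as1_neq.
  by rewrite tagged_as_self.
move: y rs; rewrite {j}ij => y; rewrite reduced_cons => /and3P[/= _ far _].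
rewrite !tagged_as_self /cons_letter; case: eqVneq => [->|_].
  by case: s far => //= b s; rewrite eq_sym => /tagged_as1_neq.
by rewrite tagged_as_self.
Qed.

Lemma fp_head1 i : fp_head i 1 = 1. Proof. by []. Qed.

Lemma fp_head_inj i (g : G i) : fp_head i (fp_inj g) = g.
Proof. by rewrite -[fp_inj g]mulg1 fp_head_injM fp_head1 mulg1. Qed.

Lemma fp_inj_inj i : injective (@fp_inj I G i).
Proof. exact: can_inj (fp_head_inj (i := i)). Qed.

Lemma fp_head_inj_neq i j (h : G j) : j != i -> fp_head i (fp_inj h) = 1.
Proof.
move=> ji; rewrite /fp_head fp_word_inj /cons_letter; case: eqVneq => // _.
by rewrite tagged_as1_neq.
Qed.

Lemma fp_head_tail i x : fp_head i (fp_tail i x) = 1.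
Proof. by rewrite /fp_tail -fp_injV fp_head_injM mulVg. Qed.

Lemma fp_inj_head_tail i x : fp_inj (fp_head i x) * fp_tail i x = x.
Proof. by rewrite mulVKg. Qed.

Lemma fp_tail_injM i (g : G i) x : fp_tail i (fp_inj g * x) = fp_tail i x.
Proof. by rewrite /fp_tail fp_head_injM fp_injM invgM mulgA mulgVK. Qed.

Lemma in_factorE i x : in_factor i x = (fp_tail i x == 1).
Proof. by rewrite mulVg_eq1 eq_sym. Qed.

Lemma in_factor_injM i (g : G i) x : in_factor i (fp_inj g * x) = in_factor i x.
Proof. by rewrite !in_factorE fp_tail_injM. Qed.

Lemma in_factor_inj i (g : G i) : in_factor i (fp_inj g).
Proof. by rewrite /in_factor fp_head_inj. Qed.

Lemma in_factorP i x : reflect (exists g : G i, x = fp_inj g) (in_factor i x).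
Proof.
apply: (iffP eqP) => [xE|[g ->]]; first by exists (fp_head i x).
by rewrite fp_head_inj.
Qed.

Lemma in_factor1 i : in_factor i 1.
Proof. by rewrite -(fp_inj1 i) in_factor_inj. Qed.

Let wmul_letter_head b s j (h : G j) c t : reduced (b :: s) ->
  wmul (b :: s) (cons_letter h [::]) = c :: t -> tag c = tag b.
Proof.
elim: s b c t => [|b' s IH] [i y] c t.
  rewrite reduced_cons => /and3P[/= y1 _ _]; rewrite /cons_letter /lact.
  case: eqVneq => [_ /=|_ /=]; first by rewrite /cons_letter (negbTE y1) => -[<-].
  case: ifP => _; rewrite /cons_letter; first by case: eqP => // _ [<-].
  by rewrite (negbTE y1) => -[<-].
rewrite reduced_cons => /and3P[/= y1 ib' rs].
move: (IH b'); rewrite /=; case: (lact b' _) => [|c' t'] IHb'.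
  by rewrite /lact /cons_letter (negbTE y1) => -[<-].
have c'b' := IHb' _ _ rs erefl.
by rewrite lact_neq /= ?c'b' 1?eq_sym// /cons_letter (negbTE y1) => -[<-].
Qed.

(* A right multiplication by one letter changes the first letter only when the
   word lies inside a factor. *)
Lemma fp_head_mul_letter i x j (h : G j) : ~~ in_factor i x ->
  fp_head i (x * fp_inj h) = fp_head i x.
Proof.
case: x => -[|a s] rs xN.
  by case/negP: xN; rewrite (_ : FreeProduct rs = 1) ?in_factor1//; exact: val_inj.
rewrite /fp_head.
have -> : fp_word (FreeProduct rs * fp_inj h) = wmul (a :: s) (cons_letter h [::]) by [].
rewrite [fp_word _]/=.
have [ai|ai] := eqVneq (tag a) i; last first.
  rewrite [RHS]tagged_as1_neq//.
  have := @wmul_letter_head a s j h; case: (wmul _ _) => // c t /(_ c t rs erefl) ca.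
  by rewrite tagged_as1_neq// ca.
case: a ai rs xN => [i' y] /= ii'; move: y; rewrite {i'}ii' => y rs.
case: s rs => [|b s] rs xN.
  case/negP: xN; apply/in_factorP; exists y; apply: val_inj => /=.
  by move: rs; rewrite reduced_cons /cons_letter => /and3P[/negbTE ->].
move: rs {xN}; rewrite reduced_cons => /and3P[/= y1 ib rs].
have := @wmul_letter_head b s j h; rewrite /=.
case: (lact b _) => [_|c t /(_ c t rs erefl) cb].
  by rewrite /lact /cons_letter (negbTE y1).
by rewrite lact_neq /= ?cb 1?eq_sym// /cons_letter (negbTE y1).
Qed.

End Projection.

Section FactorMeasure.
Local Open Scope ereal_scope.
Variables (R : realType) (I : finType) (Gam : I -> groupType).
Variables (alpha : I -> R) (mu : forall i, Gam i -> R).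
Arguments mu : clear implicits.

Local Notation Gamma := (free_product Gam).
Local Notation nu := (fp_measure alpha mu).

Record fp_steps : Prop := FpSteps {
  factor_prob : forall i, prob_mass (mu i);
  factor_no_loop : forall i, mu i 1%g = 0%R;
  weight_gt0 : forall i, (0 < alpha i)%R;
  weight_sum : (\sum_i alpha i = 1)%R }.

Hypothesis steps : fp_steps.

Let mu0 i g : (0 <= mu i g)%R.
Proof. exact: prob_mass_ge0 (factor_prob steps i). Qed.

Let alpha_ge0 i : (0 <= alpha i)%R. Proof. exact/ltW/weight_gt0. Qed.

Lemma weight_le1 i : (alpha i <= 1)%R.
Proof. by rewrite -(weight_sum steps) (bigD1 i)//= lerDl sumr_ge0. Qed.

Lemma fp_measure1 : nu 1%g = 0%R. Proof. by []. Qed.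

Lemma fp_measure_inj i (g : Gam i) : nu (fp_inj g) = (alpha i * mu i g)%R.
Proof.
rewrite /fp_measure fp_word_inj /cons_letter; case: eqVneq => [->|//].
by rewrite factor_no_loop// mulr0.
Qed.

Lemma fp_measure_supp (x : Gamma) : nu x != 0%R ->
  exists i (g : Gam i), x = fp_inj g /\ g != 1%g.
Proof.
rewrite /fp_measure; case: x => -[|[i g] []]//= rs; rewrite ?eqxx// => _.
have gN1 : g != 1%g by move: rs; rewrite reduced_cons => /andP[].
by exists i, g; split => //; apply: val_inj; rewrite /= /cons_letter (negbTE gN1).
Qed.

Lemma fp_measure_ge0 x : (0 <= nu x)%R.
Proof. by rewrite /fp_measure; case: (fp_word x) => [|a []]//; rewrite mulr_ge0. Qed.

Lemma esum_fp_support (f : Gamma -> \bar R) : (forall x, 0 <= f x) ->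
  (forall x, nu x = 0%R -> f x = 0) ->
  \esum_(x in [set: Gamma]) f x =
  \sum_(i : I) \esum_(g in [set: Gam i]) f (fp_inj g).
Proof.
move=> f0 f_supp; pose D i : set Gamma := factor_nontriv i.
transitivity (\esum_(x in [set: Gamma]) \sum_(i : I) (if x \in D i then f x else 0)).
  apply: eq_esum => x _.
  have [/f_supp->|/fp_measure_supp[i [g [-> gN1]]]] := eqVneq (nu x) 0%R.
    by rewrite big1// => i _; rewrite if_same.
  rewrite (bigD1 i)//= ifT; last by rewrite inE; exists g => //; apply/eqP.
  rewrite big1 ?adde0// => j ji; rewrite ifF//; apply/negbTE; rewrite notin_setE.
  move=> [h /eqP hN1] /(congr1 (fp_head j)).
  rewrite fp_head_inj fp_head_inj_neq 1?eq_sym// => h1.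
  by rewrite h1 eqxx in hN1.
rewrite esum_sum; last by move=> x i _ _; case: ifP.
apply: eq_bigr => i _; rewrite -esum_mkcond esum_image; last first.
  by move=> x y _ _ /fp_inj_inj.
rewrite esum_mkcond; apply: eq_esum => g _; case: ifPn => //.
by rewrite notin_setE /= => /contrapT ->; rewrite fp_inj1 f_supp.
Qed.

Lemma esum_fp_measure (f : Gamma -> \bar R) : (forall x, 0 <= f x) ->
  \esum_(x in [set: Gamma]) ((nu x)%:E * f x) =
  \sum_(i : I) \esum_(g in [set: Gam i]) ((alpha i * mu i g)%:E * f (fp_inj g)).
Proof.
move=> f0; rewrite esum_fp_support => [||x ->]; last by rewrite mul0e.
  by apply: eq_bigr => i _; apply: eq_esum => g _; rewrite fp_measure_inj.
by move=> x; rewrite mule_ge0// lee_fin fp_measure_ge0.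
Qed.

Lemma esum_factor_steps i (c : \bar R) : 0 <= c ->
  \esum_(g in [set: Gam i]) ((alpha i * mu i g)%:E * c) = (alpha i)%:E * c.
Proof.
move=> c0; rewrite -[in RHS](esum_prob_massZr (factor_prob steps i) c0).
rewrite -esumZl ?lee_fin//.
  by apply: eq_esum => g _; rewrite EFinM muleA.
by move=> g _; rewrite mule_ge0 ?lee_fin.
Qed.

Lemma fp_measure_prob : prob_mass nu.
Proof.
split; first exact: fp_measure_ge0.
rewrite -(eq_esum (fun x _ => mule1 (nu x)%:E)) esum_fp_measure//.
by under eq_bigr do rewrite esum_factor_steps// mule1; rewrite sumEFin weight_sum.
Qed.

Lemma fp_measure_gen : (forall i, semigroup_generates [set g | mu i g != 0%R]) ->
  semigroup_generates [set x | nu x != 0%R].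
Proof.
move=> mu_gen.
pose generated (x : Gamma) := exists s : seq Gamma,
  [/\ s <> [::], {in s, forall x, nu x != 0%R} & x = (\prod_(y <- s) y)%g].
have generatedM x y : generated x -> generated y -> generated (x * y)%g.
  move=> [s [s0 sA ->]] [t [t0 tA ->]]; exists (s ++ t); split.
  - by case: s s0 {sA}.
  - by move=> u; rewrite mem_cat => /orP[]; [exact: sA|exact: tA].
  - by rewrite big_cat.
have generated_inj i (g : Gam i) : generated (fp_inj g).
  have [s [s0 sA ->]] := mu_gen i g; exists [seq fp_inj x | x <- s]; split.
  - by case: s s0 {sA}.
  - move=> _ /mapP[x /sA /= mux ->]; rewrite fp_measure_inj.
    by rewrite mulf_neq0// gt_eqF// weight_gt0.
  - rewrite big_map; elim: s {s0 sA} => [|a s IH]; first by rewrite !big_nil fp_inj1.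
    by rewrite !big_cons fp_injM IH.
move=> x; change (generated x); case: x => s; elim: s => [|[i g] s IH] rs.
  have [i _|no_index] := pickP (@predT I); last first.
    by have := weight_sum steps; rewrite big_pred0// => /esym/eqP; rewrite oner_eq0.
  by rewrite (_ : FreeProduct rs = fp_inj (1%g : Gam i))// fp_inj1; exact: val_inj.
have rs' := reduced_behead rs.
rewrite (_ : FreeProduct rs = (fp_inj g * FreeProduct rs')%g); first exact: generatedM.
apply: val_inj; rewrite [RHS]fp_word_injM /=.
move: rs; rewrite reduced_cons => /and3P[/= gN1 far _].
by rewrite lact_far// /cons_letter (negbTE gN1).
Qed.

End FactorMeasure.

Section FactorExcursions.
Local Open Scope ereal_scope.
Variables (R : realType) (I : finType) (Gam : I -> groupType).
Variables (alpha : I -> R) (mu : forall i, Gam i -> R).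
Arguments mu : clear implicits.
Hypothesis steps : fp_steps alpha mu.

Local Notation Gamma := (free_product Gam).
Local Notation nu := (fp_measure alpha mu).

Let nu_prob : prob_mass nu := fp_measure_prob steps.
Let nu0 x : 0 <= (nu x)%:E. Proof. by rewrite lee_fin fp_measure_ge0. Qed.
Let law_nonneg := law_ge0 nu_prob.
Let mu0 i g : (0 <= mu i g)%R.
Proof. exact: prob_mass_ge0 (factor_prob steps i). Qed.
Let alpha_ge0 i : (0 <= alpha i)%R. Proof. exact/ltW/(weight_gt0 steps). Qed.

Variable i : I.

Local Notation excursion := (excursion nu (in_factor i)).
Local Notation excursion_return := (excursion_return nu (in_factor i)).
Local Notation excursion_mass := (excursion_mass nu (in_factor i)).
Local Notation return_mass := (return_mass nu (in_factor i)).

Let excursion_nonneg n x : 0 <= excursion n x. Proof. exact: excursion_ge0. Qed.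

Lemma fp_head_step x y : ~~ in_factor i x -> nu (x^-1 * y)%g != 0%R ->
  fp_head i y = fp_head i x.
Proof.
move=> xN /fp_measure_supp[j [h [xyE _]]].
by rewrite -(fp_head_mul_letter h xN) -xyE mulVKg.
Qed.

Lemma fp_head_stepV x y : ~~ in_factor i y -> nu (x^-1 * y)%g != 0%R ->
  fp_head i y = fp_head i x.
Proof.
move=> yN /fp_measure_supp[j [h [xyE _]]].
by rewrite -(fp_head_mul_letter h^-1%g yN) fp_injV -xyE invgM invgK mulVKg.
Qed.

Lemma excursion_head n x : fp_head i x != 1%g -> excursion n x = 0.
Proof.
elim: n x => [|n IH] x x1.
  by rewrite excursion0 /dirac_mass; case: eqVneq => // xE; rewrite xE eqxx in x1.
rewrite excursionS; case: ifPn => // xN; apply: walk_step_eq0 => y yx.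
by rewrite IH// -(fp_head_stepV xN yx).
Qed.

Lemma walk_step_excursion_in_factor n x : in_factor i x -> x != 1%g ->
  walk_step nu (excursion n.+1) x = 0.
Proof.
move=> xi x1; apply: walk_step_eq0 => y yx.
have [yi|yN] := boolP (in_factor i y); first by rewrite excursion_in.
rewrite excursion_head// -(fp_head_step yN yx).
by apply: contra_neq x1 => x1; rewrite (eqP xi) x1 fp_inj1.
Qed.

(* Decomposition at the last visit to the factor. *)
Lemma law_excursion n x : law nu n x =
  \sum_(k < n.+1) (law nu k (fp_inj (fp_head i x)) * excursion (n - k) (fp_tail i x)).
Proof.
elim: n x => [|n IH] x.
  rewrite big_ord1 excursion0 !law0 /dirac_mass.
  have [->|x1] := eqVneq x 1%g.
    by rewrite /fp_tail fp_head1 fp_inj1 mulg1 invg1 !eqxx mule1.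
  case: eqVneq => [h1|]; last by rewrite mul0e.
  case: eqVneq => [t1|_]; last by rewrite mule0.
  by move: x1; rewrite -(fp_inj_head_tail i x) h1 t1 mulg1 eqxx.
rewrite big_ord_recr /= subnn excursion0 /dirac_mass -in_factorE.
have [xi|xN] := boolP (in_factor i x).
  rewrite big1 ?add0e ?mule1 -?(eqP xi)// => k _.
  by rewrite subSn -1?ltnS// excursion_in ?mule0// /fp_tail -fp_injV in_factor_injM.
rewrite mule0 adde0 lawS; set g := fp_head i x.
rewrite (@eq_walk_step_supp _ _ _ _ (fun y => \sum_(k < n.+1)
    (law nu k (fp_inj g) * excursion (n - k) ((fp_inj g)^-1 * y)%g))); last first.
  by move=> y yx; rewrite IH /fp_tail /g (fp_head_stepV xN yx).
rewrite walk_step_sum//; last by move=> k y; rewrite mule_ge0.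
apply: eq_bigr => k _; rewrite walk_stepZ//.
rewrite (walk_step_translate nu (fp_inj g) (excursion (n - k))) subSn -1?ltnS//.
by rewrite excursionS ifF//; apply/negbTE; rewrite /fp_tail -fp_injV in_factor_injM.
Qed.

Lemma law_excursion_injM n (g : Gam i) x : fp_head i x = 1%g ->
  law nu n (fp_inj g * x)%g =
  \sum_(k < n.+1) (law nu k (fp_inj g) * excursion (n - k) x).
Proof.
move=> hx; rewrite law_excursion fp_head_injM fp_tail_injM hx mulg1.
by rewrite /fp_tail hx fp_inj1 invg1 mul1g.
Qed.

Lemma esum_in_factor (f : Gamma -> \bar R) :
  \esum_(x in [set: Gamma]) (if in_factor i x then f x else 0) =
  \esum_(g in [set: Gam i]) f (fp_inj g).
Proof.
rewrite -(@esum_image _ _ _ setT (@fp_inj _ Gam i)); last by move=> x y _ _ /fp_inj_inj.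
rewrite [RHS]esum_mkcond; apply: eq_esum => x _; congr (if _ then _ else _).
apply/in_factorP/idP; rewrite inE; first by move=> [g ->]; exists g.
by move=> [g _ <-]; exists g.
Qed.

Lemma esum_step_within_factor (u : Gamma -> \bar R) (g : Gam i) :
  (forall x, 0 <= u x) ->
  \esum_(y in [set: Gamma])
    (if in_factor i y then u y * (nu (y^-1 * fp_inj g)%g)%:E else 0) =
  (alpha i)%:E * walk_step (mu i) (fun h => u (fp_inj h)) g.
Proof.
move=> u0; rewrite esum_in_factor -esumZl ?lee_fin//; last first.
  by move=> h _; rewrite mule_ge0 ?lee_fin.
apply: eq_esum => h _; rewrite -fp_injV -fp_injM fp_measure_inj//.
by rewrite EFinM muleCA.
Qed.

Lemma esum_step_into_factor n (g : Gam i) :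
  \esum_(y in [set: Gamma])
    (if in_factor i y then 0 else law nu n y * (nu (y^-1 * fp_inj g)%g)%:E) =
  \sum_(k < n.+1) (law nu k (fp_inj g) * excursion_return (n - k).+1).
Proof.
transitivity (\esum_(x in [set: Gamma]) \sum_(k < n.+1)
    (law nu k (fp_inj g) * (excursion (n - k) x * (nu (x^-1 * 1)%g)%:E))); last first.
  rewrite esum_sum; last by move=> x k _ _; rewrite !mule_ge0.
  by apply: eq_bigr => k _; rewrite esumZl// => x _; rewrite mule_ge0.
rewrite -[LHS](esum_mulgl (fp_inj g)); apply: eq_esum => x _.
rewrite in_factor_injM invgM mulgVK mulg1.
have [->|x0] := eqVneq (nu x^-1%g) 0%R.
  by rewrite mule0 if_same big1// => k _; rewrite !mule0.
case: ifPn => xi.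
  rewrite big1// => k _; case: (n - k)%N => [|j]; last first.
    by rewrite excursion_in// mul0e mule0.
  rewrite excursion0 /dirac_mass; case: (eqVneq x 1%g) => [x1|_].
    by rewrite x1 invg1 fp_measure1 eqxx in x0.
  by rewrite mul0e mule0.
have hx : fp_head i x = 1%g.
  by rewrite -(fp_head_step (y := 1%g) xi) ?mulg1// fp_head1.
rewrite law_excursion_injM// ge0_sume_distrl; last by move=> k _; rewrite mule_ge0.
by apply: eq_bigr => k _; rewrite muleA.
Qed.

Lemma law_factor_rec n (g : Gam i) : law nu n.+1 (fp_inj g) =
  (alpha i)%:E * walk_step (mu i) (fun h => law nu n (fp_inj h)) g +
  \sum_(k < n.+1) (law nu k (fp_inj g) * excursion_return (n - k).+1).
Proof.
rewrite -esum_step_within_factor// -esum_step_into_factor -esumD; last 2 first.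
- by move=> y _; case: ifP => // _; rewrite mule_ge0.
- by move=> y _; case: ifP => // _; rewrite mule_ge0.
by apply: eq_esum => y _; case: ifP; rewrite (adde0, add0e).
Qed.

Lemma green_factor_rec (g : Gam i) : green_fun nu 1 (fp_inj g) =
  dirac_mass R g +
  (alpha i)%:E * walk_step (mu i) (fun h => green_fun nu 1 (fp_inj h)) g +
  green_fun nu 1 (fp_inj g) * return_mass.
Proof.
have mui0 h : 0 <= (mu i h)%:E by rewrite lee_fin.
have ret0 n : 0 <= excursion_return n by exact: excursion_return_ge0.
have step0 n : 0 <= walk_step (mu i) (fun h => law nu n (fp_inj h)) g.
  exact: (walk_step_ge0 (factor_prob steps i)).
rewrite {1}green_fun1E esum_nat_recl// -addeA; congr (_ + _).
  rewrite law0 /dirac_mass; congr (if _ then _ else _).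
  by rewrite -(fp_inj1 Gam i) (inj_eq (@fp_inj_inj _ _ i)).
rewrite (eq_esum (fun n _ => law_factor_rec n g)) esumD; last 2 first.
- by move=> n _; rewrite mule_ge0 ?lee_fin.
- by move=> n _; apply: sume_ge0 => k _; rewrite mule_ge0.
congr (_ + _); last first.
  rewrite (esum_cauchy_product (a := fun k => law nu k (fp_inj g))
    (b := fun k => excursion_return k.+1))// green_fun1E; congr (_ * _).
  by rewrite /return_mass [RHS]esum_nat_recl// add0e.
rewrite esumZl ?lee_fin// -(walk_step_esum (factor_prob steps i))//.
by congr (_ * _); apply: eq_walk_step => h; rewrite green_fun1E.
Qed.

Definition head_law (n : nat) (g : Gam i) : \bar R :=
  \esum_(x in [set: Gamma]) (if fp_head i x == g then law nu n x else 0).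

Lemma head_law_ge0 n g : 0 <= head_law n g.
Proof. by apply: esum_ge0 => x _; case: ifP. Qed.

Lemma head_lawE n g : head_law n g =
  \sum_(k < n.+1) (law nu k (fp_inj g) * excursion_mass (n - k)).
Proof.
rewrite /head_law -[LHS](esum_mulgl (fp_inj g)).
transitivity (\esum_(x in [set: Gamma]) \sum_(k < n.+1)
    (law nu k (fp_inj g) * excursion (n - k) x)); last first.
  rewrite esum_sum; last by move=> x k _ _; rewrite mule_ge0.
  by apply: eq_bigr => k _; rewrite esumZl.
apply: eq_esum => x _; rewrite fp_head_injM -[X in _ == X]mulg1 (inj_eq (mulgI g)).
have [hx|hx] := eqVneq (fp_head i x) 1%g; first by rewrite law_excursion_injM.
by rewrite big1// => k _; rewrite excursion_head ?mule0.
Qed.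

Lemma esum_head_law_mul n (F : Gam i -> \bar R) : (forall g, 0 <= F g) ->
  \esum_(g in [set: Gam i]) (head_law n g * F g) =
  \esum_(x in [set: Gamma]) (law nu n x * F (fp_head i x)).
Proof.
move=> F0; rewrite /head_law.
transitivity (\esum_(g in [set: Gam i]) \esum_(x in [set: Gamma])
    (if g == fp_head i x then law nu n x * F g else 0)).
  apply: eq_esum => g _; rewrite -esumZr//; last by move=> x _; case: ifP.
  by apply: eq_esum => x _; rewrite eq_sym; case: ifP; rewrite ?mul0e.
rewrite exchange_esum; last by move=> g x; case: ifP => // _; rewrite mule_ge0.
apply: eq_esum => x _.
by rewrite (esum_pred1 (f := fun g => law nu n x * F g))// mule_ge0.
Qed.

Lemma esum_head_law n : \esum_(g in [set: Gam i]) head_law n g = 1.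
Proof.
have := @esum_head_law_mul n (fun=> 1) (fun=> lee01).
under eq_esum do rewrite mule1.
by under [X in _ = X]eq_esum do rewrite mule1; rewrite esum_law.
Qed.

Lemma head_law_fin n g : head_law n g \is a fin_num.
Proof.
apply: ge0_fin_num_le (head_law_ge0 n g) _ (ltry 1).
by rewrite -(esum_head_law n); exact: le_esum_term.
Qed.

Lemma excursion_mass_sum n :
  excursion_mass n.+1 + (alpha i)%:E + \sum_(k < n.+2) excursion_return k = 1.
Proof.
have step0 k := walk_step_ge0 nu_prob (excursion_ge0 nu_prob (in_factor i) k).
elim: n => [|n IH].
  rewrite !big_ord_recr big_ord0 /= add0e walk_step_dirac// fp_measure1 !adde0.
  rewrite -[RHS](excursion_mass0 nu (in_factor i)).
  rewrite -[RHS](excursion_massS nu_prob (in_factor i) 0); congr (_ + _).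
  under eq_esum do rewrite walk_step_dirac//.
  rewrite esum_in_factor -[LHS]mule1 -(esum_factor_steps steps i lee01).
  by apply: eq_esum => g _; rewrite mule1 fp_measure_inj.
rewrite big_ord_recr /= addeA [LHS]addeAC -IH; congr (_ + _).
rewrite addeAC -[in RHS](excursion_massS nu_prob (in_factor i) n.+1); congr (_ + _ + _).
rewrite -[LHS](esum_pred1 (f := walk_step nu (excursion n.+1)))//.
apply: eq_esum => x _; case: eqVneq => [->|x1]; first by rewrite in_factor1.
by case: ifP => // xi; rewrite walk_step_excursion_in_factor.
Qed.

Lemma excursion_mass_le1 n : excursion_mass n <= 1.
Proof.
case: n => [|n]; first by rewrite excursion_mass0.
rewrite -(excursion_mass_sum n) -addeA leeDl// adde_ge0 ?lee_fin//.
by apply: sume_ge0 => k _; exact: excursion_return_ge0.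
Qed.

Lemma excursion_mass_fin n : excursion_mass n \is a fin_num.
Proof.
exact: ge0_fin_num_le (excursion_mass_ge0 nu_prob _ n) (excursion_mass_le1 n) (ltry _).
Qed.

Lemma avoiding_cone (g : Gam i) n x : fp_head i x = g ->
  avoiding nu (fp_inj g) n x = 0.
Proof.
rewrite /avoiding; elim: n x => [|n IH] x hx /=.
  case: ifPn => // xg; rewrite /dirac_mass; case: eqVneq => // x1.
  by move: xg; rewrite -hx x1 fp_head1 fp_inj1 eqxx.
case: ifPn => // xg; have xN : ~~ in_factor i x by rewrite /in_factor hx.
apply: walk_step_eq0 => y yx.
by rewrite IH// -(fp_head_stepV xN yx).
Qed.

End FactorExcursions.

(** * Transience *)

Lemma exists_neq (I : finType) (i : I) : (1 < #|I|)%N -> exists j, j != i.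
Proof.
move=> I_gt1; suff /card_gt0P[j] : (0 < #|predC1 i|)%N by exists j.
by rewrite cardC1 -subn1 subn_gt0.
Qed.

Lemma card_set2T (T : choiceType) (a b : T) : a != b ->
  (forall x, x = a \/ x = b) -> ([set: T] #= `I_2)%card.
Proof.
move=> ab only; apply/card_set_bijP; exists (fun x => (x == b) : nat); split.
- by move=> x _ /=; rewrite ltnS leq_b1.
- move=> x y _ _ /=; have [->|->] := only x; have [->|->] := only y => //=;
    by rewrite eqxx (negbTE ab).
- move=> [|[|//]] _ /=; first by exists a => //; rewrite (negbTE ab).
  by exists b => //; rewrite eqxx.
Qed.

Section LeftMean.
Variables (R : realType) (G : groupType) (m : G -> R).
Hypothesis m_prob : prob_mass m.
Implicit Types (f : G -> R) (g s : G) (C : R).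

Definition left_mean f g : R :=
  fine (\esum_(h in [set: G]) (m h * f (h^-1 * g)%g)%:E)%E.

Let m_ge0 h : 0 <= m h. Proof. exact: prob_mass_ge0. Qed.

Lemma esum_left_mean f C g : (forall h, 0 <= f h <= C) ->
  (\esum_(h in [set: G]) (m h * f (h^-1 * g)%g)%:E = (left_mean f g)%:E)%E.
Proof.
move=> f_bounded; have C0 : 0 <= C by case/andP: (f_bounded g) => /le_trans; apply.
have f_ge0 h : 0 <= f h by case/andP: (f_bounded h).
rewrite /left_mean fineK//; apply: ge0_fin_num_le _ _ (ltry C).
  by apply: esum_ge0 => h _; rewrite lee_fin mulr_ge0.
rewrite -(esum_prob_massZr (c := C%:E) m_prob)//; apply: le_esum => h _.
by rewrite lee_fin ler_wpM2l//; case/andP: (f_bounded (h^-1 * g)%g).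
Qed.

Lemma left_meanD f1 f2 C1 C2 g :
  (forall h, 0 <= f1 h <= C1) -> (forall h, 0 <= f2 h <= C2) ->
  left_mean (fun h => f1 h + f2 h) g = left_mean f1 g + left_mean f2 g.
Proof.
move=> f1_bounded f2_bounded; apply: EFin_inj; rewrite EFinD.
have f1_ge0 h : 0 <= f1 h by case/andP: (f1_bounded h).
have f2_ge0 h : 0 <= f2 h by case/andP: (f2_bounded h).
rewrite -(esum_left_mean g f1_bounded) -(esum_left_mean g f2_bounded) -esumD.
- rewrite -(@esum_left_mean _ (C1 + C2)) => [|h].
    by apply: eq_esum => h _; rewrite mulrDr EFinD.
  have /andP[_ ?] := f1_bounded h; have /andP[_ ?] := f2_bounded h.
  by rewrite addr_ge0//= lerD.
- by move=> h _; rewrite lee_fin mulr_ge0.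
- by move=> h _; rewrite lee_fin mulr_ge0.
Qed.

Lemma left_meanZ (c : R) f C g : 0 <= c -> (forall h, 0 <= f h <= C) ->
  left_mean (fun h => c * f h) g = c * left_mean f g.
Proof.
move=> c0 f_bounded; apply: EFin_inj; rewrite EFinM -(esum_left_mean g f_bounded).
have f_ge0 h : 0 <= f h by case/andP: (f_bounded h).
rewrite -(@esum_left_mean _ (c * C)) => [|h].
  rewrite -esumZl ?lee_fin//; first by apply: eq_esum => h _; rewrite mulrCA EFinM.
  by move=> h _; rewrite lee_fin mulr_ge0.
by have /andP[_ ?] := f_bounded h; rewrite mulr_ge0//= ler_wpM2l.
Qed.

Lemma left_mean_cst C g : 0 <= C -> left_mean (fun=> C) g = C.
Proof.
move=> C0; apply: EFin_inj; rewrite -(@esum_left_mean _ C) ?lexx ?C0//.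
by under eq_esum do rewrite EFinM; rewrite esum_prob_massZr.
Qed.

Lemma left_mean_1B f g : (forall h, 0 <= f h <= 1) ->
  left_mean (fun h => 1 - f h) g = 1 - left_mean f g.
Proof.
move=> f_bounded; apply: (addIr (left_mean f g)).
rewrite -(@left_meanD _ _ 1 1)//; last first.
  by move=> h; have /andP[? ?] := f_bounded h; rewrite subr_ge0 gerBl; apply/andP.
by rewrite (_ : (fun h => _) = fun=> 1) ?left_mean_cst ?subrK//;
  apply/funext => h; rewrite subrK.
Qed.

Lemma left_mean_pred1 s g :
  left_mean (fun h => (h == s)%:R) g = m (g * s^-1)%g.
Proof.
apply: EFin_inj; rewrite -(@esum_left_mean _ 1); last first.
  by move=> h; rewrite ler0n lern1 leq_b1.
rewrite -[RHS](esum_pred1 (f := fun h => (m h)%:E)) ?lee_fin//.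
apply: eq_esum => h _.
have -> : (h == g * s^-1)%g = (h^-1 * g == s)%g.
  by rewrite -(inj_eq (mulIg s)) mulgVK -[RHS](inj_eq (mulgI h)) mulVKg eq_sym.
by case: eqP => _; rewrite ?mulr1 ?mulr0.
Qed.

Lemma left_mean_neq1 g : left_mean (fun h => (h != 1%g)%:R) g = 1 - m g.
Proof.
rewrite (_ : (fun h => _) = fun h => 1 - (h == 1%g)%:R); last first.
  by apply/funext => h; case: (h == 1%g); rewrite ?subrr ?subr0.
rewrite left_mean_1B => [|h]; last by rewrite ler0n lern1 leq_b1.
by rewrite left_mean_pred1 invg1 mulg1.
Qed.

End LeftMean.

Section WordWeight.
Local Open Scope ereal_scope.
Variables (R : realType) (I : finType) (Gam : I -> groupType).
Variables (alpha : I -> R) (mu : forall i, Gam i -> R).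
Arguments mu : clear implicits.
Hypothesis steps : fp_steps alpha mu.

Local Notation Gamma := (free_product Gam).
Local Notation nu := (fp_measure alpha mu).

Let nu_prob : prob_mass nu := fp_measure_prob steps.

(* The bound on the return masses amounts to the paper's [xi_i < 1]. *)
Definition transient_walk : Prop :=
  green_fun nu 1 1%g < +oo /\
  forall i, return_mass nu (in_factor i) < (1 - alpha i)%:E.

Variable weight : forall i, Gam i -> R.
Arguments weight : clear implicits.
Hypothesis weight1 : forall i, weight i 1%g = 1%R.
Hypothesis weight_bounded : forall i g, (0 < weight i g <= 1)%R.

Definition word_weight (y : Gamma) : R :=
  (\prod_(a <- fp_word y) weight (tag a) (tagged a))%R.

Local Notation mean_weight i := (left_mean (mu i) (weight i)).

Let weight_ge0 i g : (0 <= weight i g <= 1)%R.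
Proof. by case/andP: (weight_bounded g) => /ltW -> ->. Qed.

Lemma word_weight_gt0 y : (0 < word_weight y)%R.
Proof. by apply: prodr_gt0 => a _; case/andP: (weight_bounded (tagged a)). Qed.

Lemma word_weight1 : word_weight 1%g = 1%R.
Proof. by rewrite /word_weight big_nil. Qed.

Lemma word_weight_injM i (g : Gam i) y : word_weight (fp_inj g * y)%g =
  (weight i (g * fp_head i y)%g * word_weight (fp_tail i y))%R.
Proof.
rewrite -{1}(fp_inj_head_tail i y) mulgA -fp_injM.
move: (g * _)%g (fp_tail i y) (fp_head_tail i y) => {}g {}y hy.
rewrite /word_weight fp_word_injM lact_far; last first.
  move: hy; rewrite /fp_head; case: y => -[|[j h] w] //= rs.
  apply: contra_eq_neq => ij; move: h rs; rewrite -ij => h rs.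
  by rewrite tagged_as_self; move: rs; rewrite reduced_cons => /andP[].
rewrite /cons_letter; case: eqVneq => [->|_]; last by rewrite big_cons.
by rewrite weight1 mul1r.
Qed.

Lemma esum_word_weight i y : \esum_(g in [set: Gam i])
    ((alpha i * mu i g)%:E * (word_weight ((fp_inj g)^-1 * y)%g)%:E) =
  (alpha i * mean_weight i (fp_head i y) * word_weight (fp_tail i y))%:E.
Proof.
have alpha_ge0 : (0 <= alpha i)%R by rewrite ltW// (weight_gt0 steps).
have mu_ge0 g : (0 <= mu i g)%R by exact: prob_mass_ge0 (factor_prob steps i).
have weight0 g : (0 <= weight i g)%R by case/andP: (weight_ge0 g).
have mw0 g : 0 <= (mu i g * weight i (g^-1 * fp_head i y)%g)%:E.
  by rewrite lee_fin mulr_ge0.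
rewrite EFinM [in RHS]EFinM -(esum_left_mean (factor_prob steps i) _ (@weight_ge0 i)).
rewrite -esumZl ?lee_fin// -esumZr ?lee_fin ?ltW ?word_weight_gt0//; last first.
  by move=> g _; rewrite mule_ge0// lee_fin.
by apply: eq_esum => g _; rewrite -fp_injV word_weight_injM -!EFinM !mulrA.
Qed.

Hypothesis mean_weight1 : forall i, (mean_weight i 1%g < 1)%R.

Let defect i : R := (alpha i * (1 - mean_weight i 1%g))%R.

Hypothesis weight_super : forall i (g : Gam i), g != 1%g ->
  (alpha i * mean_weight i g <=
   weight i g * (alpha i + \sum_(j | j != i) defect j))%R.

Let defect_gt0 i : (0 < defect i)%R.
Proof. by rewrite mulr_gt0 ?(weight_gt0 steps)// subr_gt0. Qed.

Let inverse_weight (x : Gamma) : R := word_weight x^-1%g.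

Let inverse_weight_ge0 x : (0 <= inverse_weight x)%R.
Proof. exact/ltW/word_weight_gt0. Qed.

Let inverse_weight1 : inverse_weight 1%g = 1%R.
Proof. by rewrite /inverse_weight invg1 word_weight1. Qed.

Let esum_inverse_weight i : \esum_(g in [set: Gam i])
    ((alpha i * mu i g)%:E * (inverse_weight (fp_inj g))%:E) =
  (alpha i - defect i)%:E.
Proof.
rewrite (eq_esum (b := fun g => (alpha i * mu i g)%:E *
  (word_weight ((fp_inj g)^-1 * 1)%g)%:E)); last by move=> g _; rewrite mulg1.
rewrite esum_word_weight fp_head1 /fp_tail fp_head1 fp_inj1 invg1 mulg1 word_weight1.
by congr (_%:E); rewrite /defect; ring.
Qed.

Let inverse_weight_superharmonic : superharmonic nu inverse_weight.
Proof.
move=> x; rewrite /inverse_weight; under eq_esum do rewrite invgM.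
move: x^-1%g => {x} y.
rewrite (esum_fp_measure steps (f := fun s => (word_weight (s^-1 * y)%g)%:E)); last first.
  by move=> s; rewrite lee_fin ltW ?word_weight_gt0.
under eq_bigr do rewrite esum_word_weight.
rewrite sumEFin lee_fin; case: y => -[|[i g] w] rs.
  have -> : FreeProduct rs = 1%g by exact: val_inj.
  rewrite word_weight1 -(weight_sum steps); apply: ler_sum => i _.
  rewrite /fp_tail fp_head1 fp_inj1 invg1 mulg1 word_weight1 mulr1.
  by rewrite ler_piMr// ltW// (weight_gt0 steps).
have gN1 : g != 1%g by move: rs; rewrite reduced_cons => /andP[].
set y := FreeProduct rs.
have hi : fp_head i y = g by rewrite /fp_head /= tagged_as_self.
have hj j : j != i -> fp_head j y = 1%g.
  by move=> ji; rewrite /fp_head /= tagged_as1_neq// eq_sym.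
have yE : word_weight y = (weight i g * word_weight (fp_tail i y))%R.
  by rewrite -{1}[y]mul1g -(fp_inj1 _ i) word_weight_injM mul1g hi.
rewrite (bigD1 i)//= hi (eq_bigr (fun j => (alpha j - defect j) * word_weight y)%R).
  rewrite -mulr_suml sumrB yE mulrA -mulrDl ler_wpM2r ?(ltW (word_weight_gt0 _))//.
  have := weight_sum steps; rewrite (bigD1 i)//= => /(canRL (addKr _)) ->.
  by have := weight_super gN1; lra.
move=> j ji; rewrite hj// /fp_tail hj// fp_inj1 invg1 mul1g.
by rewrite /defect; ring.
Qed.

Let return_mass_off_factor i :
  return_mass nu (in_factor i) <= (1 - alpha i - \sum_(j | j != i) defect j)%:E.
Proof.
apply: (le_trans (return_mass_le nu_prob inverse_weight_ge0 inverse_weight1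
  inverse_weight_superharmonic (in_factor1 Gam i) (fp_measure1 alpha mu))).
rewrite (eq_esum (b := fun x => (nu x)%:E *
    (if in_factor i x then 0 else (inverse_weight x)%:E))); last first.
  by move=> x _; case: ifP; rewrite ?mule0.
rewrite esum_fp_measure//; last by move=> x; case: ifP; rewrite ?lee_fin.
have -> : (1 - alpha i - \sum_(j | j != i) defect j =
    \sum_(j | j != i) (alpha j - defect j))%R.
  by rewrite sumrB -(weight_sum steps) (bigD1 i)//= [(alpha i + _)%R]addrC addrK.
rewrite (bigD1 i)//= esum1 ?add0e => [|g _]; last by rewrite in_factor_inj mule0.
rewrite -sumEFin; apply: lee_sum => j ji; rewrite -esum_inverse_weight.
apply: le_esum => g _; rewrite lee_wpmul2l//; last by case: ifP; rewrite ?lee_fin.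
rewrite lee_fin mulr_ge0 ?(prob_mass_ge0 _ (factor_prob steps j))//.
exact/ltW/(weight_gt0 steps).
Qed.

Lemma transient_of_weight : (1 < #|I|)%N -> transient_walk.
Proof.
move=> I_gt1; have sum_defect_gt0 i : (0 < \sum_(j | j != i) defect j)%R.
  have [j ji] := exists_neq i I_gt1; rewrite (bigD1 j)//= ltr_pwDl// sumr_ge0// => k _.
  exact: ltW.
have [i0 _] : exists i : I, true by case/card_gt0P: (ltnW I_gt1) => i _; exists i.
split; last first.
  move=> i; apply: le_lt_trans (return_mass_off_factor i) _.
  by rewrite lte_fin gtrBl.
apply: le_lt_trans (ltry _).
have defect_sum : (0 < \sum_j defect j)%R.
  by rewrite (bigD1 i0)//= ltr_pwDl// sumr_ge0// => k _; exact: ltW.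
apply: (green_fun_superharmonic nu_prob inverse_weight_ge0 inverse_weight1
  inverse_weight_superharmonic defect_sum).
rewrite esum_fp_measure//; under eq_bigr do rewrite esum_inverse_weight.
by rewrite sumEFin -EFinD sumrB subrK (weight_sum steps).
Qed.

End WordWeight.

Section Penalty.
Variables (R : realType) (I : finType) (Gam : I -> groupType).
Variables (alpha : I -> R) (mu : forall i, Gam i -> R).
Arguments mu : clear implicits.
Hypothesis steps : fp_steps alpha mu.
Hypothesis I_gt1 : (1 < #|I|)%N.

Variables (penalty : forall i, Gam i -> R) (bound : I -> R) (margin : R).
Arguments penalty : clear implicits.
Hypothesis penalty1 : forall i, penalty i 1%g = 0.
Hypothesis penalty_bounded : forall i g, 0 <= penalty i g <= bound i.

Local Notation mean_penalty i := (left_mean (mu i) (penalty i)).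

Hypothesis margin_gt0 : 0 < margin.
Hypothesis mean_penalty1_gt0 : forall i, 0 < mean_penalty i 1%g.
Hypothesis penalty_margin : forall i (g : Gam i), g != 1%g ->
  penalty i g - mean_penalty i g + margin <= \sum_(j | j != i) mean_penalty j 1%g.

Let total i : R := \sum_(j | j != i) mean_penalty j 1%g.

Let exists_small : exists e, [/\ 0 < e, forall i, e * (bound i / alpha i) < 1 &
  forall i, e * (total i * (bound i / alpha i)) < margin].
Proof.
have near_bound : \forall e \near 0^'+, forall i, e * (bound i / alpha i) < 1.
  by apply: filter_forall => i; exact: near0_mulr_lt.
have near_margin : \forall e \near 0^'+, forall i,
    e * (total i * (bound i / alpha i)) < margin.
  by apply: filter_forall => i; exact: near0_mulr_lt.
have [e [[? ?] ?]] :=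
  filter_ex (filterI (filterI (nbhs_right_gt (0 : R)) near_bound) near_margin).
by exists e.
Qed.

(* To first order in [e], the weights [1 - e * penalty / alpha] satisfy
   [transient_of_weight] as soon as [penalty_margin] holds. *)
Lemma transient_of_penalty : transient_walk alpha mu.
Proof.
have [e [e0 e_bound e_margin]] := exists_small.
have alpha_gt0 i : 0 < alpha i := weight_gt0 steps i.
pose scale i := e / alpha i; have scale_gt0 i : 0 < scale i by rewrite divr_gt0.
have alpha_scale i : alpha i * scale i = e by rewrite mulrC divfK ?gt_eqF.
have scaled i g : 0 <= scale i * penalty i g <= scale i * bound i.
  have /andP[p0 pb] := penalty_bounded g.
  by rewrite mulr_ge0 ?(ltW (scale_gt0 i))//= ler_wpM2l// ltW.
have scaled_lt1 i : scale i * bound i < 1 by rewrite mulrAC -mulrA.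
have scaled1 i g : 0 <= scale i * penalty i g <= 1.
  have /andP[-> /le_trans] := scaled i g; apply.
  exact: ltW.
have mean_weightE i g :
    left_mean (mu i) (fun h => 1 - scale i * penalty i h) g =
    1 - scale i * mean_penalty i g.
  rewrite (left_mean_1B (factor_prob steps i))//.
  have scale_ge0 := ltW (scale_gt0 i).
  by rewrite (left_meanZ (factor_prob steps i) _ scale_ge0 (@penalty_bounded i)).
apply: (transient_of_weight steps
  (weight := fun i h => 1 - scale i * penalty i h)) => //.
- by move=> i; rewrite penalty1 mulr0 subr0.
- move=> i g; have /andP[p0 pb] := scaled i g.
  by rewrite gerBl p0 subr_gt0 (le_lt_trans pb) ?scaled_lt1.
- by move=> i; rewrite mean_weightE gtrBl mulr_gt0.
move=> i g gN1; rewrite mean_weightE.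
rewrite (eq_bigr (fun j => e * mean_penalty j 1%g)); last first.
  by move=> j _; rewrite mean_weightE opprB addrC subrK mulrA alpha_scale.
rewrite -mulr_sumr -/(total i) mulrBr mulr1 mulrA alpha_scale.
have -> : (1 - scale i * penalty i g) * (alpha i + e * total i) =
    alpha i + e * (total i - penalty i g - total i * (scale i * penalty i g)).
  by rewrite -(alpha_scale i); ring.
rewrite lerD2l -mulrN ler_pM2l//.
have total_ge0 : 0 <= total i by apply: sumr_ge0 => j _; exact: ltW.
have := penalty_margin gN1; rewrite -/(total i).
have : total i * (scale i * penalty i g) <= margin.
  rewrite (le_trans _ (ltW (e_margin i)))// [leRHS]mulrCA ler_wpM2l//.
  have /andP[_ /le_trans] := scaled i g; apply.
  by rewrite /scale mulrAC mulrA.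
lra.
Qed.

End Penalty.

Section SmallGroups.
Variables (R : realType) (G : groupType) (m : G -> R).
Hypotheses (m_prob : prob_mass m) (m1 : m 1%g = 0).
Hypothesis m_gen : semigroup_generates [set g | m g != 0].

Lemma support_neq1 : exists g, g != 1%g /\ 0 < m g.
Proof.
have [l [l0 lA _]] := m_gen 1%g; case: l l0 lA => // g l _ lA.
have /= mg := lA g (mem_head _ _); exists g; split; last by rewrite prob_mass_gt0.
by apply: contra_neq mg => ->.
Qed.

Lemma card2_of_unit_mass g : g != 1%g -> g^-1%g = g -> m g = 1 ->
  ([set: G] #= `I_2)%card.
Proof.
move=> gN1 gV mg; apply: (@card_set2T _ 1%g g); first by rewrite eq_sym.
move=> x; have [l [_ lA ->]] := m_gen x.
have {}lA : {in l, forall y, y = g}.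
  by move=> y /lA /=; apply: contra_neq_eq; exact: prob_mass_eq0.
elim: l lA => [|y l IH] lA; first by left; rewrite big_nil.
rewrite big_cons (lA y (mem_head _ _)).
have [z zl|->|->] := IH; first by apply: lA; rewrite inE zl orbT.
  by right; rewrite mulg1.
by left; rewrite -{1}gV mulVg.
Qed.

(* Otherwise [m g >= 1] follows by applying the negation to [g] and [g^-1]. *)
Lemma exists_asymmetric_step : ~ ([set: G] #= `I_2)%card ->
  exists g, [/\ g != 1%g, 0 < m g & m g^-1%g < (1 + m g) / 2].
Proof.
apply: contra_notP => none.
have sym g : g != 1%g -> 0 < m g -> (1 + m g) / 2 <= m g^-1%g.
  by move=> gN1 mg; rewrite leNgt; apply/negP => gV; apply: none; exists g.
have [g [gN1 mg]] := support_neq1.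
have gV := sym g gN1 mg; have gVN1 : g^-1%g != 1%g by rewrite invg_eq1.
have /(sym _ gVN1) : 0 < m g^-1%g by lra.
have := prob_mass_le1 g m_prob; have := prob_mass_le1 g^-1%g m_prob.
rewrite invgK => mgV_le1 mg_le1 gVV; have mg1 : m g = 1 by lra.
apply: (card2_of_unit_mass gN1 _ mg1); apply/eqP; apply: contraTT mg.
by move=> /(prob_mass_eq0 m_prob mg1) mgV; move: gV; rewrite mgV; lra.
Qed.

End SmallGroups.

Section Transience.
Variables (R : realType) (I : finType) (Gam : I -> groupType).
Variables (alpha : I -> R) (mu : forall i, Gam i -> R).
Arguments mu : clear implicits.
Hypothesis steps : fp_steps alpha mu.
Hypothesis mu_gen : forall i, semigroup_generates [set g | mu i g != 0].

Let mu_prob i : prob_mass (mu i) := factor_prob steps i.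
Let mu1 i : mu i 1%g = 0 := factor_no_loop steps i.
Let mu_ge0 i g : 0 <= mu i g. Proof. exact: prob_mass_ge0. Qed.
Let mu_le1 i g : mu i g <= 1. Proof. exact: prob_mass_le1. Qed.

Let indicator_bounded (b : bool) : 0 <= (b%:R : R) <= 1.
Proof. by rewrite ler0n lern1 leq_b1. Qed.

Let neq1_penalty i (c : R) (g : Gam i) : R := c * (g != 1%g)%:R.

Let neq1_penalty_bounded i (c : R) (g : Gam i) : 0 <= c -> 0 <= neq1_penalty c g <= c.
Proof.
move=> c0; have /andP[? ?] := indicator_bounded (g != 1%g).
by rewrite mulr_ge0//= ler_piMr.
Qed.

Let left_mean_neq1_penalty i (c : R) (g : Gam i) : 0 <= c ->
  left_mean (mu i) (neq1_penalty c) g = c * (1 - mu i g).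
Proof.
by move=> c0; rewrite (left_meanZ (mu_prob i) _ c0 (C := 1)) ?left_mean_neq1.
Qed.

Lemma transient_of_card_gt2 : (2 < #|I|)%N -> transient_walk alpha mu.
Proof.
move=> I_gt2; have mean1 i : left_mean (mu i) (neq1_penalty 1) 1%g = 1.
  by rewrite left_mean_neq1_penalty// mu1 subr0 mulr1.
apply: (transient_of_penalty steps _ (penalty := fun i => @neq1_penalty i 1)
  (bound := fun=> 1) (margin := 1)) => //.
- exact: ltnW.
- by move=> i; rewrite /neq1_penalty eqxx mulr0.
- by move=> i g; exact: neq1_penalty_bounded.
- by move=> i; rewrite mean1.
move=> i g gN1; rewrite left_mean_neq1_penalty// /neq1_penalty gN1 !mul1r.
rewrite (eq_bigr (fun=> 1)) => [|j _]; last by rewrite mean1.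
rewrite sumr_const cardC1; apply: (@le_trans _ _ 2%:R); last first.
  by rewrite ler_nat -ltnS prednK// ltnW// ltnW.
by have := mu_le1 g; rewrite /=; lra.
Qed.

Section LargeFactor.
Variables (k : I) (s : Gam k).
Hypotheses (sN1 : s != 1%g) (mus : 0 < mu k s).
Hypothesis mu_asym : mu k s^-1%g < (1 + mu k s) / 2.
Hypothesis I_gt1 : (1 < #|I|)%N.

Let large_penalty (g : Gam k) : R := neq1_penalty 1 g + 2^-1 * (g == s^-1%g)%:R.

Let large_penalty_bounded g : 0 <= large_penalty g <= 1 + 2^-1.
Proof.
have /andP[? ?] := neq1_penalty_bounded g (@ler01 R).
have /andP[? ?] := indicator_bounded (g == s^-1%g).
by apply/andP; split; rewrite /large_penalty; lra.
Qed.

Let left_mean_large_penalty g :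
  left_mean (mu k) large_penalty g = 1 - mu k g + 2^-1 * mu k (g * s)%g.
Proof.
have half_bounded (h : Gam k) : 0 <= (2^-1 * (h == s^-1%g)%:R : R) <= 2^-1.
  by have /andP[? ?] := indicator_bounded (h == s^-1%g); apply/andP; split; lra.
rewrite (left_meanD (mu_prob k) _ (fun h => neq1_penalty_bounded h ler01) half_bounded).
rewrite left_mean_neq1_penalty// mul1r.
have half_ge0 : 0 <= 2^-1 :> R by lra.
by rewrite (left_meanZ (mu_prob k) _ half_ge0 (C := 1)) ?left_mean_pred1 ?invgK.
Qed.

Let small_mean : R := (Num.max 1 (2^-1 + mu k s^-1%g) + (1 + mu k s / 2)) / 2.

Let small_mean_bounds :
  [/\ 1 < small_mean, 2^-1 + mu k s^-1%g < small_mean & small_mean < 1 + mu k s / 2].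
Proof.
have max1 : 1 <= Num.max 1 (2^-1 + mu k s^-1%g) by rewrite le_max lexx.
have maxV : 2^-1 + mu k s^-1%g <= Num.max 1 (2^-1 + mu k s^-1%g).
  by rewrite le_max lexx orbT.
have max_lt : Num.max 1 (2^-1 + mu k s^-1%g) < 1 + mu k s / 2.
  by rewrite gt_max; have := mus; have := mu_asym; move=> *; apply/andP; split; lra.
by rewrite /small_mean; split; lra.
Qed.

Let penalty : forall i, Gam i -> R :=
  @dfwith I (fun i => Gam i -> R) (fun i => @neq1_penalty i small_mean) k large_penalty.

Let mean_penalty1 i : left_mean (mu i) (@penalty i) 1%g =
  if i == k then 1 + mu k s / 2 else small_mean.
Proof.
have [? ? ?] := small_mean_bounds; rewrite /penalty.
case: dfwithP => [|j kj]; rewrite ?eqxx.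
  by rewrite left_mean_large_penalty mu1 mul1g; lra.
rewrite eq_sym (negbTE kj) left_mean_neq1_penalty ?mu1 ?subr0 ?mulr1//; lra.
Qed.

Let mean_penalty1_gt0 i : 0 < left_mean (mu i) (@penalty i) 1%g.
Proof.
have [? ? ?] := small_mean_bounds; rewrite mean_penalty1; have := mus.
by case: eqP => _; lra.
Qed.

Let mean_penalty1_le i j : j != i ->
  left_mean (mu j) (@penalty j) 1%g <=
  \sum_(l | l != i) left_mean (mu l) (@penalty l) 1%g.
Proof. by move=> ji; rewrite (bigD1 j)//= lerDl sumr_ge0// => l _; exact: ltW. Qed.

Lemma transient_of_asymmetric_step : transient_walk alpha mu.
Proof.
have [c_gt1 c_gtV c_lt] := small_mean_bounds.
have c0 : 0 <= small_mean by lra.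
pose margin := Num.min (1 + mu k s / 2 - small_mean)
  (small_mean - Num.max 1 (2^-1 + mu k s^-1%g)).
apply: (transient_of_penalty steps I_gt1 (penalty := penalty) (margin := margin)
  (bound := fun i => if i == k then 1 + 2^-1 else small_mean)) => //.
- move=> i; rewrite /penalty; case: dfwithP => [|j _]; last first.
    by rewrite /neq1_penalty eqxx mulr0.
  rewrite /large_penalty /neq1_penalty eqxx eq_sym invg_eq1 (negbTE sN1) !mulr0.
  by rewrite addr0.
- move=> i; rewrite /penalty; case: dfwithP => [g|j kj g]; rewrite ?eqxx//.
  by rewrite eq_sym (negbTE kj); exact: neq1_penalty_bounded.
- rewrite lt_min subr_gt0 c_lt subr_gt0 gt_max.
  have := mus; have := mu_asym; move=> *; apply/andP; split; lra.
move=> i; rewrite {1 2}/penalty; case: dfwithP => [g gN1|j kj g gN1].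
  have [j jk] := exists_neq k I_gt1.
  apply: le_trans (mean_penalty1_le jk); rewrite mean_penalty1 (negbTE jk).
  rewrite left_mean_large_penalty /large_penalty /neq1_penalty gN1.
  have : margin <= small_mean - Num.max 1 (2^-1 + mu k s^-1%g).
    by rewrite ge_min lexx orbT.
  have : 1 <= Num.max 1 (2^-1 + mu k s^-1%g) by rewrite le_max lexx.
  have : 2^-1 + mu k s^-1%g <= Num.max 1 (2^-1 + mu k s^-1%g).
    by rewrite le_max lexx orbT.
  have := mu_ge0 (g * s)%g; have := mu_le1 g.
  by case: eqVneq => [->|_] /=; lra.
apply: le_trans (mean_penalty1_le kj); rewrite mean_penalty1 eqxx.
rewrite left_mean_neq1_penalty// /neq1_penalty gN1.
have : margin <= 1 + mu k s / 2 - small_mean by rewrite ge_min lexx.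
by have := ler_wpM2l c0 (mu_le1 g); rewrite /=; lra.
Qed.

End LargeFactor.

Lemma free_product_transient : (2 <= #|I|)%N ->
  ~ (#|I| = 2%N /\ forall i, ([set: Gam i] #= `I_2)%card) ->
  transient_walk alpha mu.
Proof.
move=> I_gt1 not_dihedral.
have [all2|/existsNP[k card_k]] := pselect (forall i, ([set: Gam i] #= `I_2)%card).
  apply: transient_of_card_gt2; rewrite ltn_neqAle I_gt1 andbT; apply/eqP => I2.
  exact: not_dihedral.
have [s [sN1 mus mu_asym]] :=
  exists_asymmetric_step (mu_prob k) (mu1 k) (@mu_gen k) card_k.
exact: transient_of_asymmetric_step sN1 mus mu_asym I_gt1.
Qed.

End Transience.

(** * Entropy of the walk on the free product *)

Section FreeProductEntropy.
Local Open Scope ereal_scope.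
Variables (R : realType) (I : finType) (Gam : I -> groupType).
Variables (alpha : I -> R) (mu : forall i, Gam i -> R).
Arguments mu : clear implicits.
Hypothesis steps : fp_steps alpha mu.
Hypothesis mu_gen : forall i, semigroup_generates [set g | mu i g != 0%R].
Hypothesis trans : transient_walk alpha mu.

Local Notation Gamma := (free_product Gam).
Local Notation nu := (fp_measure alpha mu).
Local Notation green := (green_real nu).

Let nu_prob : prob_mass nu := fp_measure_prob steps.
Let nu_gen : semigroup_generates [set x | nu x != 0%R] := fp_measure_gen steps mu_gen.
Let green_finite : green_fun nu 1 1%g < +oo := trans.1.
Let nu_ge0 x : (0 <= nu x)%R. Proof. exact: prob_mass_ge0. Qed.
Let law_nonneg := law_ge0 nu_prob.

Let one_oc : (0 < (1 : R) <= 1)%R. Proof. by rewrite ltr01 lexx. Qed.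
Let one_cc : (0 <= (1 : R) <= 1)%R. Proof. by rewrite ler01 lexx. Qed.

Let green_gt0 z x : (0 < z <= 1)%R -> (0 < green z x)%R.
Proof. exact: green_real_gt0. Qed.

Let green1_gt0 x : (0 < green 1 x)%R. Proof. exact: green_gt0. Qed.

Let green1K x : (green 1 x)%:E = green_fun nu 1 x.
Proof. exact: green_realK. Qed.

Section Factor.
Variable i : I.

Let mui_prob : prob_mass (mu i) := factor_prob steps i.
Let mui_ge0 g : 0 <= (mu i g)%:E. Proof. by rewrite lee_fin prob_mass_ge0. Qed.
Let alpha_gt0 : (0 < alpha i)%R := weight_gt0 steps i.

Definition return_prob : R := fine (return_mass nu (in_factor i)).
Definition factor_xi : R := (alpha i / (1 - return_prob))%R.

Let return_mass_fin : return_mass nu (in_factor i) \is a fin_num.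
Proof.
exact: ge0_fin_num_le (return_mass_ge0 nu_prob _) (ltW (trans.2 i)) (ltry _).
Qed.

Lemma return_prob_ge0 : (0 <= return_prob)%R.
Proof. by rewrite fine_ge0 ?return_mass_ge0. Qed.

Lemma return_prob_lt : (return_prob < 1 - alpha i)%R.
Proof. by rewrite -lte_fin fineK//; exact: trans.2. Qed.

Lemma one_sub_return_prob_gt0 : (0 < 1 - return_prob)%R.
Proof. by have := return_prob_lt; have := alpha_gt0; lra. Qed.

Lemma factor_xi_gt0 : (0 < factor_xi)%R.
Proof. exact: divr_gt0 one_sub_return_prob_gt0. Qed.

Lemma factor_xi_lt1 : (factor_xi < 1)%R.
Proof.
by rewrite ltr_pdivrMr ?one_sub_return_prob_gt0// mul1r; have := return_prob_lt; lra.
Qed.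

Lemma green_factor (g : Gam i) :
  ((1 - return_prob) * green 1 (fp_inj g))%:E = green_fun (mu i) factor_xi g.
Proof.
have denom0 := ltW one_sub_return_prob_gt0.
pose phi (g : Gam i) : \bar R := ((1 - return_prob) * green 1 (fp_inj g))%:E.
apply: (@green_fun_unique _ _ _ mui_prob _ (ltW factor_xi_gt0) phi
  ((1 - return_prob) * green 1 1%g)%R _ _ factor_xi_lt1) => h.
  rewrite !lee_fin mulr_ge0 ?(ltW (green1_gt0 _))//= ler_wpM2l//.
  exact: green_real_le.
rewrite /phi; have := green_factor_rec steps h.
rewrite -(fineK return_mass_fin) -/return_prob -green1K.
set step := walk_step _ _ _.
have step_ge0 : 0 <= step.
  by apply: (walk_step_ge0 mui_prob) => x; rewrite -green1K lee_fin ltW.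
have -> : walk_step (mu i) (fun g => ((1 - return_prob) * green 1 (fp_inj g))%:E) h =
    (1 - return_prob)%:E * step.
  rewrite -(walk_stepZ mui_prob)// => [|x]; last by rewrite -green1K lee_fin ltW.
  by apply: eq_walk_step => x; rewrite EFinM green1K.
have dirac0 := dirac_mass_ge0 R h; rewrite /dirac_mass in dirac0 *.
case: step step_ge0 => [w||]// w0; last first.
  by rewrite gt0_muley ?lte_fin//; case: ifP.
rewrite -!EFinM; case: ifP => _; rewrite -!EFinD => -[greenE]; congr (_%:E);
  rewrite /factor_xi mulrA divfK ?gt_eqF ?one_sub_return_prob_gt0//; lra.
Qed.

Definition head_limit (g : Gam i) : R :=
  ((1 - alpha i - return_prob) * green 1 (fp_inj g))%R.

Let escape_gt0 : (0 < 1 - alpha i - return_prob)%R.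
Proof. by have := return_prob_lt; lra. Qed.

Lemma head_limitE g :
  (head_limit g)%:E = (1 - factor_xi)%:E * green_fun (mu i) factor_xi g.
Proof.
rewrite -green_factor -EFinM; congr (_%:E); rewrite mulrA; congr (_ * _)%R.
by rewrite /factor_xi mulrBl mul1r divfK ?gt_eqF ?one_sub_return_prob_gt0//; ring.
Qed.

Lemma head_limit_gt0 g : (0 < head_limit g)%R.
Proof. by rewrite mulr_gt0. Qed.

Lemma head_limit_prob : prob_mass head_limit.
Proof.
have xi0 := ltW factor_xi_gt0.
have xi1 : (0 < 1 - factor_xi)%R by rewrite subr_gt0 factor_xi_lt1.
split; first by move=> g; exact/ltW/head_limit_gt0.
rewrite (eq_esum (fun g _ => head_limitE g)) esumZl ?lee_fin ?(ltW xi1)//; last first.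
  by move=> g _; exact: green_fun_ge0.
by rewrite esum_green_fun ?factor_xi_lt1// -EFinM mulfV// gt_eqF.
Qed.

Lemma head_limit_le g : (head_limit g <= green 1 (fp_inj g))%R.
Proof.
rewrite ler_piMl//; first exact: ltW.
by have := return_prob_ge0; have := alpha_gt0; lra.
Qed.

Lemma esum_green_factor :
  \esum_(g in [set: Gam i]) (green 1 (fp_inj g))%:E =
  ((1 - alpha i - return_prob)^-1)%:E.
Proof.
rewrite -[RHS](esum_prob_massZl head_limit_prob) ?lee_fin ?invr_ge0 ?ltW//.
by apply: eq_esum => g _; rewrite -EFinM mulrA mulVf ?mul1r// gt_eqF.
Qed.

Lemma excursion_mass_cvg : fine (excursion_mass nu (in_factor i) n) @[n --> \oo] -->
  (1 - alpha i - return_prob)%R.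
Proof.
pose ret k := fine (excursion_return nu (in_factor i) k).
have ret0 n := excursion_return_ge0 nu_prob (in_factor i) n.
have ret_fin n : excursion_return nu (in_factor i) n \is a fin_num.
  apply: ge0_fin_num_le (ret0 n) _ (lt_trans (trans.2 i) (ltry _)).
  exact: le_esum_term.
have ret_cvg : (\sum_(k < n) ret k)%R @[n --> \oo] --> return_prob.
  have : (\sum_(k < n) (ret k)%:E) @[n --> \oo] --> return_prob%:E.
    rewrite /return_prob fineK// /return_mass -nneseries_esumT//.
    under eq_fun do (under eq_bigr do rewrite fineK//; rewrite -(big_mkord xpredT)).
    exact: is_cvg_nneseries.
  by under eq_fun do rewrite sumEFin; move=> /fine_cvgP[].
rewrite -(cvg_shiftS (fun n => fine (excursion_mass nu (in_factor i) n))).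
have -> : (fun n => fine (excursion_mass nu (in_factor i) n.+1)) =
    (fun n => 1 - alpha i - \sum_(k < n.+2) ret k)%R.
  apply/funext => n; have := excursion_mass_sum steps i n.
  rewrite -(fineK (excursion_mass_fin steps i n.+1)).
  under eq_bigr do rewrite -(fineK (ret_fin _)).
  by rewrite sumEFin -!EFinD => -[<-]; ring.
apply: cvgB; first exact: cvg_cst.
rewrite (cvg_shiftS (fun n => \sum_(k < n.+1) ret k)%R).
by rewrite (cvg_shiftS (fun n => \sum_(k < n) ret k)%R).
Qed.

Definition head_prob n (g : Gam i) : R := fine (head_law alpha mu n g).

Lemma head_probK n g : (head_prob n g)%:E = head_law alpha mu n g.
Proof. by rewrite fineK ?head_law_fin. Qed.

Lemma head_prob_ge0 n g : (0 <= head_prob n g)%R.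
Proof. by rewrite fine_ge0 ?head_law_ge0. Qed.

Let esum_law_green x : \esum_(k in [set: nat]) (fine (law nu k x))%:E = (green 1 x)%:E.
Proof.
by rewrite green1K green_fun1E; apply: eq_esum => k _; rewrite fineK ?law_fin.
Qed.

Lemma head_prob_le n g : (head_prob n g <= green 1 (fp_inj g))%R.
Proof.
rewrite -lee_fin head_probK head_lawE// green1K green_fun1E.
apply: le_trans (esum_nat_ge n.+1 (fun k => law_nonneg k (fp_inj g))).
apply: lee_sum => k _; rewrite -[leRHS]mule1 lee_wpmul2l//.
exact: excursion_mass_le1.
Qed.

Lemma head_prob_cvg g : head_prob n g @[n --> \oo] --> head_limit g.
Proof.
have mass0 k := excursion_mass_ge0 nu_prob (in_factor i) k.
have mass_fin := excursion_mass_fin steps i.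
have head_cvg : \sum_(k < n.+1) (fine (law nu k (fp_inj g)) *
      fine (excursion_mass nu (in_factor i) (n - k)))%:E @[n --> \oo] -->
    \esum_(k in [set: nat])
      (fine (law nu k (fp_inj g)) * (1 - alpha i - return_prob))%:E.
  apply: (cvg_convolution _ _ _ excursion_mass_cvg).
  - by move=> k; rewrite fine_ge0.
  - move=> k; rewrite fine_ge0//= -lee_fin fineK//.
    exact: excursion_mass_le1.
  - by rewrite esum_law_green ltry.
suff : (head_prob n g)%:E @[n --> \oo] --> (head_limit g)%:E by case/fine_cvgP.
have -> : (head_limit g)%:E = \esum_(k in [set: nat])
    (fine (law nu k (fp_inj g)) * (1 - alpha i - return_prob))%:E.
  rewrite /head_limit mulrC EFinM -esum_law_green -esumZr ?lee_fin ?(ltW escape_gt0)//.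
  by move=> k _; rewrite lee_fin fine_ge0.
apply: cvg_trans head_cvg; apply: near_eq_cvg; apply: nearW => n /=.
rewrite head_probK head_lawE//; apply: eq_bigr => k _.
by rewrite EFinM !fineK ?law_fin.
Qed.

Lemma green_real_cone z x : (0 <= z <= 1)%R ->
  (green z x * green z 1%g = green z (fp_inj (fp_head i x)) * green z (fp_tail i x))%R.
Proof.
move=> z01; have z0 : (0 <= z)%R by case/andP: z01.
apply: EFin_inj; rewrite 2!EFinM /green_real !fineK ?green_fun_fin//.
rewrite (green_fun_first_visit nu_prob z0 (fun n =>
  avoiding_cone alpha mu n (erefl (fp_head i x)))).
rewrite [X in _ = X * _](green_funE nu_prob z0) -!muleA.
by congr (_ * _); rewrite muleC.
Qed.

Lemma slack_fp_inj z (g : Gam i) x : (0 < z <= 1)%R ->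
  slack nu z (fp_inj g) x = slack nu z (fp_inj g) (fp_inj (fp_head i x)).
Proof.
move=> z01; have zcc : (0 <= z <= 1)%R by case/andP: z01 => /ltW -> ->.
have ln_cone y : (ln (green z y) + ln (green z 1%g) =
    ln (green z (fp_inj (fp_head i y))) + ln (green z (fp_tail i y)))%R.
  by rewrite -!lnM ?posrE ?green_gt0// green_real_cone.
have := ln_cone x; have := ln_cone (fp_inj g * x)%g.
rewrite fp_head_injM fp_tail_injM fp_injM /slack /green_dist; lra.
Qed.

Definition slack_term (z : R) (q : Gam i -> R) (p : Gam i * Gam i) : R :=
  (nu (fp_inj p.1) * q p.2 * slack nu z (fp_inj p.1) (fp_inj p.2))%R.

Definition mean_head_slack (z : R) (q : Gam i -> R) : \bar R :=
  \esum_(p in [set: (Gam i * Gam i)%type]) (slack_term z q p)%:E.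

Lemma slack_term_ge0 z q p : (0 < z <= 1)%R -> (forall g, 0 <= q g)%R ->
  (0 <= slack_term z q p)%R.
Proof. by move=> z01 q0; rewrite /slack_term mulrAC mulr_ge0// mul_slack_ge0. Qed.

Lemma mean_head_slack_ge0 z q : (0 < z <= 1)%R -> (forall g, 0 <= q g)%R ->
  0 <= mean_head_slack z q.
Proof. by move=> z01 q0; apply: esum_ge0 => p _; rewrite lee_fin slack_term_ge0. Qed.

Lemma mean_head_slackE z n : (0 < z <= 1)%R ->
  mean_head_slack z (head_prob n) =
  \esum_(g in [set: Gam i]) \esum_(x in [set: Gamma])
    (law nu n x * (nu (fp_inj g) * slack nu z (fp_inj g) x)%:E).
Proof.
move=> z01; rewrite /mean_head_slack.
rewrite -(esum_pair (a := fun g h => (slack_term z (head_prob n) (g, h))%:E)).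
  apply: eq_esum => g _; under [RHS]eq_esum do rewrite slack_fp_inj//.
  rewrite -(esum_head_law_mul steps n (F := fun h =>
    (nu (fp_inj g) * slack nu z (fp_inj g) (fp_inj h))%:E)); last first.
    by move=> h; rewrite lee_fin mul_slack_ge0.
  by apply: eq_esum => h _; rewrite -head_probK -EFinM /slack_term /= mulrCA mulrA.
by move=> g h; rewrite lee_fin slack_term_ge0// => k; exact: head_prob_ge0.
Qed.

Definition factor_cost : \bar R :=
  \esum_(g in [set: Gam i]) (nu (fp_inj g) * step_cost nu 1 (fp_inj g))%:E.

Lemma factor_cost_ge0 : 0 <= factor_cost.
Proof. by apply: esum_ge0 => g _; rewrite lee_fin mul_step_cost_ge0. Qed.

Hypothesis mui_entropy : shannon (mu i) < +oo.

Lemma factor_cost_fin : factor_cost \is a fin_num.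
Proof.
have ln_alpha0 : (0 <= - ln (alpha i))%R.
  by rewrite oppr_ge0 ln_le0// (weight_le1 steps).
have alpha_ln0 := mulr_ge0 (ltW alpha_gt0) ln_alpha0.
have -> : factor_cost = (alpha i)%:E * shannon (mu i) + (alpha i * - ln (alpha i))%:E.
  rewrite -[X in _ + X](esum_prob_massZl mui_prob)//.
  rewrite -esumZl ?lee_fin ?(ltW alpha_gt0)//.
    rewrite -esumD.
    - apply: eq_esum => g _; rewrite -!EFinM -EFinD; congr (_%:E).
      rewrite (fp_measure_inj steps) /step_cost mul1r (fp_measure_inj steps).
      have [->|mug] := eqVneq (mu i g) 0%R.
        by rewrite !(mulr0, mul0r, oppr0, addr0).
      by rewrite lnM ?posrE// ?prob_mass_gt0//; ring.
    - by move=> g _; rewrite -EFinM lee_fin mulr_ge0 ?entropy_term_ge0// ltW.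
    - by move=> g _; rewrite mule_ge0.
  by move=> g _; rewrite lee_fin entropy_term_ge0.
rewrite fin_numD andbT fin_numM// ge0_fin_numE// shannon_ge0//.
Qed.

Let slack_bound (p : Gam i * Gam i) : R :=
  (nu (fp_inj p.1) * green 1 (fp_inj (p.1 * p.2)%g) +
   nu (fp_inj p.1) * step_cost nu 1 (fp_inj p.1) * green 1 (fp_inj p.2))%R.

Let slack_term_le (q : Gam i -> R) p :
  (forall g, 0 <= q g <= green 1 (fp_inj g))%R -> (slack_term 1 q p <= slack_bound p)%R.
Proof.
move=> q_bounded; have /andP[q0 q_le] := q_bounded p.2.
set a := green 1 (fp_inj (p.1 * p.2)%g); set b := green 1 (fp_inj p.2).
have a0 : (0 < a)%R by exact: green1_gt0.
have b0 : (0 < b)%R by exact: green1_gt0.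
have cost0 := step_cost_ge0 nu_prob (fp_inj p.1) one_cc.
have q_ln : (q p.2 * (ln a - ln b) <= a)%R.
  rewrite -ln_div ?posrE//; apply: (@le_trans _ _ (b * (a / b))%R); last first.
    by rewrite mulrCA divff ?mulr1// gt_eqF.
  apply: (@le_trans _ _ (q p.2 * (a / b))%R).
    by rewrite ler_wpM2l// ltW// ln_sublinear// divr_gt0.
  by rewrite ler_wpM2r// divr_ge0// ltW.
set cost := step_cost nu 1 (fp_inj p.1) in cost0 *.
have q_cost : (q p.2 * cost <= b * cost)%R.
  by rewrite ler_wpM2r.
rewrite /slack_bound -/a -/b -[X in (_ + X)%R]mulrA -mulrDr /slack_term.
rewrite -mulrA ler_wpM2l// /slack /green_dist -fp_injM -/a -/b; lra.
Qed.

Let esum_slack_bound :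
  \esum_(p in [set: (Gam i * Gam i)%type]) (slack_bound p)%:E < +oo.
Proof.
have green0 x : (0 <= green 1 x)%R by exact/ltW/green1_gt0.
have cost0 g : (0 <= nu (fp_inj g : Gamma) * step_cost nu 1 (fp_inj g : Gamma))%R.
  exact: mul_step_cost_ge0.
rewrite -(esum_pair (a := fun g h => (slack_bound (g, h))%:E)); last first.
  by move=> g h; rewrite lee_fin; apply: addr_ge0; apply: mulr_ge0 => //=.
set total := ((1 - alpha i - return_prob)^-1)%:E.
have total0 : 0 <= total by rewrite lee_fin invr_ge0 ltW.
rewrite (eq_esum (b := fun g => (nu (fp_inj g))%:E * total +
    (nu (fp_inj g) * step_cost nu 1 (fp_inj g))%:E * total)); last first.
  move=> g _.
  under eq_esum do rewrite /slack_bound /= EFinD EFinM [X in _ + X]EFinM fp_injM.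
  rewrite esumD; last 2 first.
  - by move=> h _; rewrite mule_ge0 ?lee_fin.
  - by move=> h _; rewrite mule_ge0 ?lee_fin.
  rewrite !esumZl ?lee_fin// ?esum_green_factor; try by move=> h _; rewrite lee_fin.
  congr (_ * _ + _); rewrite /total -esum_green_factor -[RHS](esum_mulgl g).
  by apply: eq_esum => h _; rewrite fp_injM.
rewrite esumD; last 2 first.
- by move=> g _; rewrite mule_ge0 ?lee_fin.
- by move=> g _; rewrite mule_ge0 ?lee_fin.
rewrite [X in _ + X](esumZr total0); last first.
  by move=> g _; rewrite lee_fin.
under [X in X + _]eq_esum do rewrite (fp_measure_inj steps).
rewrite (esum_factor_steps steps)// -/factor_cost -(fineK factor_cost_fin).
by rewrite -!EFinM -EFinD ltry.
Qed.

Let head_limit_ge0 g : (0 <= head_limit g)%R. Proof. exact/ltW/head_limit_gt0. Qed.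

Lemma mean_head_slack_fin : mean_head_slack 1 head_limit \is a fin_num.
Proof.
apply: ge0_fin_num_le esum_slack_bound; first exact: mean_head_slack_ge0.
apply: le_esum => p _; rewrite lee_fin; apply: slack_term_le => g.
by rewrite head_limit_ge0 head_limit_le.
Qed.

Lemma mean_head_slack_cvg :
  mean_head_slack 1 (head_prob n) @[n --> \oo] --> mean_head_slack 1 head_limit.
Proof.
apply: (esum_dominated (g := slack_bound) _ _ esum_slack_bound).
- apply: nearW => n p; rewrite slack_term_ge0//=; last first.
    by move=> g; exact: head_prob_ge0.
  by apply: slack_term_le => g; rewrite head_prob_ge0 head_prob_le.
- move=> p; apply: cvgM; last exact: cvg_cst.
  by apply: cvgM; [exact: cvg_cst|exact: head_prob_cvg].
Qed.

Let slack_term_cvg (q : Gam i -> R) p :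
  slack_term z q p @[z --> 1%R^'-] --> slack_term 1 q p.
Proof.
rewrite /slack_term; have [->|nug] := eqVneq (nu (fp_inj p.1)) 0%R.
  by under eq_fun do rewrite !mul0r; rewrite !mul0r; exact: cvg_cst.
have ln_cvg x : ln (green z x) @[z --> 1%R^'-] --> ln (green 1 x).
  apply: (continuous_cvg _ (h := @ln R)); last exact: green_real_cvg.
  by apply: continuous_ln; exact: green1_gt0.
have dist_cvg x : green_dist nu z x @[z --> 1%R^'-] --> green_dist nu 1 x.
  by apply: cvgB; exact: ln_cvg.
apply: cvgM; first exact: cvg_cst.
apply: cvgB; last exact: dist_cvg.
apply: cvgD; last exact: dist_cvg.
apply: cvgN; apply: (continuous_cvg _ (h := @ln R)).
  by apply: continuous_ln; rewrite mul1r prob_mass_gt0.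
by apply: cvgM; [apply: cvg_at_left_filter; exact: cvg_id|exact: cvg_cst].
Qed.

Lemma mean_head_slack_near (c : R) : c%:E < mean_head_slack 1 head_limit ->
  \forall z \near 1%R^'-, \forall n \near \oo, c%:E < mean_head_slack z (head_prob n).
Proof.
move=> c_lt; have near_z : \forall z \near 1%R^'-, c%:E < mean_head_slack z head_limit.
  apply: (esum_fatou (l := fun p => (slack_term 1 head_limit p)%:E)) => //.
    apply: filterS (near_left1 R) => z /andP[z0 /ltW z1] p.
    by rewrite lee_fin slack_term_ge0// z0.
  by move=> p; apply: cvg_EFin; [exact: nearW|exact: slack_term_cvg].
apply: filterS (filterI near_z (near_left1 R)) => z [c_z /andP[z0 /ltW z1]].
apply: (esum_fatou (l := fun p => (slack_term z head_limit p)%:E)) => //.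
  apply: nearW => n p; rewrite lee_fin slack_term_ge0 ?z0// => g.
  exact: head_prob_ge0.
move=> p; apply: cvg_EFin; first exact: nearW.
apply: cvgM; last exact: cvg_cst.
by apply: cvgM; [exact: cvg_cst|exact: head_prob_cvg].
Qed.

End Factor.

Local Notation limit_slack i := (mean_head_slack 1 (@head_limit i)).

Lemma shannon_fp_measure : shannon nu = \sum_(i : I) factor_cost i.
Proof.
have := esum_step_cost nu_prob one_oc; rewrite ln1 oppr0 adde0 => <-.
rewrite (esum_fp_support (alpha := alpha) (mu := mu))// => x; last first.
  by move=> ->; rewrite mul0r.
by rewrite lee_fin mul_step_cost_ge0.
Qed.

Lemma mean_slack_fp z n : (0 < z <= 1)%R ->
  mean_slack nu z n = \sum_(i : I) mean_head_slack z (@head_prob i n).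
Proof.
move=> z01; rewrite /mean_slack.
rewrite (esum_fp_support (alpha := alpha) (mu := mu)) => [||x nux].
- by apply: eq_bigr => i _; rewrite mean_head_slackE.
- by move=> x; apply: esum_ge0 => y _; rewrite mule_ge0 ?lee_fin ?mul_slack_ge0.
- by apply: esum1 => y _; rewrite nux mul0r mule0.
Qed.

Hypothesis mu_entropy : forall i, shannon (mu i) < +oo.

Let limit_slack_fin i : limit_slack i \is a fin_num.
Proof. exact: mean_head_slack_fin. Qed.

Let slack_limit : R := (\sum_(i : I) fine (limit_slack i))%R.

Let mean_slack_cvg : mean_slack nu 1 n @[n --> \oo] --> slack_limit%:E.
Proof.
rewrite /slack_limit -sumEFin (eq_bigr (fun i => limit_slack i)); last first.
  by move=> i _; rewrite fineK.
under eq_fun do rewrite mean_slack_fp//.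
apply: (@cvg_nnesum _ _ _ _ _ _ (fun i n => mean_head_slack 1 (@head_prob i n))).
  move=> i _; apply: nearW => n; apply: mean_head_slack_ge0 => // g.
  exact: head_prob_ge0.
by move=> i _; exact: mean_head_slack_cvg.
Qed.

Let mean_slack_near (e : R) : (0 < e)%R -> \forall z \near 1%R^'-,
  \forall n \near \oo, (slack_limit - e)%:E <= mean_slack nu z n.
Proof.
move=> e0; pose d : R := (e / (#|I|%:R + 1))%R.
have I1 : (0 < #|I|%:R + 1 :> R)%R by rewrite ltr_wpDl.
have d0 : (0 < d)%R by rewrite divr_gt0.
have near_factors : \forall z \near 1%R^'-, forall i, \forall n \near \oo,
    (fine (limit_slack i) - d)%:E < mean_head_slack z (@head_prob i n).
  apply: filter_forall => i; apply: mean_head_slack_near => //.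
  by rewrite -[ltRHS]fineK// lte_fin gtrBl.
apply: filterS (filterI near_factors (near_left1 R)) => z [near_n /andP[z0 /ltW z1]].
have : \forall n \near \oo, forall i,
    (fine (limit_slack i) - d)%:E < mean_head_slack z (@head_prob i n).
  by apply: filter_forall.
apply: filterS => n slack_n; rewrite mean_slack_fp ?z0//.
apply: (@le_trans _ _ (\sum_(i : I) (fine (limit_slack i) - d)%:E)); last first.
  by apply: lee_sum => i _; exact/ltW/slack_n.
rewrite sumEFin lee_fin sumrB lerD2l lerN2 sumr_const -[leLHS]mulr_natl /d.
by rewrite mulrCA ger_pMr// ler_pdivrMr// mul1r lerDl.
Qed.

Theorem free_product_entropy_rate :
  (n%:R^-1)%:E * shannon (fun x => fine (law nu n x)) @[n --> \oo] -->
  (\sum_(i : I) (fine (factor_cost i) - fine (limit_slack i))%R)%:E.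
Proof.
have cost_fin i : factor_cost i \is a fin_num by exact: factor_cost_fin.
have entropy_finite : shannon nu < +oo.
  rewrite shannon_fp_measure; apply: lte_sum_pinfty => i _.
  by rewrite -ge0_fin_numE ?factor_cost_ge0.
have := entropy_rate nu_prob nu_gen green_finite entropy_finite mean_slack_cvg
  mean_slack_near.
by rewrite shannon_fp_measure -sum_fine// sumrB.
Qed.

Section Formula.
Variables (F : forall i, Gam i -> R) (Goo : I -> R).
Arguments F : clear implicits.
Hypothesis FE : forall i g, (F i g)%:E = hitting_fun (mu i) (factor_xi i) g.
Hypothesis GooE : forall i, (Goo i)%:E = green_fun (mu i) (factor_xi i) 1%g.

Let mu_prob i : prob_mass (mu i) := factor_prob steps i.
Let alpha_gt0 i : (0 < alpha i)%R := weight_gt0 steps i.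

Definition head_weight i : R := ((1 - factor_xi i) * Goo i)%R.

Lemma head_limit_first_passage i g : head_limit g = (head_weight i * F i g)%R.
Proof.
apply: EFin_inj; rewrite head_limitE (green_funE (mu_prob i) (ltW (factor_xi_gt0 i))).
by rewrite -FE -GooE -!EFinM; congr (_%:E); rewrite /head_weight; ring.
Qed.

Lemma head_limit1 i : head_limit (1%g : Gam i) = head_weight i.
Proof. by apply: EFin_inj; rewrite head_limitE -GooE. Qed.

Lemma head_weight_gt0 i : (0 < head_weight i)%R.
Proof. by rewrite -head_limit1 head_limit_gt0. Qed.

Let first_passage_gt0 i g : (0 < F i g)%R.
Proof.
rewrite -(pmulr_rgt0 _ (head_weight_gt0 i)) -head_limit_first_passage.
exact: head_limit_gt0.
Qed.

Let first_passage1 i : F i 1%g = 1%R.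
Proof.
apply: (mulfI (lt0r_neq0 (head_weight_gt0 i))).
by rewrite -head_limit_first_passage head_limit1 mulr1.
Qed.

Lemma slack_first_passage i (g h : Gam i) :
  slack nu 1 (fp_inj g) (fp_inj h) =
  (step_cost nu 1 (fp_inj g) + ln (F i (g * h)%g / F i h))%R.
Proof.
have escape_gt0 : (0 < 1 - alpha i - return_prob i)%R.
  by have := return_prob_lt i; lra.
have lnF k : (ln (head_weight i) + ln (F i k) =
    ln (1 - alpha i - return_prob i) + ln (green 1 (fp_inj k)))%R.
  by rewrite -!lnM ?posrE ?head_weight_gt0// -head_limit_first_passage.
have := lnF h; have := lnF (g * h)%g.
rewrite ln_div ?posrE// /slack /green_dist fp_injM; lra.
Qed.

Definition limit_slack_at i (g : Gam i) : \bar R :=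
  \esum_(h in [set: Gam i]) (head_limit h * slack nu 1 (fp_inj g) (fp_inj h))%:E.

Let head_limit_ge0 i (g : Gam i) : (0 <= head_limit g)%R.
Proof. exact/ltW/head_limit_gt0. Qed.

Let nu_inj_gt0 i (g : Gam i) : (0 < nu (fp_inj g))%R = (0 < mu i g)%R.
Proof. by rewrite (fp_measure_inj steps) pmulr_rgt0. Qed.

Let slack_mass_ge0 i (g h : Gam i) : (0 < mu i g)%R ->
  (0 <= head_limit h * slack nu 1 (fp_inj g) (fp_inj h))%R.
Proof. by move=> mug; rewrite mulr_ge0 ?slack_ge0// nu_inj_gt0. Qed.

Lemma limit_slack_sum i : limit_slack i =
  \esum_(g in [set: Gam i]) ((nu (fp_inj g))%:E * limit_slack_at g).
Proof.
rewrite /mean_head_slack -(esum_pair (a := fun g h =>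
    (slack_term 1 (@head_limit i) (g, h))%:E)); last first.
  by move=> g h; rewrite lee_fin slack_term_ge0.
apply: eq_esum => g _; rewrite /slack_term /=.
have [->|nug] := eqVneq (nu (fp_inj g)) 0%R.
  by rewrite mul0e esum1// => h _; rewrite !mul0r.
rewrite -esumZl ?lee_fin//.
  by apply: eq_esum => h _; rewrite -EFinM [in RHS]mulrA.
by move=> h _; rewrite lee_fin slack_mass_ge0// -nu_inj_gt0 prob_mass_gt0.
Qed.

Lemma limit_slack_at_ge0 i (g : Gam i) : (0 < mu i g)%R -> 0 <= limit_slack_at g.
Proof. by move=> mug; apply: esum_ge0 => h _; rewrite lee_fin slack_mass_ge0. Qed.

Lemma limit_slack_at_fin i (g : Gam i) : (0 < mu i g)%R ->
  limit_slack_at g \is a fin_num.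
Proof.
move=> mug; have nug : (0 < nu (fp_inj g))%R by rewrite nu_inj_gt0.
have : (nu (fp_inj g))%:E * limit_slack_at g <= limit_slack i.
  rewrite limit_slack_sum.
  exact: (le_esum_term (fun g => (nu (fp_inj g))%:E * limit_slack_at g)).
rewrite -(fineK (limit_slack_fin i)).
case: (limit_slack_at g) (limit_slack_at_ge0 mug) => //.
by rewrite gt0_muley ?lte_fin.
Qed.

(* The paper's [\mathcal F(g)]. *)
Definition mean_log_ratio i (g : Gam i) : \bar R := usum [set g' : Gam i | g' <> 1%g]
  (fun g' => (F i g' * ln (F i (g * g')%g / F i g'))%:E).

Lemma log_ratio_slackE i (g : Gam i) : (0 < mu i g)%R ->
  (head_weight i * ln (F i g))%:E + (head_weight i)%:E * mean_log_ratio g =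
  (fine (limit_slack_at g) - step_cost nu 1 (fp_inj g))%:E.
Proof.
move=> mug; set cost := step_cost nu 1 (fp_inj g).
have cost0 : (0 <= cost)%R by rewrite step_cost_ge0.
pose p (h : Gam i) := (head_limit h * slack nu 1 (fp_inj g) (fp_inj h))%R.
pose q (h : Gam i) := (head_limit h * cost)%R.
have p0 h : (0 <= p h)%R by exact: slack_mass_ge0.
have q0 h : (0 <= q h)%R by rewrite mulr_ge0.
have q_sum : \esum_(h in [set: Gam i]) (q h)%:E = cost%:E.
  by under eq_esum do rewrite EFinM; rewrite (esum_prob_massZr (head_limit_prob i)).
pose off (f : Gam i -> R) := \esum_(h in [set h | h <> 1%g]) (f h)%:E.
have split1 f : (forall h, 0 <= f h)%R -> \esum_(h in [set: Gam i]) (f h)%:E < +oo ->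
    [/\ off f < +oo, off f \is a fin_num &
    fine (off f) = (fine (\esum_(h in [set: Gam i]) (f h)%:E) - f 1%g)%R].
  move=> f0; have off0 : 0 <= off f by apply: esum_ge0 => h _; rewrite lee_fin.
  rewrite (esumD1 1%g)// -/(off f); case: (off f) off0 => [a||]//= _ _.
  by split; rewrite ?ltry// addrC addrK.
have [|p_lty p_fin pE] := split1 p p0.
  by rewrite -/(limit_slack_at g) -ge0_fin_numE ?limit_slack_at_fin ?limit_slack_at_ge0.
have [|q_lty q_fin qE] := split1 q q0; first by rewrite q_sum ltry.
have -> : (head_weight i)%:E * mean_log_ratio g = off p - off q.
  rewrite /mean_log_ratio usumZl ?head_weight_gt0// -usumB//.
  congr usum; apply/funext => h; rewrite -EFinM mulrA -head_limit_first_passage.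
  by rewrite /p /q slack_first_passage; congr (_%:E); ring.
rewrite -(fineK p_fin) -(fineK q_fin) pE qE q_sum -/(limit_slack_at g) -EFinB -EFinD.
congr (_%:E); rewrite /p /q head_limit1 slack_first_passage mulg1 first_passage1.
by rewrite divr1 /= -/cost; ring.
Qed.

Lemma usum_log_ratioE i :
  usum [set: Gam i] (fun g => (alpha i * mu i g)%:E *
    ((head_weight i * ln (F i g))%:E + (head_weight i)%:E * mean_log_ratio g)) =
  (fine (limit_slack i) - fine (factor_cost i))%:E.
Proof.
pose s (g : Gam i) := (nu (fp_inj g) * fine (limit_slack_at g))%R.
pose c (g : Gam i) := (nu (fp_inj g) * step_cost nu 1 (fp_inj g))%R.
have nu0E g : ~~ (0 < mu i g)%R -> nu (fp_inj g) = 0%R.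
  by rewrite -nu_inj_gt0 prob_mass_gt0// negbK => /eqP.
have s0 g : (0 <= s g)%R.
  rewrite /s; have [mug|/nu0E->] := boolP (0 < mu i g)%R; last by rewrite mul0r.
  by rewrite mulr_ge0// fine_ge0// limit_slack_at_ge0.
have s_sum : \esum_(g in [set: Gam i]) (s g)%:E = limit_slack i.
  rewrite limit_slack_sum; apply: eq_esum => g _; rewrite /s.
  have [mug|/nu0E->] := boolP (0 < mu i g)%R; last by rewrite mul0r mul0e.
  by rewrite EFinM fineK ?limit_slack_at_fin.
have cost_fin : factor_cost i \is a fin_num by exact: factor_cost_fin.
rewrite EFinB !fineK// -s_sum -usumB//.
- congr usum; apply/funext => g; rewrite /s -(fp_measure_inj steps).
  have [mug|/nu0E->] := boolP (0 < mu i g)%R; last by rewrite mul0e !mul0r subrr.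
  by rewrite log_ratio_slackE// -EFinM mulrBr.
- by move=> g; exact: mul_step_cost_ge0.
- by rewrite s_sum -ge0_fin_numE// mean_head_slack_ge0.
- by rewrite -/(factor_cost i) -ge0_fin_numE ?factor_cost_ge0.
Qed.

Theorem free_product_entropy_formula :
  (n%:R^-1)%:E * shannon (fun x => fine (law nu n x)) @[n --> \oo] -->
  - (\sum_(i : I) usum [set: Gam i] (fun g => (alpha i * mu i g)%:E *
    ((head_weight i * ln (F i g))%:E + (head_weight i)%:E * mean_log_ratio g))).
Proof.
rewrite (eq_bigr _ (fun i _ => usum_log_ratioE i)) sumEFin -EFinN -sumrN.
under eq_bigr do rewrite opprB.
exact: free_product_entropy_rate.
Qed.

End Formula.
End FreeProductEntropy.

Section ReturnEvents.
Local Open Scope ereal_scope.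
Variables (R : realType) (I : finType) (Gam : I -> groupType).
Variables (alpha : I -> R) (mu : forall i, Gam i -> R).
Arguments mu : clear implicits.
Hypothesis steps : fp_steps alpha mu.

Local Notation nu := (fp_measure alpha mu).
Let nu_prob : prob_mass nu := fp_measure_prob steps.

Context {d : measure_display} {T : measurableType d}.
Variables (P : probability T R) (X : nat -> T -> free_product Gam).
Hypothesis FP_countable : countable [set: free_product Gam].
Hypothesis X_walk : random_walk P nu 1%g X.
Variable i : I.

(* A path that leaves [1] through another factor re-enters the factor [i] only
   at [1], so avoiding [1] after such a first step is the same as avoiding the
   whole factor. *)
Let off_factor_start (k : nat) (x : free_product Gam) : bool :=
  (k == 0)%N || ((x != 1%g) && ((k == 1)%N ==> ~~ in_factor i x)).

Let restricted_excursion n :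
  restricted_law nu off_factor_start n = excursion nu (in_factor i) n.
Proof.
elim: n => [|n IH]; first by [].
apply/funext => x; rewrite excursionS /= IH /off_factor_start /=.
have [->|xN1] := eqVneq x 1%g; first by rewrite in_factor1.
case: n {IH} => [|n] /=; first by case: in_factor.
by case: ifPn => // xi; rewrite walk_step_excursion_in_factor.
Qed.

Lemma prob_excursion_return n :
  P (return_time X 1%g n `&` [set w | ~ factor_nontriv i (X 1%N w)]) =
  excursion_return nu (in_factor i) n.
Proof.
case: n => [|n] /=.
  by rewrite -[RHS](measure0 P); congr (P _); rewrite -subset0 => w /= [[]].
rewrite -restricted_excursion -(prob_restricted_step FP_countable nu_prob X_walk).
congr (P _); apply/seteqP; split => w /=.
  move=> [[_ wn wN] w1]; split => // -[//|k kn]; rewrite /off_factor_start /=.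
  have /eqP kN1 : X k.+1 w <> 1%g by exact: wN.
  rewrite kN1 /=; case: k kn kN1 => //= _ kN1; apply/negP => /in_factorP[g wg].
  apply: w1; exists g => //= g1; move: kN1; rewrite wg g1.
  by rewrite fp_inj1 eqxx.
move=> [wA wn]; split.
  split => // -[//|k] kn; apply/eqP.
  by have /andP[] := wA k.+1 kn.
move=> [g /= gN1 wg]; case: n wA wn => [|n] wA wn.
  apply: gN1; apply: (@fp_inj_inj _ _ i); rewrite fp_inj1.
  by rewrite wg.
by have /andP[_ /negP] := wA 1%N isT; apply; rewrite -wg in_factor_inj.
Qed.

Lemma xiE : transient_walk alpha mu -> xi alpha P X i 1 = factor_xi alpha mu i.
Proof.
move=> trans; have return_lty := lt_trans (trans.2 i) (ltry _).
have ret0 n := excursion_return_ge0 nu_prob (in_factor i) n.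
have sum_return : \esum_(n in [set: nat])
    ((1 ^+ n)%:E * excursion_return nu (in_factor i) n) = return_mass nu (in_factor i).
  by apply: eq_esum => n _; rewrite expr1n mul1e.
rewrite /xi /factor_xi mulr1; congr (_ / (1 - _))%R; apply: EFin_inj.
rewrite /Hbar; under [X in gen_fun X]eq_fun do rewrite prob_excursion_return.
rewrite gen_funE ?sum_return//.
- by rewrite fineK// ge0_fin_numE// return_mass_ge0.
- by move=> n; apply: ge0_fin_num_le (ret0 n) _ return_lty; exact: le_esum_term.
Qed.

End ReturnEvents.

Theorem theorem5p1 (R : realType) (r : nat) (Gam : 'I_r -> groupType)
  (mu : forall i : 'I_r, Gam i -> R) (alpha : 'I_r -> R)
  (d : measure_display) (Om : measurableType d) (P : probability Om R)
  (X : nat -> Om -> free_product Gam)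
  (d' : 'I_r -> measure_display) (Om' : forall i : 'I_r, measurableType (d' i))
  (P' : forall i : 'I_r, probability (Om' i) R)
  (Y : forall i : 'I_r, nat -> Om' i -> Gam i)
  (hr : (2 <= r)%N)
  (hfg : forall i, finitely_generated (Gam i))
  (hmu : forall i, prob_mass (mu i))
  (hmu1 : forall i, mu i 1%g = 0)
  (hsupp : forall i, semigroup_generates [set g | mu i g != 0])
  (hexcl : ~ (r = 2%N /\ forall i, ([set: Gam i] #= `I_2)%card))
  (halpha : forall i, 0 < alpha i)
  (halpha1 : \sum_(i < r) alpha i = 1)
  (hX : random_walk P (fp_measure alpha mu) 1%g X)
  (hY : forall i, random_walk (P' i) (mu i) 1%g (Y i))
  (hent : forall i, (shannon (mu i) < +oo)%E) :
  let xi1 (i : 'I_r) : R := xi alpha P X i 1 in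
  let F (i : 'I_r) (g : Gam i) : R := first_passage (P' i) (Y i) g (xi1 i) in
  let Goo (i : 'I_r) : R := green (P' i) (Y i) 1%g (xi1 i) in
  let varrho (i : 'I_r) : R := 1 - (1 - xi1 i) * Goo i in
  let calF (i : 'I_r) (g : Gam i) : \bar R :=
    usum [set g' : Gam i | g' <> 1%g]
      (fun g' => (F i g' * ln (F i (g * g')%g / F i g'))%:E) in
  (fun n : nat => (n%:R^-1)%:E * mean_neg_log P X n)%E @ \oo -->
  (- (\sum_(i < r) usum [set: Gam i] (fun g =>
        (alpha i * mu i g)%:E *
        (((1 - varrho i) * ln (F i g))%:E
         + ((1 - xi1 i) * Goo i)%:E * calF i g))))%E.
Proof.
move=> xi1 F Goo varrho calF.
have steps : fp_steps alpha mu by [].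
have Gam_countable i := finitely_generated_countable (hfg i).
have fp_countable := free_product_countable Gam_countable.
have trans : transient_walk alpha mu.
  by apply: (free_product_transient steps hsupp); rewrite card_ord.
have xi1E i : xi1 i = factor_xi alpha mu i.
  exact: (xiE steps fp_countable hX).
have xi01 i : 0 <= xi1 i <= 1.
  by rewrite xi1E !ltW ?(factor_xi_gt0 steps trans) ?(factor_xi_lt1 steps trans).
have FE i g : (F i g)%:E = hitting_fun (mu i) (factor_xi alpha mu i) g.
  by rewrite -xi1E; exact: (first_passageE (Gam_countable i) (hmu i) (hY i)).
have GooE i : (Goo i)%:E = green_fun (mu i) (factor_xi alpha mu i) 1%g.
  rewrite -xi1E; apply: (greenE (Gam_countable i) (hmu i) (hY i)).
    by case/andP: (xi01 i).
  by rewrite xi1E -(green_factor steps hsupp trans) ltry.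
have := free_product_entropy_formula steps hsupp trans hent FE GooE.
under eq_fun do rewrite -(mean_neg_logE fp_countable (fp_measure_prob steps) hX).
congr (_ --> - _)%E; apply: eq_bigr => i _; congr usum; apply/funext => g.
by rewrite /varrho opprB addrCA subrr addr0 /head_weight -xi1E.
Qed.
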